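(* Let $X$ be a Banach space and put $\kappa:=\operatorname{dens}(X)$. Then the following conditions are equivalent. (i) $X$ is a WCG space. (ii) There exist a projectional skeleton $\mathfrak{s}=(P_s)_{s\in\Gamma}$ on $X$ and a non-empty set $\mathcal{A}\subset B_X$ such that: (a) $\mathcal{A}$ is linearly dense in $X$ and countably supports all of $X^*$; (b) $\mathfrak{s}$ is $(\mathcal{A},0)$-shrinking in every element of $X^*$. (iii) There exist a SPRI $(Q_\alpha)_{\alpha\le\kappa}$ in $X$ and a non-empty set $\mathcal{A}\subset B_X$ such that: (3a) $\mathcal{A}$ is linearly dense in $X$ and countably supports $X^*$; (3b) for every $x\in\mathcal{A}$ it holds that $\{Q_\alpha(x) : \alpha\le\kappa\}\subset\{0,x\}$; (3c) $(Q_\alpha)_{\alpha\le\kappa}$ is $(\mathcal{A},0)$-shrinking in every element of $X^*$.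
   Context: $B_X$ is the closed unit ball of $X$; $\operatorname{dens}(X)$ is the density of $X$ (least cardinality of a dense subset). A set is linearly dense if its linear span is dense. A set $A\subset X$ countably supports a set $D\subset X^*$ if $\{x\in A : x^*(x)\neq 0\}$ is countable for every $x^*\in D$. All projections are bounded linear idempotent maps $X\to X$. A Banach space is WCG (weakly compactly generated) if it contains a linearly dense weakly compact subset. Projectional skeleton: Let $(\Gamma,\le)$ be an up-directed partially ordered set. A sequence $(s_n)_{n\in\omega}$ in $\Gamma$ is increasing if $s_n\le s_{n+1}$ for all $n$. $\Gamma$ is $\sigma$-complete if every increasing sequence in $\Gamma$ has a supremum in $\Gamma$. A projectional skeleton on $X$ is a family of bounded linear projections $(P_s)_{s\in\Gamma}$ on $X$ indexed by an up-directed $\sigma$-complete partially ordered set $\Gamma$ such that: (1) $P_s[X]$ is separable for every $s$; (2) if $s\le t$ then $P_s=P_s\circ P_t=P_t\circ P_s$; (3) if $(s_n)$ is increasing with $s=\sup_n s_n$, then $P_s[X]=\overline{\bigcup_n P_{s_n}[X]}$; (4) $X=\bigcup_{s\in\Gamma}P_s[X]$. SPRI (separable projectional resolution of the identity): a family of bounded linear projections $(Q_\alpha)_{\alpha\in[0,\operatorname{dens}X]}$ on $X$, indexed by ordinals $\alpha\le\operatorname{dens}X$, such that $Q_0=0$, $Q_{\operatorname{dens}X}=\mathrm{Id}$ and for every $\alpha\in[0,\operatorname{dens}X)$: (1) $(Q_{\alpha+1}-Q_\alpha)[X]$ is separable; (2) $Q_\alpha Q_\beta=Q_\beta Q_\alpha=Q_\beta$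 for $\beta\in[0,\alpha]$; (3) $x\in\overline{\operatorname{span}}\{(Q_{\beta+1}-Q_\beta)x : 0\le\beta<\operatorname{dens}X\}$ for every $x\in X$. Shrinking: for a non-empty bounded set $A\subset X$ put $\rho_A(x^*,y^* ):=\sup_{x\in A}|x^*(x)-y^*(x)|$ for $x^*,y^*\in X^*$. Given a partially ordered set $\Gamma$, a family $\mathfrak{s}=(P_s)_{s\in\Gamma}$ of bounded projections on $X$, $\varepsilon\ge 0$ and $x^*\in X^*$, $\mathfrak{s}$ is $(A,\varepsilon)$-shrinking in $x^*$ if for every increasing sequence $(s_n)_{n\in\omega}$ in $\Gamma$ such that $s=\sup_n s_n$ exists in $\Gamma$, it holds that $\limsup_{n\to\infty}\rho_A(P_{s_n}^*(x^* ),P_s^*(x^* ))\le\varepsilon\|x^*\|$. For a SPRI the index set is the ordinal interval $[0,\kappa]$. *)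

(* Defs.v *)
(* Banach spaces are real: completeNormedModType R with R : realType. *)
From HB Require Import structures.
From mathcomp Require Import all_boot all_order all_algebra.
From mathcomp Require wochoice.
From mathcomp Require Import all_classical all_reals all_analysis.

Set Implicit Arguments.
Unset Strict Implicit.
Unset Printing Implicit Defensive.

Import Order.TTheory GRing.Theory Num.Theory.
Import numFieldNormedType.Exports.

Local Open Scope classical_set_scope.
Local Open Scope card_scope.
Local Open Scope ring_scope.

Record dual_space (R : realType) (X : normedModType R) := Dual {
  dual_fun :> {linear X -> R^o};
  dual_continuous : continuous dual_fun }.

HB.instance Definition _ (R : realType) (X : normedModType R) :=
  gen_eqMixin (dual_space X).
HB.instance Definition _ (R : realType) (X : normedModType R) :=
  gen_choiceMixin (dual_space X).

Record bounded_proj (R : realType) (X : normedModType R) := BoundedProj {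
  bproj_fun :> {linear X -> X};
  bproj_continuous : continuous bproj_fun;
  bproj_idem : forall x, bproj_fun (bproj_fun x) = bproj_fun x }.

Section Basics.
Context (R : realType) (X : normedModType R).
Implicit Types (A S D : set X) (f g : dual_space X) (P : bounded_proj X).

Lemma adjoint_subproof P f : continuous (f \o P).
Proof.
move=> x; apply: continuous_comp; first exact: bproj_continuous.
exact: dual_continuous.
Qed.

Definition adjoint P f : dual_space X := Dual (@adjoint_subproof P f).

Definition unit_ball : set X := [set x | `|x| <= 1].

Definition dual_norm f : \bar R := ereal_sup [set `|f x|%:E | x in unit_ball].

Definition lin_span A : set X :=
  [set x | exists n (a : 'I_n -> R) (v : 'I_n -> X),
    (forall i, A (v i)) /\ x = \sum_i a i *: v i].

Definition linearly_dense A := closure (lin_span A) = setT.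

Definition separable S :=
  exists D, [/\ D `<=` S, countable D & S `<=` closure D].

Definition countably_supports A (F : set (dual_space X)) :=
  forall f, F f -> countable [set x | A x /\ f x != 0].

(* The weak topology: the coarsest topology making every functional
   continuous, i.e. the initial topology for the map of X into the space of
   functions on its dual, with the topology of pointwise convergence. *)
Definition weak_eval (x : X) : {ptws dual_space X -> R} := fun f => f x.

Definition weak_compact A := @compact (initial_topology weak_eval) A.

Definition WCG := exists A, linearly_dense A /\ weak_compact A.

(* Valued in the extended reals; rho A f g is finite when A is nonempty and
   bounded. *)
Definition rho A f g : \bar R := ereal_sup [set `|f x - g x|%:E | x in A].

End Basics.

Definition incr_seq d (G : porderType d) (s_ : nat -> G) :=
  forall n, (s_ n <= s_ n.+1)%O.

Definition shrinking (R : realType) (X : normedModType R) d (G : porderType d)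
    (P : G -> bounded_proj X) (A : set X) (eps : R) (f : dual_space X) :=
  forall (s_ : nat -> G) (s : G), incr_seq s_ ->
    supremums (range s_) s ->
    (limn_esup (fun n => rho A (adjoint (P (s_ n)) f) (adjoint (P s) f))
       <= eps%:E * dual_norm f)%E.

Definition up_directed d (G : porderType d) :=
  forall s t : G, exists u, (s <= u)%O /\ (t <= u)%O.

Definition sigma_complete d (G : porderType d) :=
  forall s_ : nat -> G, incr_seq s_ -> exists s, supremums (range s_) s.

Record projectional_skeleton (R : realType) (X : normedModType R)
    d (G : porderType d) (P : G -> bounded_proj X) : Prop := {
  skeleton_directed : up_directed G;
  skeleton_sigma_complete : sigma_complete G;
  skeleton_separable : forall s, separable (range (P s));
  skeleton_comp : forall s t x, (s <= t)%O ->
    P s x = P s (P t x) /\ P s x = P t (P s x);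
  skeleton_sup : forall (s_ : nat -> G) s, incr_seq s_ ->
    supremums (range s_) s ->
    range (P s) = closure (\bigcup_n range (P (s_ n)));
  skeleton_cover : \bigcup_s range (P s) = setT }.

(* The set C has cardinality dens X. *)
Definition card_is_dens (X : topologicalType) T (C : set T) :=
  (exists2 D : set X, dense D & C #= D) /\
  forall D : set X, dense D -> C #<= D.

(* I is (up to the unique isomorphism) the interval [0, kappa] of ordinals,
   where kappa = dens X is identified with the least ordinal of its
   cardinality: I is well-ordered, \bot stands for 0 and \top for kappa, the
   set [0, kappa) of the elements below \top has cardinality dens X, and its
   proper initial segments have a strictly smaller cardinality. *)
Record ordinals_upto_dens (X : topologicalType) d (I : tbOrderType d)
    : Prop := {
  ordinals_wo : wochoice.well_order (<=%O : rel I);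
  ordinals_card : card_is_dens X [set a : I | (a < \top)%O];
  ordinals_initial : forall a : I, (a < \top)%O ->
    ~ ([set b : I | (b < \top)%O] #<= [set b : I | (b < a)%O]) }.

(* b = a + 1; in a well-order, every a < \top has a unique successor. *)
Definition is_succ d (I : porderType d) (a b : I) :=
  (a < b)%O /\ forall c, (a < c)%O -> (b <= c)%O.

Record SPRI (R : realType) (X : normedModType R) d (I : tbOrderType d)
    (Q : I -> bounded_proj X) : Prop := {
  SPRI_index : ordinals_upto_dens X I;
  SPRI_bot : forall x, Q \bot%O x = 0;
  SPRI_top : forall x, Q \top%O x = x;
  SPRI_separable : forall a b, (a < \top)%O -> is_succ a b ->
    separable (range (fun x => Q b x - Q a x));
  SPRI_comp : forall a b x, (a < \top)%O -> (b <= a)%O ->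
    Q a (Q b x) = Q b x /\ Q b (Q a x) = Q b x;
  SPRI_span : forall x, closure (lin_span [set y | exists a b,
    [/\ (a < \top)%O, is_succ a b & y = Q b x - Q a x]]) x }.

(* Main.v *)
(** Everything goes through sets A that are linearly dense and c0: each functional
    exceeds e > 0 in absolute value at only finitely many points of A. For such
    A the set A `|` [set 0] is weakly compact, so X is WCG.

    Conversely, a WCG space has such a set (Amir-Lindenstrauss). Let L be weakly
    compact and linearly dense. A subset C of L closed under suitable countably
    many finitary operations carries a set of functionals norming its span, and
    L projects onto the part of L in the closed span of C along the annihilator
    of these functionals. Along the closures of the initial segments of a
    well-order of L, the differences of consecutive projections cut L into weakly
    compact pieces of smaller density on which a given functional tends to 0, and
    one concludes by induction on the density.

    Given a c0 set A, a subset C of A which is closed under suitable operations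
    (absorbing the supports of norming functionals of its span) splits X into
    the closed spans of C and of its complement in A, with a projection of norm 1
    that acts on A as the indicator of C. The countable closed sets form the
    skeleton. All these projections are diagonal on A, so they commute and finite
    Boolean combinations of closed sets also give bounded projections; by
    induction on the cardinality A is well-ordered by countable blocks whose
    initial segments are of this kind, which gives the SPRI. Shrinking is then
    immediate from the c0 property.

    In the other direction, shrinking rules out gliding humps: A splits into
    countable layers, almost all of which are small for a given functional.
    Rescaling each countable layer turns A into a c0 set. *)

Require Import Defs.
From HB Require Import structures.
From mathcomp Require Import all_boot all_order all_algebra.
From mathcomp Require wochoice.
From mathcomp Require Import all_classical all_reals all_analysis.
From mathcomp Require Import lra.

Set Implicit Arguments.
Unset Strict Implicit.
Unset Printing Implicit Defensive.

Import Order.TTheory GRing.Theory Num.Theory.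
Import numFieldNormedType.Exports.

Local Open Scope classical_set_scope.
Local Open Scope card_scope.

(** * Cardinals and closures *)

(** Every induction on density follows one scheme. A set is exhausted by closures [cle d] of its
    initial segments under countably many finitary operations; each closure is countable or no
    larger than a proper initial segment of a fixed well-order. The operations depend on data that
    change on the way (in Amir-Lindenstrauss on the compact set, which is replaced by its pieces),
    so the induction hypothesis has to cover every [op] and every set no larger than such a closure.
    Limit stages are increasing unions, hence each kind of projection needs its own continuity along
    chains: weak, by ultrafilter limits, for [weak_proj]; in norm, by the uniform bound 1 on closed
    sets, for [diag]. The c0 property fits shrinking because, for a given functional and a given
    error, only finitely many points of the set matter, and an increasing sequence of indices
    settles on finitely many points. *)

Lemma card_le_injP {T} {U : pointedType} {A : set T} {B : set U} :
  A #<= B <-> exists f : T -> U,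
    (forall x, A x -> B (f x)) /\
    (forall x y, A x -> A y -> f x = f y -> x = y).
Proof.
split=> [/pcard_leP[f]|[f [fB fI]]].
  exists f; split=> [x Ax|x y Ax Ay]; first exact: (@funS _ _ _ _ f x Ax).
  by apply: (@inj _ _ _ f); exact: mem_set.
apply/pcard_leP/injfunPex; exists f => // x y /set_mem Ax /set_mem Ay.
exact: fI.
Qed.

Lemma card_le_comparable {T U : pointedType} (A : set T) (B : set U) :
  A #<= B \/ B #<= A.
Proof.
pose P (G : set (T * U)) := [/\ forall p, G p -> A p.1 /\ B p.2,
  forall x y y', G (x, y) -> G (x, y') -> y = y' &
  forall x x' y, G (x, y) -> G (x', y) -> x = x'].
have [F FP Ftot|G [[GAB Gf Gi] Gmax]] := @Zorn_bigcup _ P.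
  have dir p q : (\bigcup_(X in F) X) p -> (\bigcup_(X in F) X) q ->
      exists2 X, F X & X p /\ X q.
    move=> [Y FY Yp] [Z FZ Zq]; have [YZ|ZY] := Ftot _ _ FY FZ.
      by exists Z => //; split => //; exact: YZ.
    by exists Y => //; split => //; exact: ZY.
  split.
  - by move=> p [X FX Xp]; case: (FP _ FX) => + _ _; apply.
  - move=> x y y' Gy Gy'; have [X FX [Xy Xy']] := dir _ _ Gy Gy'.
    by case: (FP _ FX) => _ + _; apply; eassumption.
  - move=> x y y' Gy Gy'; have [X FX [Xy Xy']] := dir _ _ Gy Gy'.
    by case: (FP _ FX) => _ _; apply; eassumption.
have [Atot|/existsNP[a /not_implyP[Aa aG]]] :=
    pselect (forall x, A x -> exists y, G (x, y)).
  left; apply/card_le_injP; have [f fG] : exists f, forall x, A x -> G (x, f x).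
    have /choice[f fG] : forall x, exists y, A x -> G (x, y).
      by move=> x; have [/Atot[y]|] := pselect (A x); [exists y|exists point].
    by exists f.
  exists f; split=> [x /fG/GAB[]//|x y Ax Ay fxy].
  by apply: (Gi _ _ (f x)); [exact: fG|rewrite fxy; exact: fG].
have [Btot|/existsNP[b /not_implyP[Bb bG]]] :=
    pselect (forall y, B y -> exists x, G (x, y)).
  right; apply/card_le_injP; have [f fG] : exists f, forall y, B y -> G (f y, y).
    have /choice[f fG] : forall y, exists x, B y -> G (x, y).
      by move=> x; have [/Btot[y]|] := pselect (B x); [exists y|exists point].
    by exists f.
  exists f; split=> [x /fG/GAB[]//|x y Ax Ay fxy].
  by apply: (Gf (f x)); [exact: fG|rewrite fxy; exact: fG].
exfalso; apply: (Gmax (G `|` [set (a, b)])).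
  split; first by move=> p Gp; left.
  move=> /(_ (a, b)) Gab; apply: aG; exists b; apply: Gab; by right.
split.
- by move=> p [/GAB//|->].
- move=> x y y' [Gxy|[-> ->]] [Gxy'|[]].
  + exact: Gf Gxy Gxy'.
  + by move=> xa; case: aG; exists y; rewrite -xa.
  + by case: aG; exists y'.
  + by [].
- move=> x y y' [Gxy|[-> ->]] [Gxy'|[]].
  + exact: Gi Gxy Gxy'.
  + by move=> _ xa; case: bG; exists x; rewrite -xa.
  + by case: bG; exists y.
  + by [].
Qed.

(** * Arithmetic of infinite cardinals *)

Section Hessenberg.
Context {T : pointedType}.
Implicit Types (B S : set T) (g : T -> T -> T).

Definition pairing_on S g := (forall a b, S a -> S b -> S (g a b)) /\
  forall a b a' b', S a -> S b -> S a' -> S b' -> g a b = g a' b' ->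
    a = a' /\ b = b'.

(** Zorn's lemma on graphs of pairings of subsets [S] of [B]. For a maximal one, either the rest of
    [B] injects into [S], so that [B] injects into [S] and inherits its pairing, or a copy of [S]
    fits into the rest and the pairing extends to [S] and this copy, against maximality. *)
Lemma infinite_pairing B : infinite_set B -> exists g, pairing_on B g.
Proof.
move=> /infiniteP/card_le_injP[e [eB eI]].
have {}eB n : B (e n) by exact: eB.
have {}eI m n : e m = e n -> m = n by exact: eI.
pose fld (G : set (T * T * T)) := [set a | exists b c, G ((a, b), c)].
(* The last clause gives every nonempty graph the distinct elements [e n], which serve as tags
   below; the empty graph stays allowed as the union of an empty chain. *)
pose P (G : set (T * T * T)) := [/\ forall a b c, G ((a, b), c) ->
    [/\ B a, fld G b & fld G c],
  forall a b, fld G a -> fld G b -> exists c, G ((a, b), c),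
  forall a b c c', G ((a, b), c) -> G ((a, b), c') -> c = c',
  forall a b a' b' c, G ((a, b), c) -> G ((a', b'), c) -> a = a' /\ b = b' &
  G = set0 \/ forall n, fld G (e n)].
have [F FP Ftot|G [[GB Gt Gf Gi Ge] Gmax]] := @Zorn_bigcup _ P.
  have dir p q : (\bigcup_(X in F) X) p -> (\bigcup_(X in F) X) q ->
      exists2 X, F X & X p /\ X q.
    move=> [Y FY Yp] [Z FZ Zq]; have [YZ|ZY] := Ftot _ _ FY FZ.
      by exists Z => //; split => //; exact: YZ.
    by exists Y => //; split => //; exact: ZY.
  have sub X a : F X -> fld X a -> fld (\bigcup_(X in F) X) a.
    by move=> FX [b [c Xabc]]; exists b, c, X.
  split.
  - move=> a b c [X FX Xp]; have [/(_ _ _ _ Xp)[Ba Xb Xc] _ _ _ _] := FP _ FX.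
    by split => //; exact: (sub X).
  - move=> a b [a1 [c1 Ga]] [b1 [c2 Gb]].
    have [X FX [Xa Xb]] := dir _ _ Ga Gb; have [_ Xt _ _ _] := FP _ FX.
    have [c Xc] : exists c, X ((a, b), c).
      by apply: Xt; [exists a1, c1|exists b1, c2].
    by exists c, X.
  - move=> a b c c' Gc Gc'; have [X FX [Xc Xc']] := dir _ _ Gc Gc'.
    by have [_ _ + _ _] := FP _ FX; apply; eassumption.
  - move=> a b a' b' c Gc Gc'; have [X FX [Xc Xc']] := dir _ _ Gc Gc'.
    by have [_ _ _ + _] := FP _ FX; apply; eassumption.
  - have [F0|/existsNP[X /not_implyP[FX /eqP/set0P[[[a b] c] Xp]]]] :=
      pselect (forall X, F X -> X = set0).
      by left; rewrite -subset0 => p [X /F0 ->].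
    have [_ _ _ _ [X0|Xe]] := FP _ FX; first by rewrite X0 in Xp.
    by right => n; exact: (sub X).
have {}Ge : forall n, fld G (e n).
  case: Ge => // G0; exfalso.
  pose G0' := [set p : T * T * T | exists i j, p = ((e i, e j), e (pickle (i, j)))].
  apply: (Gmax G0').
    split=> [|/(_ ((e 0, e 0), e (pickle (0, 0))))]; rewrite G0 //; apply.
    by exists 0, 0.
  have fe n : fld G0' (e n) by exists (e 0), (e (pickle (n, 0))), n, 0.
  split.
  - by move=> a b c [i [j [-> -> ->]]]; split.
  - move=> a b [? [? [i [? [-> _ _]]]]] [? [? [j [? [-> _ _]]]]].
    by exists (e (pickle (i, j))), i, j.
  - move=> a b c c' [i [j [-> -> ->]]] [i' [j' [/eI -> /eI -> ->]]] //.
  - move=> a b a' b' c [i [j [-> -> ->]]] [i' [j' [-> -> /eI]]].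
    by move=> /(pcan_inj pickleK)[-> ->].
  - by right.
set S := fld G in GB Gt Ge *.
have SB a : S a -> B a by case=> b [c /GB[]].
have [g gG] : exists g, forall a b, S a -> S b -> G ((a, b), g a b).
  have /choice[g gG] : forall p : T * T, exists c, S p.1 -> S p.2 -> G (p, c).
    move=> [a b]; have [[Sa Sb]|nS] := pselect (S a /\ S b).
      by have [c] := Gt _ _ Sa Sb; exists c.
    by exists point => /= Sa Sb; case: nS.
  by exists (fun a b => g (a, b)) => a b; exact: (gG (a, b)).
have gS a b : S a -> S b -> S (g a b) by move=> Sa Sb; have [] := GB _ _ _ (gG _ _ Sa Sb).
have gI a b a' b' : S a -> S b -> S a' -> S b' -> g a b = g a' b' -> a = a' /\ b = b'.
  move=> Sa Sb Sa' Sb' E; apply: Gi (gG _ _ Sa Sb) _.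
  by rewrite E; exact: gG.
have [|] := card_le_comparable S (B `\` S); last first.
  move=> /card_le_injP[k [kS kI]].
  pose m x := if x \in S then g x (e 0) else g (k x) (e 1).
  have mS x : B x -> S (m x).
    rewrite /m; case: ifPn => [/set_mem Sx _|/negP xS Bx]; first exact: gS.
    by apply: gS => //; apply: kS; split => // Sx; apply: xS; exact: mem_set.
  have mI x y : B x -> B y -> m x = m y -> x = y.
    rewrite /m; case: ifPn => [/set_mem Sx _|/negP xS Bx].
      case: ifPn => [/set_mem Sy _|/negP yS By].
        by move=> /(gI _ _ _ _ Sx (Ge 0) Sy (Ge 0))[].
      have yS' : (B `\` S) y by split => // Sy; apply: yS; exact: mem_set.
      by move=> /(gI _ _ _ _ Sx (Ge 0) (kS _ yS') (Ge 1))[_ /eI].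
    have xS' : (B `\` S) x by split => // Sx; apply: xS; exact: mem_set.
    case: ifPn => [/set_mem Sy _|/negP yS By].
      by move=> /(gI _ _ _ _ (kS _ xS') (Ge 1) Sy (Ge 0))[_ /eI].
    have yS' : (B `\` S) y by split => // Sy; apply: yS; exact: mem_set.
    by move=> /(gI _ _ _ _ (kS _ xS') (Ge 1) (kS _ yS') (Ge 1))[/kI ->].
  exists (fun a b => g (m a) (m b)); split.
    by move=> a b Ba Bb; apply: SB; apply: gS; exact: mS.
  by move=> a b a' b' Ba Bb Ba' Bb' /gI[||||/mI -> // /mI -> //]; exact: mS.
move=> /card_le_injP[h [hB hI]]; exfalso.
pose el (t : bool) a := if t then h a else a.
have elI t a t' a' : S a -> S a' -> el t a = el t' a' -> t = t' /\ a = a'.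
  move=> Sa Sa'; case: t t' => -[] /=.
  - by move=> /hI ->.
  - by move=> E; have [_] := hB _ Sa; rewrite E.
  - by move=> E; have [_] := hB _ Sa'; rewrite -E.
  - by [].
(* The old pairing is kept on [S]. The three new blocks of pairs all take values in the copy of [S],
   where the tags 2t + t' = 1, 2, 3 keep them apart. *)
pose v (t t' : bool) a b := el (t || t')
  (if t || t' then g (g a b) (e (2 * t + t')) else g a b).
pose G1 := [set p | exists t t' a b,
  [/\ S a, S b & p = ((el t a, el t' b), v t t' a b)]].
have fG1 t a : S a -> fld G1 (el t a).
  by move=> Sa; exists (el t a), (v t t a a), t, t, a, a.
have vf t t' a b : S a -> S b -> fld G1 (v t t' a b).
  by move=> Sa Sb; apply: fG1; case: ifP => _; [exact: gS (gS _ _ Sa Sb) _|exact: gS].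
have fG1E x : fld G1 x -> exists t a, S a /\ x = el t a.
  by move=> [? [? [t [t' [a [b [Sa Sb [-> _ _]]]]]]]]; exists t, a.
apply: (Gmax G1).
  split=> [[[a b] c] Gp|G1G].
    have [_ Sb _] := GB _ _ _ Gp; have Sa : S a by exists b, c.
    exists false, false, a, b; split => //=.
    by rewrite /v /=; congr (_, _); exact: Gf Gp (gG _ _ Sa Sb).
  have Sh : S (h (e 0)).
    have [b [c G1h]] := fG1 true _ (Ge 0); exists b, c; exact: G1G.
  by have [] := hB _ (Ge 0).
split.
- move=> a b c [t [t' [a1 [b1 [Sa Sb [-> -> ->]]]]]]; split.
  + by case: t => /=; [have [] := hB _ Sa|exact: SB].
  + exact: fG1.
  + exact: vf.
- move=> a b /fG1E[t [a1 [Sa ->]]] /fG1E[t' [b1 [Sb ->]]].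
  by exists (v t t' a1 b1), t, t', a1, b1.
- move=> a b c c' [t [t' [a1 [b1 [Sa Sb [-> -> ->]]]]]].
  move=> [u [u' [a2 [b2 [Sa' Sb' [/elI[//|//|-> ->] /elI[//|//|-> ->] ->]]]]]] //.
- move=> a b a' b' c [t [t' [a1 [b1 [Sa Sb [-> -> ->]]]]]].
  move=> [u [u' [a2 [b2 [Sa' Sb' [-> -> /elI[||tu]]]]]]].
  + by case: ifP => _; [exact: gS (gS _ _ Sa Sb) _|exact: gS].
  + by case: ifP => _; [exact: gS (gS _ _ Sa' Sb') _|exact: gS].
  rewrite -tu; case: ifP => [_ /gI[||||]|tt' /gI[//|//|//|//|-> ->]].
  1-4: by [exact: gS|exact: Ge].
  + move=> /gI[//|//|//|//|-> ->] /eI.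
    by case: t t' u u' {tu} => -[] [] [].
  + by move: tu tt'; case: t t' u u' => -[] [] [].
- right=> n; exact: (fG1 false).
Qed.

End Hessenberg.

Section InfiniteCard.
Context {U : pointedType} (B : set U) (Binf : infinite_set B).

Lemma bigcup_card_le {T} (A : nat -> set T) :
  (forall n, A n #<= B) -> \bigcup_n A n #<= B.
Proof.
move=> AB; have [g [gB gI]] := infinite_pairing Binf.
have /infiniteP/card_le_injP[e [eB eI]] := Binf.
have /choice[F FP] := fun n => (card_le_injP.1 (AB n)).
have /choice[i iP] : forall x, exists n, (\bigcup_n A n) x -> A n x.
  move=> x; have [[n _ Anx]|] := pselect ((\bigcup_n A n) x); last by exists 0.
  by exists n.
apply/card_le_injP; exists (fun x => g (e (i x)) (F (i x) x)); split.
  by move=> x /iP Ax; apply: gB; [exact: eB|exact: (FP _).1].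
move=> x y /iP Ax /iP Ay /gI[].
- exact: eB.
- exact: (FP _).1.
- exact: eB.
- exact: (FP _).1.
- by move=> /eI ixy; rewrite -ixy // in Ay *; exact: (FP _).2.
Qed.

Lemma setU_card_le {T} (A A' : set T) : A #<= B -> A' #<= B -> A `|` A' #<= B.
Proof.
move=> AB A'B.
have /bigcup_card_le : forall n, (if n is 0 then A else A') #<= B by case.
apply: card_le_trans; apply: subset_card_le => x [Ax|A'x]; first by exists 0.
by exists 1.
Qed.

Lemma seq_nat_card_le {T : eqType} (A : set T) : A #<= B ->
  [set p : seq T * nat | forall x, x \in p.1 -> A x] #<= B.
Proof.
move=> /card_le_injP[f [fB fI]]; have [g [gB gI]] := infinite_pairing Binf.
have /infiniteP/card_le_injP[e [eB eI]] := Binf.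
have {}eB n : B (e n) by exact: eB.
have {}eI m n : e m = e n -> m = n by exact: eI.
(* [c] is injective only among sequences of the same length, so the final code records the length as
   well. *)
pose c := foldr (fun x u => g (f x) u) (e 0).
have cB s : (forall x, x \in s -> A x) -> B (c s).
  elim: s => [_|x s IH sA] /=; first exact: eB.
  apply: gB.
    by apply: fB; apply: sA; rewrite mem_head.
  by apply: IH => y ys; apply: sA; rewrite inE ys orbT.
have cI s t : (forall x, x \in s -> A x) -> (forall x, x \in t -> A x) ->
    size s = size t -> c s = c t -> s = t.
  elim: s t => [[//|]|x s IH [//|y t]] xsA ytA //= [st].
  have xA : A x by apply: xsA; rewrite mem_head.
  have yA : A y by apply: ytA; rewrite mem_head.
  have sA z : z \in s -> A z by move=> zs; apply: xsA; rewrite inE zs orbT.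
  have tA z : z \in t -> A z by move=> zs; apply: ytA; rewrite inE zs orbT.
  move=> /(gI _ _ _ _ (fB _ xA) (cB _ sA) (fB _ yA) (cB _ tA))[].
  by move=> /fI -> // /IH -> //.
apply/card_le_injP; exists (fun p => g (g (e (size p.1)) (c p.1)) (e p.2)).
split=> [[s k] /= sA|[s k] [t l] /= sA tA].
  by apply: (gB _ _ _ (eB _)); apply: gB => //; exact: cB.
have cB' r : (forall x, x \in r -> A x) -> B (g (e (size r)) (c r)).
  by move=> rA; apply: gB => //; exact: cB.
move=> /(gI _ _ _ _ (cB' _ sA) (eB _) (cB' _ tA) (eB _))[].
move=> /(gI _ _ _ _ (eB _) (cB _ sA) (eB _) (cB _ tA))[].
by move=> /eI st /cI -> // /eI ->.
Qed.

End InfiniteCard.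

Lemma directed_bigcup_seq {T : eqType} {I} (D : set I) (C : I -> set T)
    (s : seq T) : D !=set0 ->
  (forall i j, D i -> D j -> exists k, [/\ D k, C i `<=` C k & C j `<=` C k]) ->
  (forall x, x \in s -> (\bigcup_(i in D) C i) x) ->
  exists2 i, D i & forall x, x \in s -> C i x.
Proof.
move=> [i0 Di0] Cdir; elim: s => [|x s IH] sC; first by exists i0.
have [|i Di si] := IH; first by move=> y ys; apply: sC; rewrite inE ys orbT.
have [k Dk xk] := sC x (mem_head _ _).
have [l [Dl kl il]] := Cdir _ _ Dk Di.
by exists l => // y; rewrite inE => /orP[/eqP ->|/si /il//]; exact: kl.
Qed.

(** * Closure under countably many finitary operations *)

Section Closure.
Context {T : pointedType} (op : seq T -> nat -> T).
Implicit Types (C S D : set T).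

(** Only nonempty [s] count, so the empty set is closed; this is what makes [clt] closed at a least
    element. *)
Definition op_closed C := forall s k, s != [::] ->
  (forall x, x \in s -> C x) -> C (op s k).

Inductive op_closure S : set T :=
| op_closure_sub x : S x -> op_closure S x
| op_closure_op s k : s != [::] -> (forall x, x \in s -> op_closure S x) ->
    op_closure S (op s k).

Lemma op_closure_closed S : op_closed (op_closure S).
Proof. by move=> s k s0 sS; exact: op_closure_op. Qed.

Lemma op_closure_min S C : op_closed C -> S `<=` C -> op_closure S `<=` C.
Proof.
move=> Cc SC x; elim=> {x} [x /SC//|s k s0 _ sC]; exact: Cc.
Qed.

Lemma op_closureS S S' : S `<=` S' -> op_closure S `<=` op_closure S'.
Proof.
move=> SS'; apply: op_closure_min; first exact: op_closure_closed.
by move=> x /SS'; exact: op_closure_sub.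
Qed.

Lemma op_closed_bigcup {I} (D : set I) (C : I -> set T) :
  (forall i, D i -> op_closed (C i)) ->
  (forall i j, D i -> D j -> exists k, [/\ D k, C i `<=` C k & C j `<=` C k]) ->
  op_closed (\bigcup_(i in D) C i).
Proof.
move=> Cc Cdir s k s0 sC; have D0 : D !=set0.
  case: s s0 sC => // x s _ xsC; have [i Di _] := xsC x (mem_head _ _).
  by exists i.
have [i Di si] := directed_bigcup_seq D0 Cdir sC.
by exists i => //; exact: Cc.
Qed.

(** The closure is reached in countably many stages, each adding one application of [op] to finite
    sequences; an infinite cardinal absorbs both. *)
Lemma op_closure_card_le {U : pointedType} (B : set U) S : infinite_set B ->
  S #<= B -> op_closure S #<= B.
Proof.
move=> Binf SB.
pose step C := C `|` [set op p.1 p.2 | p in [set p : seq T * nat | forall x, x \in p.1 -> C x]].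
pose C_ := fix C_ n := if n is n.+1 then step (C_ n) else S.
have C_S n : C_ n `<=` C_ n.+1 by move=> x; left.
have C_mono : {homo C_ : m n / (m <= n)%N >-> m `<=` n}.
  by apply: homo_leq => //; [exact: subset_refl|move=> A2 A1 A3; exact: subset_trans].
have : \bigcup_n C_ n #<= B.
  apply: bigcup_card_le => // n; elim: n => [//|n IH] /=.
  apply: setU_card_le => //; apply: card_le_trans (card_image_le _ _) _.
  exact: seq_nat_card_le.
apply: card_le_trans; apply: subset_card_le; apply: op_closure_min; last first.
  by move=> x Sx; exists 0.
move=> s k s0 sC; have [|n _ sn] := directed_bigcup_seq (ex_intro _ 0 I) _ sC.
  move=> m n _ _; exists (maxn m n); split=> //; apply: C_mono.
    exact: leq_maxl.
  exact: leq_maxr.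
by exists n.+1 => //; right; exists (s, k).
Qed.

End Closure.

(** * Well-orders and induction on cardinality *)

Definition strict_well_order {T} (lt : T -> T -> Prop) :=
  [/\ well_founded lt, (forall x y z, lt x y -> lt y z -> lt x z) &
      forall x y, [\/ lt x y, x = y | lt y x]].

Lemma strict_well_orderP (T : eqType) :
  exists lt : T -> T -> Prop, strict_well_order lt.
Proof.
have [R Rwo] := wochoice.well_ordering_principle T.
have Rch : wochoice.wo_chain R predT by move=> A _; exact: Rwo.
have Rtot x y : R x y || R y x by exact: (wochoice.wo_chainW Rch).
have Ranti x y : R x y -> R y x -> x = y.
  by move=> xy yx; apply: (wochoice.wo_chain_antisymmetric Rch); rewrite ?xy.
have Rmin (A : set T) : A !=set0 -> exists2 z, A z & forall y, A y -> R z y.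
  move=> [x Ax]; have [|z [[zA zmin] _]] := Rwo (fun y => y \in A).
    by exists x; exact: mem_set.
  exists z; first exact: set_mem.
  by move=> y Ay; apply: zmin; exact: mem_set.
exists (fun x y => ~~ R y x); split.
- move=> x; apply: contrapT => nx.
  have [|z nz zmin] := Rmin [set x | ~ Acc (fun x y => ~~ R y x) x].
    by exists x.
  apply: nz; constructor => y yz; apply: contrapT => ny.
  by move: yz; rewrite zmin.
- move=> x y z xy yz; apply/negP => zx.
  have [w wA wmin] := Rmin [set x; y; z] (ex_intro _ x (or_introl (or_introl erefl))).
  have wx := wmin x (or_introl (or_introl erefl)).
  have wy := wmin y (or_introl (or_intror erefl)).
  have wz := wmin z (or_intror erefl).
  move: xy yz; case: wA wx wy wz => [[->|->]|->] wx wy wz.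
  + by move=> _; rewrite -(Ranti _ _ wz zx) wy.
  + by rewrite wx.
  + by move=> _; rewrite wy.
- move=> x y; have [xy|xy] := boolP (R y x).
    have [yx|yx] := boolP (R x y); last by constructor 3.
    by constructor 2; exact: Ranti.
  by constructor 1.
Qed.

Section WellOrder.
Context {T U : Type} (lt : U -> U -> Prop) (wo : strict_well_order lt).
Implicit Types (D : set T) (j : T -> U).

Lemma swo_irr x : ~ lt x x.
Proof. by have [wf _ _] := wo; elim/(well_founded_ind wf): x => x IH xx; exact: (IH x). Qed.

Lemma swo_asym x y : lt x y -> ~ lt y x.
Proof. by have [_ ltT _] := wo => xy yx; exact: (swo_irr (ltT _ _ _ xy yx)). Qed.

Lemma swo_min (A : set U) : A !=set0 -> exists2 z, A z & forall y, A y -> ~ lt y z.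
Proof.
have [wf _ _] := wo; move=> [x]; elim/(well_founded_ind wf): x => x IH Ax.
have [[y [Ay yx]]|nx] := pselect (exists y, A y /\ lt y x); first exact: (IH y).
by exists x => // y Ay yx; apply: nx; exists y.
Qed.

Definition set_inj_on D j := forall x y, D x -> D y -> j x = j y -> x = y.

(** [D] is ordered through [j], so that it can be measured against initial segments of a well-order
    on another type. *)
Definition initial D j d := [set x | D x /\ ~ lt (j d) (j x)].

End WellOrder.

Lemma initial_closure_card {T U : pointedType} (lt : U -> U -> Prop)
    (op : seq T -> nat -> T) (D : set T) (j : T -> U) d :
  strict_well_order lt -> set_inj_on D j ->
  countable (op_closure op (initial lt D j d)) \/
  infinite_set [set u | lt u (j d)] /\
  op_closure op (initial lt D j d) #<= [set u | lt u (j d)].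
Proof.
move=> wo jI; have [_ _ tot] := wo.
have iniS : initial lt D j d #<= [set u | lt u (j d)] `|` [set j d].
  apply/card_le_injP; exists j; split=> [x [Dx dx]|x y [Dx _] [Dy _]]; last exact: jI.
  by have [xd|xd|//] := tot (j x) (j d); [left|right].
have [fin|inf] := pselect (finite_set [set u | lt u (j d)]).
  left; apply: op_closure_card_le; first exact: infinite_nat.
  apply: finite_set_countable; apply: card_le_finite iniS _.
  by rewrite finite_setU.
right; split => //; apply: op_closure_card_le => //.
apply: card_le_trans iniS _; apply: setU_card_le => //.
have [u uj] := infinite_setN0 inf.
by apply/card_le_injP; exists (fun=> u); split=> [//|x y -> ->].
Qed.


(** Take least elements repeatedly: removing the least element of an infinite set leaves an infinite
    set of larger ones. *)
Lemma swo_increasing_sequence {T U : Type} (lt : U -> U -> Prop)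
    (B : set T) (j : T -> U) :
  strict_well_order lt -> set_inj_on B j -> infinite_set B ->
  exists b : nat -> T, forall n, B (b n) /\ lt (j (b n)) (j (b n.+1)).
Proof.
move=> wo jI Binf; have [_ _ tot] := wo.
have bmin A : A `<=` B -> infinite_set A -> exists2 b, A b &
    infinite_set [set x | A x /\ lt (j b) (j x)].
  move=> AB Ainf; have [|_ [b Ab <-] bmin] := @swo_min _ _ wo (j @` A).
    by have [x Ax] := infinite_setN0 Ainf; exists (j x), x.
  exists b => // fin; apply: Ainf.
  apply: (@sub_finite_set _ _ ([set b] `|` [set x | A x /\ lt (j b) (j x)])).
    move=> x Ax; have [xb|xb|bx] := tot (j x) (j b); last by right; split.
      by exfalso; apply: (bmin (j x)) xb; exists x.
    by left; apply: jI => //; exact: AB.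
  by rewrite finite_setU.
pose tail b := [set x | B x /\ lt (j b) (j x)].
have /choice[next nextP] : forall b, exists b',
    infinite_set (tail b) -> tail b b' /\ infinite_set (tail b').
  move=> b; have [tb|] := pselect (infinite_set (tail b)); last by exists b.
  have [|b' tb' b'inf] := bmin (tail b) _ tb; first by move=> x [].
  by exists b' => _; split => //; apply: sub_infinite_set b'inf => x [[]].
have [b0 Bb0 b0inf] := bmin B (fun _ => id) Binf.
have iterP n : B (iter n next b0) /\ infinite_set (tail (iter n next b0)).
  by elim: n => [//|n [_ /nextP[[]]]].
exists (fun n => iter n next b0) => n; split; first exact: (iterP n).1.
by have [_ /nextP[[]]] := iterP n.
Qed.

(** [j] injects [A] into the least initial segment that is large enough, if there is one; by
    minimality no shorter segment can hold [A]. This plays the role of the initial ordinal of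
    [A]. *)
Lemma initial_well_order {T : pointedType} (A : set T) :
  exists (lt : T -> T -> Prop) (j : T -> T),
  [/\ strict_well_order lt, set_inj_on A j &
      forall d, A d -> ~ (A #<= [set u | lt u (j d)])].
Proof.
have [lt wo] := strict_well_orderP T; exists lt.
have [[a Aa]|nA] := pselect (exists a, A #<= [set u | lt u a]); last first.
  by exists id; split => // d _ Ad; apply: nA; exists d.
have [b Ab bmin] := swo_min wo (ex_intro [set a | A #<= [set u | lt u a]] a Aa).
have /card_le_injP[j [jb jI]] := Ab.
by exists j; split => // d /jb; apply: contraPnot => /bmin.
Qed.

(** Well-founded induction on [a] for the sets that inject into the elements below [a]: the closure
    of an initial segment is countable or injects below some [j d], which precedes [a]. One more
    step, with the order of [T] itself, reaches arbitrary sets. *)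
Lemma card_ind {T : pointedType} (Phi : set T -> Prop) :
  (forall D, countable D -> Phi D) ->
  (forall D (lt : T -> T -> Prop) (j : T -> T), strict_well_order lt ->
    set_inj_on D j ->
    (forall d, D d -> forall op S,
       S #<= op_closure op (initial lt D j d) -> Phi S) ->
    Phi D) ->
  forall D, Phi D.
Proof.
move=> Phic Phis; have [lt wo] := strict_well_orderP T.
have aux a D : D #<= [set u | lt u a] -> Phi D.
  have [wf _ _] := wo; elim/(well_founded_ind wf): a D => a IH D.
  move=> /card_le_injP[j [ja jI]]; apply: (Phis D lt j) => // d Dd op S SD.
  have [cl|[_ cl]] := initial_closure_card op d wo jI.
    by apply: Phic; apply: card_le_trans SD cl.
  by apply: (IH (j d)); [exact: ja|apply: card_le_trans SD cl].
move=> D; apply: (Phis D lt id) => // d Dd op S SD.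
have [//|cl|[_ cl]] := @initial_closure_card _ _ _ op D id d wo.
  by apply: Phic; apply: card_le_trans SD cl.
by apply: (aux d); apply: card_le_trans SD cl.
Qed.

Section Filtration.
Context {T : pointedType} (op : seq T -> nat -> T) (lt : T -> T -> Prop)
  (wo : strict_well_order lt) (j : T -> T) (D : set T).

Definition cle d := op_closure op (initial lt D j d).

Definition clt d :=
  \bigcup_(d' in [set d' | D d' /\ lt (j d') (j d)]) cle d'.

Lemma cle_closed d : op_closed op (cle d).
Proof. exact: op_closure_closed. Qed.

Lemma cle_sub C d : op_closed op C -> D `<=` C -> cle d `<=` C.
Proof. by move=> Cc DC; apply: op_closure_min => // x [/DC]. Qed.

Lemma mem_cle d : D d -> cle d d.
Proof. by move=> Dd; apply: op_closure_sub; split => //; exact: swo_irr. Qed.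

Lemma cle_mono d d' : ~ lt (j d') (j d) -> cle d `<=` cle d'.
Proof.
have [_ ltT tot] := wo; move=> dd'; apply: op_closureS => x [Dx dx]; split => // d'x.
have [//|dx'|xd] := tot (j d) (j x); first by apply: dd'; rewrite dx'.
by apply: dd'; exact: ltT d'x xd.
Qed.

Lemma cle_total d d' : cle d `<=` cle d' \/ cle d' `<=` cle d.
Proof.
have [dd'|dd'] := pselect (lt (j d') (j d)); last by left; exact: cle_mono.
by right; apply: cle_mono; exact: swo_asym.
Qed.

Lemma clt_cle d : clt d `<=` cle d.
Proof. by move=> x [d' [_ d'd]]; apply: cle_mono; exact: swo_asym. Qed.

Lemma cle_clt d d' : D d -> lt (j d) (j d') -> cle d `<=` clt d'.
Proof. by move=> Dd dd' x dx; exists d. Qed.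

Lemma clt_closed d : op_closed op (clt d).
Proof.
apply: op_closed_bigcup => [d' _|a b Da Db]; first exact: cle_closed.
by have [ab|ba] := cle_total a b; [exists b|exists a]; split.
Qed.

Lemma op_closure_cle : op_closure op D = \bigcup_(d in D) cle d.
Proof.
apply/seteqP; split=> [|x [d _]]; last first.
  by apply: cle_sub; [exact: op_closure_closed|exact: op_closure_sub].
apply: op_closure_min => [|x Dx]; last by exists x => //; exact: mem_cle.
apply: op_closed_bigcup => [d _|a b Da Db]; first exact: cle_closed.
by have [ab|ba] := cle_total a b; [exists b|exists a]; split.
Qed.

(** Choosing the least stage that contains a point splits the closure of [D] into the layers [cle d]
    minus [clt d]. *)
Lemma cle_layer d x : D d -> cle d x -> exists d', [/\ D d', cle d' x & ~ clt d' x].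
Proof.
move=> Dd dx.
have [|_ [d' [Dd' d'x] <-] dmin] := @swo_min _ _ wo (j @` [set d | D d /\ cle d x]).
  by exists (j d), d.
exists d'; split => // -[d'' [Dd'' d''d'] d''x].
by apply: (dmin (j d'')) d''d'; exists d''.
Qed.

End Filtration.

Local Open Scope ring_scope.

(** * The Hahn-Banach theorem *)

Section HahnBanach.
Context {R : realType} {V : lmodType R}.
Implicit Types (p q : V -> R) (x y : V).

Definition sublinear p := (forall x y, p (x + y) <= p x + p y) /\
  forall a x, 0 < a -> p (a *: x) <= a * p x.

Lemma sublinear0 p : sublinear p -> p 0 = 0.
Proof.
move=> [_ ph]; have := ph 2 0 ltac:(lra); have := ph 2^-1 0 ltac:(lra).
by rewrite !scaler0; lra.
Qed.

Lemma sublinearN p x : sublinear p -> - p (- x) <= p x.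
Proof.
by move=> ps; have := ps.1 x (- x); rewrite subrr sublinear0 //; lra.
Qed.

(** Zorn's lemma with pointwise infima of chains; they are finite because - p (- x) bounds every
    sublinear functional below [p] from below. *)
Lemma minimal_sublinear p : sublinear p -> exists q,
  [/\ sublinear q, forall x, q x <= p x &
      forall q', sublinear q' -> (forall x, q' x <= q x) -> forall x, q' x = q x].
Proof.
move=> ps; pose S := {q | sublinear q /\ forall x, q x <= p x}.
pose le (q q' : S) := `[< forall x, sval q' x <= sval q x >].
have [| | |A Atot|[q [qs qp]] qmin] := @Zorn S le.
- by move=> q; apply/asboolP.
- move=> q1 q2 q3 /asboolP q12 /asboolP q23; apply/asboolP => x.
  exact: le_trans (q23 x) (q12 x).
- move=> [q1 P1] [q2 P2] /asboolP /= q12 /asboolP /= q21.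
  by apply/eq_exist/funext => x; apply/eqP; rewrite eq_le q12 q21.
- have [->|/set0P[q0 Aq0]] := eqVneq A set0.
    by exists (exist _ p (conj ps (fun x => lexx _))).
  pose E x := [set sval q x | q in A].
  have E0 x : E x !=set0 by exists (sval q0 x), q0.
  have Elb x : has_lbound (E x).
    exists (- p (- x)) => _ [q Aq <-]; case: (svalP q) => qs qp.
    by apply: le_trans (sublinearN x qs); rewrite lerN2.
  have infE x (q : S) : A q -> inf (E x) <= sval q x.
    by move=> Aq; apply: ge_inf => //; exists q.
  have infs : sublinear (fun x => inf (E x)).
    split=> [x y|a x a0].
    + rewrite -lerBlDr; apply: lb_le_inf => // _ [q1 Aq1 <-].
      rewrite lerBlDr [leRHS]addrC -lerBlDr; apply: lb_le_inf => // _ [q2 Aq2 <-].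
      rewrite lerBlDr [leRHS]addrC.
      have [q [Aq q1q q2q]] : exists q : S, [/\ A q, le q1 q & le q2 q].
        have [l|l] := Atot _ _ Aq1 Aq2.
          by exists q2; split => //; apply/asboolP.
        by exists q1; split => //; apply/asboolP.
      apply: le_trans (infE _ _ Aq) _; have [[qa _] _] := svalP q.
      by apply: le_trans (qa x y) _; apply: lerD; [move/asboolP: q1q|move/asboolP: q2q].
    + rewrite mulrC -ler_pdivrMr //; apply: lb_le_inf => // _ [q Aq <-].
      rewrite ler_pdivrMr // mulrC; apply: le_trans (infE _ _ Aq) _.
      by have [[_ qh] _] := svalP q; exact: qh.
  have infp x : inf (E x) <= p x.
    by apply: le_trans (infE _ _ Aq0) _; have [_] := svalP q0.
  exists (exist _ (fun x => inf (E x)) (conj infs infp)) => q Aq.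
  by apply/asboolP => x; exact: infE.
- exists q; split => // q' q's q'q x.
  have q'p y : q' y <= p y by exact: le_trans (q'q y) (qp y).
  have /qmin/(congr1 sval)/= -> // :
    le (exist _ q (conj qs qp)) (exist _ q' (conj q's q'p)) by apply/asboolP.
Qed.

(** [q x] is the infimum over t >= 0 of p (x + t y) - t p y. Taking t = 0 gives q <= p, and t = 1 at
    - y gives the last clause. *)
Lemma sublinear_shift p y : sublinear p -> exists q,
  [/\ sublinear q, forall x, q x <= p x & q (- y) <= - p y].
Proof.
move=> ps; have [pa ph] := ps.
pose E x := [set p (x + t *: y) - t * p y | t in [set t | 0 <= t]].
have E0 x : E x !=set0 by exists (p (x + 0 *: y) - 0 * p y), 0 => /=.
have Elb x : has_lbound (E x).
  exists (- p (- x)) => _ [t /= t0 <-].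
  have := pa (x + t *: y) (- x); rewrite addrAC subrr add0r.
  have [->|tn0] := eqVneq t 0; first by rewrite scale0r sublinear0 //; lra.
  have tp : 0 < t by rewrite lt_def tn0.
  have := ph t^-1 (t *: y); rewrite invr_gt0 scalerA mulVf // scale1r => /(_ tp).
  rewrite mulrC ler_pdivlMr // mulrC; lra.
have infE x t : 0 <= t -> inf (E x) <= p (x + t *: y) - t * p y.
  by move=> t0; apply: ge_inf => //; exists t.
exists (fun x => inf (E x)); split.
- split=> [x x'|a x a0].
  + rewrite -lerBlDr; apply: lb_le_inf => // _ [t t0 <-].
    rewrite lerBlDr [leRHS]addrC -lerBlDr; apply: lb_le_inf => // _ [t' t'0 <-].
    have := infE (x + x') (t + t') (addr_ge0 t0 t'0).
    have := pa (x + t *: y) (x' + t' *: y).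
    rewrite addrACA -scalerDl; lra.
  + rewrite mulrC -ler_pdivrMr //; apply: lb_le_inf => // _ [t t0 <-].
    rewrite ler_pdivrMr //.
    have := infE (a *: x) (a * t) (mulr_ge0 (ltW a0) t0).
    by have := ph a (x + t *: y) a0; rewrite scalerDr scalerA; lra.
- by move=> x; have := infE x 0 (lexx _); rewrite scale0r addr0 mul0r subr0.
- have := infE (- y) 1 ler01; rewrite scale1r addNr sublinear0 //; lra.
Qed.

(* A minimal sublinear functional is linear: by sublinear_shift it is odd. *)
Lemma hahn_banach p y : sublinear p -> exists f : V -> R,
  [/\ forall a x z, f (a *: x + z) = a * f x + f z,
      forall x, f x <= p x & f y = p y].
Proof.
(* Shifting along [y] beforehand forces every linear functional below [q] to attain [p] at [y]. *)
move=> ps; have [q [qs qp qy]] := sublinear_shift y ps.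
have [f [fs fq fmin]] := minimal_sublinear qs.
have fN x : f (- x) = - f x.
  have [g [gs gf gx]] := sublinear_shift x fs.
  by have := fmin _ gs gf (- x); have := sublinearN x fs; lra.
have fD x z : f (x + z) = f x + f z.
  have := fs.1 x z; have := fs.1 (x + z) (- z); rewrite addrK fN; lra.
have fZp a x : 0 < a -> f (a *: x) = a * f x.
  move=> a0; have := fs.2 a x a0; have := fs.2 a (- x) a0.
  by rewrite scalerN !fN; lra.
have fZ a x : f (a *: x) = a * f x.
  have [a0|a0|->] := ltgtP a 0; last by rewrite scale0r mul0r sublinear0.
    have := fZp (- a) x; rewrite oppr_gt0 => /(_ a0).
    by rewrite scaleNr fN; lra.
  exact: fZp.
exists f; split=> [a x z|x|]; first by rewrite fD fZ.
  exact: le_trans (fq x) (qp x).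
have := fq (- y); have := fq y; have := qp y; rewrite fN; lra.
Qed.

End HahnBanach.

Section Dual.
Context {R : realType} {X : normedModType R}.
Implicit Types (f : dual_space X) (x y : X) (A C W : set X).

Lemma dual_bounded f : exists2 M, 0 < M & forall x, `|f x| <= M * `|x|.
Proof.
have /linear_boundedP := continuous_linear_bounded 0 (@dual_continuous _ _ f 0).
move=> /pinfty_ex_gt0[M M0 fM]; exists M => // x; exact: fM.
Qed.

Lemma dual_of_bounded (f : X -> R) (M : R) :
  (forall a x y, f (a *: x + y) = a * f x + f y) ->
  (forall x, `|f x| <= M * `|x|) -> exists g : dual_space X, g =1 f.
Proof.
move=> flin fM.
pose l : {linear X -> R^o} := HB.pack f (GRing.isLinear.Build R X R^o _ f flin).
have lc : continuous l.
  apply: bounded_linear_continuous; apply/linear_boundedP.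
  near=> N => x; apply: le_trans (fM x) _.
  by rewrite ler_wpM2r.
by exists (Dual lc).
Unshelve. all: by end_near. Qed.

End Dual.

(** * Spans, separation and dense subsets *)

Section Span.
Context {R : realType} {X : normedModType R}.
Implicit Types (f : dual_space X) (x y : X) (A C W : set X).

Lemma closure_normP A x :
  closure A x <-> forall e, 0 < e -> exists2 y, A y & `|x - y| < e.
Proof.
split=> [Ax e e0|Ax B /nbhs_normP[e /= e0 eB]].
  have [|y [Ay xy]] := Ax (ball x e); first exact: nbhsx_ballx.
  by exists y => //; move: xy; rewrite -ball_normE.
by have [y Ay xy] := Ax e e0; exists y; split => //; exact: eB.
Qed.

Definition subspace_set W := W 0 /\ forall a x y, W x -> W y -> W (a *: x + y).

Lemma subspace_setD W x y : subspace_set W -> W x -> W y -> W (x + y).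
Proof. by move=> [_ Wl] Wx /(Wl 1 _ _ Wx); rewrite scale1r. Qed.

Lemma subspace_setZ W a x : subspace_set W -> W x -> W (a *: x).
Proof. by move=> [W0 Wl] Wx; rewrite -[_ *: _]addr0; exact: Wl. Qed.

Lemma subspace_setB W x y : subspace_set W -> W x -> W y -> W (x - y).
Proof.
move=> Ws Wx Wy; apply: subspace_setD => //.
by rewrite -scaleN1r; exact: subspace_setZ.
Qed.

Lemma subspace_set_sum W n (v : 'I_n -> X) : subspace_set W ->
  (forall i, W (v i)) -> W (\sum_i v i).
Proof.
move=> Ws Wv; elim/big_ind: _ => //; first exact: Ws.1.
by move=> x y; exact: subspace_setD.
Qed.

Lemma lin_span_min A W : subspace_set W -> A `<=` W -> lin_span A `<=` W.
Proof.
move=> Ws AW _ [n [a [v [Av ->]]]]; apply: subspace_set_sum => // i.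
by apply: subspace_setZ => //; exact: AW.
Qed.

Lemma sub_lin_span A : A `<=` lin_span A.
Proof.
by move=> x Ax; exists 1, (fun=> 1), (fun=> x); rewrite big_ord1 scale1r.
Qed.

Lemma lin_span_subspace A : subspace_set (lin_span A).
Proof.
split; first by exists 0, (fun=> 0), (fun=> 0); split=> [[]//|]; rewrite big_ord0.
move=> c _ _ [n [a [v [Av ->]]]] [m [b [w [Aw ->]]]].
exists (n + m)%N,
  (fun i : 'I_(n + m) => match fintype.split i with inl i => c * a i | inr i => b i end),
  (fun i : 'I_(n + m) => match fintype.split i with inl i => v i | inr i => w i end).
split; first by move=> i; case: fintype.split.
rewrite big_split_ord scaler_sumr; congr (_ + _); apply: eq_bigr => i _.
  by rewrite (unsplitK (inl i)) scalerA.
by rewrite (unsplitK (inr i)).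
Qed.

Lemma lin_spanS A C : A `<=` C -> lin_span A `<=` lin_span C.
Proof.
move=> AC; apply: lin_span_min; first exact: lin_span_subspace.
by move=> x /AC; exact: sub_lin_span.
Qed.

Lemma closure_subspace W : subspace_set W -> subspace_set (closure W).
Proof.
move=> Ws; split; first exact/subset_closure/Ws.1.
move=> a x y /closure_normP Wx /closure_normP Wy; apply/closure_normP => e e0.
have a1 : 0 < `|a| + 1 by apply: ltr_wpDl.
have [x' Wx' xx'] := Wx (e / 2 / (`|a| + 1)) ltac:(by rewrite !divr_gt0).
have [y' Wy' yy'] := Wy (e / 2) ltac:(by rewrite divr_gt0).
exists (a *: x' + y'); first exact: Ws.2.
rewrite opprD addrACA -scalerBr; apply: le_lt_trans (ler_normD _ _) _.
rewrite normrZ [e]splitr; apply: ler_ltD => //.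
move: xx'; rewrite ltr_pdivlMr // => /ltW; apply: le_trans.
by rewrite mulrC ler_wpM2l // lerDl.
Qed.

Definition closed_span A := closure (lin_span A).

Lemma closed_span_subspace A : subspace_set (closed_span A).
Proof. exact/closure_subspace/lin_span_subspace. Qed.

Lemma sub_closed_span A : A `<=` closed_span A.
Proof. by move=> x /sub_lin_span; exact: subset_closure. Qed.

Lemma closed_span_min A W : subspace_set W -> closed W -> A `<=` W ->
  closed_span A `<=` W.
Proof.
move=> Ws Wc AW; rewrite [W](closure_id _).1 //; apply: closureS.
exact: lin_span_min.
Qed.

Lemma closed_span_le A C : A `<=` closed_span C -> closed_span A `<=` closed_span C.
Proof.
by apply: closed_span_min; [exact: closed_span_subspace|exact: closed_closure].
Qed.

Lemma closed_spanS A C : A `<=` C -> closed_span A `<=` closed_span C.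
Proof. by move=> AC; apply: closed_span_le => x /AC; exact: sub_closed_span. Qed.

Lemma dual_ker_subspace f : subspace_set [set x | f x = 0].
Proof.
split; first exact: linear0.
by move=> a x y /= fx fy; rewrite linearP fx fy scaler0 addr0.
Qed.

Lemma closed_dual_ker f : closed [set x | f x = 0].
Proof.
apply: (@closed_comp _ _ f [set 0]) => [x _|]; first exact: dual_continuous.
exact: closed_eq.
Qed.

Lemma dual_eq0_closed_span f A : (forall x, A x -> f x = 0) ->
  forall x, closed_span A x -> f x = 0.
Proof.
move=> fA; apply: closed_span_min => //; first exact: dual_ker_subspace.
exact: closed_dual_ker.
Qed.

Lemma norming_functional y : exists f : dual_space X,
  (forall x, `|f x| <= `|x|) /\ f y = `|y|.
Proof.
have [|f [flin fle fy]] := @hahn_banach _ _ (fun x : X => `|x|) y.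
  by split=> [x z|a x a0]; [exact: ler_normD|rewrite normrZ gtr0_norm].
have f0 : f 0 = 0.
  by have := flin 1 0 0; rewrite scaler0 addr0; lra.
have fb x : `|f x| <= 1 * `|x|.
  rewrite mul1r ler_norml fle andbT lerNl.
  have := flin (-1) x 0; rewrite scaleN1r addr0 f0 addr0 mulN1r => <-.
  by rewrite -normrN; exact: fle.
have [g gf] := dual_of_bounded flin fb; exists g.
by split=> [x|]; rewrite gf; [rewrite -[leRHS]mul1r; exact: fb|exact: fy].
Qed.

(** Hahn-Banach for the distance to [W], which is sublinear, vanishes on [W] and is positive at
    [y]. *)
Lemma hahn_banach_separation W y : subspace_set W -> ~ closure W y ->
  exists f, (forall x, W x -> f x = 0) /\ f y != 0.
Proof.
move=> Ws Wy; pose E x := [set `|x - w| | w in W].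
have E0 x : E x !=set0 by exists `|x - 0|, 0 => //; exact: Ws.1.
have Elb x : has_lbound (E x) by exists 0 => _ [w _ <-].
have infE x w : W w -> inf (E x) <= `|x - w|.
  by move=> Ww; apply: ge_inf => //; exists w.
have [|f [flin fle fy]] := @hahn_banach _ _ (fun x : X => inf (E x)) y.
  split=> [x z|a x a0].
    rewrite -lerBlDr; apply: lb_le_inf => // _ [w Ww <-].
    rewrite lerBlDr [leRHS]addrC -lerBlDr; apply: lb_le_inf => // _ [w' Ww' <-].
    rewrite lerBlDr [leRHS]addrC; apply: le_trans (infE _ (w + w') _) _.
      exact: subspace_setD.
    by rewrite opprD addrACA; exact: ler_normD.
  rewrite mulrC -ler_pdivrMr //; apply: lb_le_inf => // _ [w Ww <-].
  rewrite ler_pdivrMr //; apply: le_trans (infE _ (a *: w) _) _.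
    exact: subspace_setZ.
  by rewrite -scalerBr normrZ gtr0_norm // mulrC.
have f0 : f 0 = 0.
  by have := flin 1 0 0; rewrite scaler0 addr0; lra.
have fN x : f (- x) = - f x.
  by have := flin (-1) x 0; rewrite scaleN1r addr0 f0 addr0 mulN1r.
have fle' x : f x <= `|x|.
  by apply: le_trans (fle x) _; rewrite -[in leRHS](subr0 x); exact/infE/Ws.1.
have fb x : `|f x| <= 1 * `|x|.
  by rewrite mul1r ler_norml fle' andbT lerNl -fN -normrN; exact: fle'.
have [g gf] := dual_of_bounded flin fb; exists g; split=> [x Wx|]; rewrite gf.
  have fW z : W z -> f z <= 0.
    by move=> Wz; apply: le_trans (fle z) _; rewrite (le_trans (infE _ _ Wz)) ?subrr ?normr0.
  apply/eqP; rewrite eq_le fW //= -oppr_le0 -fN; apply: fW.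
  by rewrite -scaleN1r; exact: subspace_setZ.
rewrite fy; apply/negP => /eqP infy; apply: Wy; apply/closure_normP => e e0.
apply: contrapT => nW; suff : e <= inf (E y) by rewrite infy leNgt e0.
apply: lb_le_inf => // _ [w Ww <-]; rewrite leNgt; apply/negP => ye.
by apply: nW; exists w.
Qed.

Lemma lin_span_cons x (s : seq X) y : lin_span [set` x :: s] y ->
  exists a z, lin_span [set` s] z /\ y = a *: x + z.
Proof.
have [s0 sl] := lin_span_subspace [set` s].
apply: (@lin_span_min _ [set y | exists a z, lin_span [set` s] z /\ y = a *: x + z]); [split|].
- by exists 0, 0; split => //; rewrite scale0r addr0.
- move=> c _ _ [a [z [sz ->]]] [b [w [sw ->]]].
  exists (c * a + b), (c *: z + w); split; first exact: sl.
  by rewrite scalerDr scalerA addrACA -scalerDl.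
- move=> z /=; rewrite inE => /orP[/eqP ->|zs].
    by exists 1, 0; rewrite scale1r addr0.
  by exists 0, z; rewrite scale0r add0r; split => //; exact: sub_lin_span.
Qed.

Lemma lin_span_seq A y : lin_span A y ->
  exists s : seq X, (forall x, x \in s -> A x) /\ lin_span [set` s] y.
Proof.
move=> [n [a [v [Av ->]]]]; exists [seq v i | i <- enum 'I_n]; split.
  by move=> x /mapP[i _ ->].
exists n, a, v; split => // i /=; apply/mapP; exists i => //.
by rewrite mem_enum.
Qed.

Lemma seq_span_separable (s : seq X) : exists d : nat -> X,
  (forall k, lin_span [set` s] (d k)) /\
  forall y, lin_span [set` s] y -> forall e, 0 < e -> exists k, `|y - d k| < e.
Proof.
elim: s => [|x s [d [ds dP]]].
  exists (fun=> 0); split=> [k|y sy e e0]; first exact: (lin_span_subspace _).1.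
  exists 0%N; suff -> : y = 0 by rewrite subrr normr0.
  move: y sy; apply: (@lin_span_min _ [set 0]) => //.
  by split=> // a y z -> ->; rewrite scaler0 addr0.
pose d' k := if unpickle k is Some (q, j) then ratr q *: x + d j else 0.
have xs := lin_span_subspace [set` x :: s].
exists d'; split=> [k|y /lin_span_cons[a [z [sz ->]]] e e0].
  rewrite /d'; case: unpickle => [[q j]|]; last exact: xs.1.
  apply: xs.2; first by apply: sub_lin_span; rewrite /= mem_head.
  by apply: lin_spanS (ds j) => y /= ys; rewrite inE ys orbT.
have [j zj] := dP _ sz (e / 2) ltac:(by rewrite divr_gt0).
have x1 : 0 < `|x| + 1 by apply: ltr_wpDl.
(* The rational [q] contributes an error of at most e / 2; the + 1 in the denominator allows x =
   0. *)
have [|q] := @rat_in_itvoo R (a - e / 2 / (`|x| + 1)) a.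
  by rewrite ltrBlDr ltrDl !divr_gt0.
rewrite in_itv /= => /andP[q1 q2].
exists (pickle (q, j)); rewrite /d' pickleK opprD addrACA -scalerBl.
apply: le_lt_trans (ler_normD _ _) _; rewrite [e]splitr normrZ.
apply: ler_ltD => //; rewrite gtr0_norm ?subr_gt0 //.
have : (a - ratr q) * (`|x| + 1) <= e / 2.
  by rewrite -ler_pdivlMr // lerBlDl -lerBlDr ltW.
by apply: le_trans; rewrite ler_wpM2l ?lerDl // subr_ge0 ltW.
Qed.

Lemma span_dense_card {U : pointedType} (B : set U) A : infinite_set B ->
  A #<= B -> exists D,
  [/\ D `<=` lin_span A, D #<= B & closed_span A `<=` closure D].
Proof.
have /choice[d dP] := seq_span_separable => Binf AB.
pose E := [set p : seq X * nat | forall x, x \in p.1 -> A x].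
exists [set d p.1 p.2 | p in E]; split.
- move=> _ [[s k] /= sA <-]; have [+ _] := dP s => /(_ k).
  exact: lin_spanS.
- apply: (card_le_trans (card_image_le _ _)); exact: seq_nat_card_le.
- rewrite [X in _ `<=` X](closure_id _).1; last exact: closed_closure.
  apply: closureS => y /lin_span_seq[s [sA sy]]; apply/closure_normP => e e0.
  have [_ /(_ y sy e e0)[k yk]] := dP s.
  by exists (d s k) => //; exists (s, k).
Qed.

End Span.

(** * Weak compactness *)

Section Ultrafilters.

Lemma ultra_fmap {I T} (F : set_system I) (x : I -> T) :
  UltraFilter F -> UltraFilter (x @ F).
Proof.
move=> FU; split=> [|G GP FG]; first exact: fmap_proper_filter.
apply/seteqP; split=> // A GA; have [//|nA] := in_ultra_setVsetC (x @^-1` A) FU.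
have [t [At nAt]] := filter_ex (filterI GA (FG (~` A) nA)); case: (nAt At).
Qed.

Lemma ultra_finite {T : eqType} (F : set_system T) (E : set T) :
  UltraFilter F -> finite_set E -> F E -> exists2 x, E x & F [set x].
Proof.
move=> FU /finite_seqP[s ->]; elim: s => [|x s IH] Fs.
  by have [] := filter_ex Fs.
have [Fx|Fx] := in_ultra_setVsetC [set x] FU.
  by exists x => //=; rewrite mem_head.
have [|y ys Fy] := IH; last by exists y => //=; rewrite inE ys orbT.
apply: filterS2 Fs Fx => y /=; rewrite inE => /orP[/eqP -> /(_ erefl)//|//].
Qed.

End Ultrafilters.

Section Weak.
Context {R : realType} {X : normedModType R}.
Implicit Types (f : dual_space X) (x y : X) (A C L W : set X).
Local Notation weval := (@weak_eval R X).

Lemma weak_cvgP (F : set_system X) (p : X) : Filter F ->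
  (F --> (p : initial_topology weval)) <->
  forall f : dual_space X, f x @[x --> F] --> f p.
Proof.
move=> FF; split=> [Fp f|Fp].
  have Fe : weval @ F --> weval p.
    by apply: cvg_trans (@initial_continuous _ _ weval p); exact: cvg_app.
  apply: cvg_trans (@proj_continuous (dual_space X) (fun=> R : topologicalType) f (weval p)).
  by move=> A FA; exact: (Fe _ FA).
move=> A; rewrite nbhsE => -[B [Bo Bp] BA]; case: Bo Bp BA => O Oo <- Op BA.
suff : weval @ F --> weval p.
  move=> FO; have /FO FO' : nbhs (weval p) O by exact: open_nbhs_nbhs.
  exact: filterS BA FO'.
apply/cvg_sup => f; rewrite cvg_image; last first.
  by rewrite eqEsubset; split=> v // _; exists (cst v).
move=> B' /Fp FB'; exists (@^~ f @^-1` B') => //.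
by rewrite eqEsubset; split => [j [? + <-//]|j Wj]; exists (fun _ => j).
Qed.

Lemma weak_compactP L : weak_compact L <->
  forall F, UltraFilter F -> F L ->
    exists2 y, L y & forall f : dual_space X, f x @[x --> F] --> f y.
Proof.
rewrite /weak_compact compact_ultra; split=> Lc F FU FL.
  by have [y [Ly /weak_cvgP Fy]] := Lc F FU FL; exists y.
by have [y Ly Fy] := Lc F FU FL; exists y; split => //; exact/weak_cvgP.
Qed.

(** Along one ultrafilter all families in [L] converge at once, which takes the place of passing to
    common subnets. *)
Lemma weak_compact_ultra L {I} (U : set_system I) (x : I -> X) :
  weak_compact L -> UltraFilter U -> (\forall i \near U, L (x i)) ->
  exists2 y, L y & forall f, f (x i) @[i --> U] --> f y.
Proof.
move=> /weak_compactP Lc UU Ux.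
by have [y Ly xy] := Lc _ (ultra_fmap x UU) Ux; exists y.
Qed.

Lemma weak_limit_eq {I} (U : set_system I) (u v : I -> X) y z f :
  ProperFilter U -> f (u i) @[i --> U] --> f y -> f (v i) @[i --> U] --> f z ->
  (\forall i \near U, f (u i) = f (v i)) -> f y = f z.
Proof.
move=> UP uy vz uv; apply: (cvg_unique (@norm_hausdorff _ R^o) uy).
apply: cvg_trans vz.
by apply: near_eq_cvg; apply: filterS uv.
Qed.

(** Closed subspaces are weakly closed: a functional vanishing on [C] but not at [y] would
    contradict the convergence. *)
Lemma weak_limit_closed_span {I} (U : set_system I) (x : I -> X) C y :
  ProperFilter U -> (\forall i \near U, closed_span C (x i)) ->
  (forall f, f (x i) @[i --> U] --> f y) -> closed_span C y.
Proof.
move=> UP Ux xy; apply: contrapT => ny.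
have [f [f0 /eqP fy]] := hahn_banach_separation (lin_span_subspace C) ny.
apply: fy; apply/esym; rewrite -(linear0 f).
apply: (@weak_limit_eq _ U (fun=> 0) x) => //; first exact: cvg_cst.
apply: filterS Ux => i Ci; rewrite linear0; apply/esym.
by apply: dual_eq0_closed_span Ci => z Cz; apply: f0; exact: sub_lin_span.
Qed.

Lemma weak_compact_bounded L f : weak_compact L ->
  exists2 M, 0 < M & forall x, L x -> `|f x| <= M.
Proof.
move=> Lc.
have fc : continuous (fun x : initial_topology weval => f x : R^o).
  by move=> p; exact: (weak_cvgP p (nbhs_filter (p : initial_topology weval))).1.
have := @continuous_compact (initial_topology weval) R^o _ L
  (continuous_subspaceT fc) Lc.
move=> /compact_bounded/pinfty_ex_gt0[M M0 fM].
by exists M => // x Lx; apply: fM; exists x.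
Qed.

Definition c0_set A := forall f e, 0 < e -> finite_set [set x | A x /\ e <= `|f x|].

(** An ultrafilter on the set is principal or contains no finite set. In the second case it avoids
    the finite sets where |f| >= e, for all f and e, and so converges weakly to 0. *)
Lemma c0_set_weak_compact A : c0_set A -> weak_compact (A `|` [set 0]).
Proof.
move=> Ac; apply/weak_compactP => F FU FA.
have [[x [Ax Fx]]|nF] := pselect (exists x, (A `|` [set 0]) x /\ F [set x]).
  exists x => // f B /nbhs_singleton Bfx; by apply: (@filterS _ F _ [set x]) Fx => _ ->; exact: Bfx.
exists 0; first by right.
move=> f; rewrite linear0; apply/cvgr0Pnorm_lt => e e0.
have [E|E] := in_ultra_setVsetC [set x | A x /\ e <= `|f x|] FU.
  by have [x [Ax _] Fx] := ultra_finite FU (Ac f _ e0) E; case: nF; exists x; split => //; left.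
apply: filterS2 FA E => x [Ax|->] Ex; last by rewrite linear0 normr0.
by rewrite ltNge; apply/negP => ex; exact: Ex.
Qed.

Lemma c0_set_countably_supports A : c0_set A -> countably_supports A [set: dual_space X].
Proof.
move=> Ac f _.
apply: (@sub_countable _ _ _
    (\bigcup_(n in [set: nat]) [set x | A x /\ n.+1%:R^-1 <= `|f x|])).
  apply: subset_card_le => x [Ax]; rewrite -normr_gt0 => fx.
  have [n nfx] := ltr_add_invr fx; exists n => //; split => //.
  by rewrite add0r in nfx; exact: ltW.
apply: bigcup_countable => // n _; apply: finite_set_countable.
by apply: Ac; rewrite invr_gt0.
Qed.

End Weak.

(** * The Amir-Lindenstrauss theorem *)

Section Norming.
Context {R : realType} {X : normedModType R}.
Implicit Types (f : dual_space X) (x y u v : X) (A C L W : set X)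
  (G : seq X -> nat -> dual_space X).

(** Countably many functionals for each finite sequence, so that operations on [seq X] indexed by
    [nat] can refer to all of them. *)
Definition norming_system G := (forall s k x, `|G s k x| <= `|x|) /\
  forall s y, lin_span [set` s] y -> forall e, 0 < e ->
    exists k, `|y| <= `|G s k y| + e.

Lemma norming_system_exists : exists G, norming_system G.
Proof.
have /choice[phi phiP] := @norming_functional R X.
have /choice[d dP] := @seq_span_separable R X.
exists (fun s k => phi (d s k)); split=> [s k|s y sy e e0].
  by have [] := phiP (d s k).
have [k yk] := (dP s).2 _ sy (e / 2) ltac:(by rewrite divr_gt0).
exists k; have [phib phid] := phiP (d s k); set h := phi _ in phib phid *.
have := phib (y - d s k); rewrite linearB /=.
rewrite ler_norml phid => /andP[hd _].
have := ler_norm (h y); have := ler_normD (d s k) (y - d s k).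
by rewrite [d s k + _]addrC subrK; lra.
Qed.

Definition agree G C u v := forall s k, s != [::] ->
  (forall x, x \in s -> C x) -> G s k u = G s k v.

Lemma agreeS G C C' u v : C `<=` C' -> agree G C' u v -> agree G C u v.
Proof. by move=> CC' uv s k s0 sC; apply: uv => // x /sC /CC'. Qed.

Lemma agree_sym G C u v : agree G C u v -> agree G C v u.
Proof. by move=> uv s k s0 sC; rewrite uv. Qed.

Lemma agree_trans G C u v w : agree G C u v -> agree G C v w -> agree G C u w.
Proof. by move=> uv vw s k s0 sC; rewrite uv // vw. Qed.

(** Functionals that norm the span of [C] cannot tell [u] from [v]. The norm estimates for both
    [weak_proj] and [diag] rest on this inequality. Three errors e / 4 occur: two from replacing [u]
    by [y], one from norming [y]. *)
Lemma norming_le G C u v : norming_system G -> closed_span C u ->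
  agree G C u v -> `|u| <= `|v|.
Proof.
move=> [Gb Gn] /closure_normP Cu uv; apply/ler_addgt0Pr => e e0.
have e4 : 0 < e / 4 by rewrite divr_gt0.
have [y Cy uy] := Cu _ e4.
have [s [sC sy]] := lin_span_seq Cy; have [k yk] := Gn _ _ sy _ e4.
have := ler_normD y (u - y); rewrite [y + _]addrC subrK => yu'.
have [s0|s0] := eqVneq s [::].
  suff y0 : y = 0 by move: uy yu'; rewrite y0 normr0 subr0; have := normr_ge0 v; lra.
  apply: (@lin_span_min _ _ _ [set 0] _ _ _ sy).
    by split=> // a b z -> ->; rewrite scaler0 addr0.
  by move=> x; rewrite s0.
have := uv s k s0 sC => uvE.
have := Gb s k (u - y); rewrite linearB /= => Guy.
have := ler_normB (G s k u) (G s k u - G s k y); rewrite subKr.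
have := Gb s k v; rewrite -uvE.
by lra.
Qed.

Lemma norming_uniq G C u v : norming_system G -> closed_span C u ->
  closed_span C v -> agree G C u v -> u = v.
Proof.
move=> Gn Cu Cv uv; apply/eqP; rewrite -subr_eq0 -normr_le0 -[leRHS](@normr0 R X).
apply: (norming_le Gn (subspace_setB (closed_span_subspace C) Cu Cv)) => s k s0 sC.
by rewrite linearB /= uv // subrr linear0.
Qed.

(* Every closed set C for such an operation has, on L, a weakly dense image
   under the functionals G t k with t a sequence in C; t ranges over the
   subsequences of s because these must handle finitely many t at once. *)
Definition dense_op G L (op : seq X -> nat -> X) := (forall s j, L (op s j)) /\
  forall s (l : seq (seq X * nat)) n x, L x ->
    (forall p, p \in l -> subseq p.1 s) ->
    exists j, forall p, p \in l ->
      `|G p.1 p.2 (op s j) - G p.1 p.2 x| <= n.+1%:R^-1.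

Lemma dense_op_exists G L : L 0 -> exists op, dense_op G L op.
Proof.
move=> L0.
(* Values are rounded to multiples of 1 / (n + 1) and subsequences are given by masks, so the data
   contain no points of X and fit into one natural number. *)
pose code s (l : seq (bitseq * nat)) (n : nat) x : seq int :=
  [seq Num.floor (G (mask p.1 s) p.2 x * n.+1%:R) | p <- l].
pose op s j := if unpickle j is Some (l, n, c) then
  xget 0 [set z | L z /\ code s l n z = c] else 0.
exists op; split=> [s j|s l n x Lx ls].
  by rewrite /op; case: unpickle => [[[l n] c]|//]; case: xgetP => [z _ []|].
have [l' ll'] : exists l' : seq (bitseq * nat),
    l = [seq (mask p.1 s, p.2) | p <- l'].
  elim: l ls => [|[t k] l IH] ls; first by exists [::].
  have [|l' ->] := IH; first by move=> p pl; apply: ls; rewrite inE pl orbT.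
  have /subseqP[m _ tm] := ls (t, k) (mem_head _ _).
  by exists ((m, k) :: l'); rewrite /= -tm.
exists (pickle (l', n, code s l' n x)); rewrite /op pickleK.
case: xgetP => [z _ [Lz zx]|/(_ x)/=nx]; last by case: nx.
move=> p; rewrite ll' => /mapP[[m k] ml ->] /=.
have /= /eqP fl := (eq_in_map _ _ _).2 zx (m, k) ml.
have n0 : (0 : R) < n.+1%:R by [].
rewrite -[leRHS]mul1r ler_pdivlMr // -[X in _ * X]gtr0_norm // -normrM mulrBl.
have := floor_itv (G (mask m s) k z * n.+1%:R).
rewrite (eqP fl) => /andP[z1 z2].
have /andP[x1 x2] := floor_itv (G (mask m s) k x * n.+1%:R).
move: z1 z2 x1 x2; rewrite intrD rmorph1.
by move: (_%:~R) => t *; rewrite ler_norml; apply/andP; split; lra.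
Qed.

Section WeakProjection.
Context (G : seq X -> nat -> dual_space X) (Gn : norming_system G)
  (L : set X) (Lc : weak_compact L) (L0 : L 0)
  (op : seq X -> nat -> X) (opP : dense_op G L op).

(* The projection of x in L to the closed span of C along the common kernel of
   the functionals G s k, s in C. It is only considered on L, where weak
   compactness alone provides it: L need not be convex. *)
Definition weak_proj C x := xget 0 [set y | [/\ L y, closed_span C y & agree G C y x]].

Lemma weak_proj_uniq C x y : L y -> closed_span C y -> agree G C y x ->
  weak_proj C x = y.
Proof.
move=> Ly Cy yx; rewrite /weak_proj; case: xgetP => [z _ [Lz Cz zx]|/(_ y)[]//].
by apply: (norming_uniq Gn Cz Cy); exact: agree_trans zx (agree_sym yx).
Qed.

Lemma weak_proj_id C y : L y -> closed_span C y -> weak_proj C y = y.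
Proof. by move=> Ly Cy; exact: weak_proj_uniq. Qed.

(** By density of [op], points of [C] agree with [x] up to any error on any finitely many of the
    functionals; a weak limit of such points along an ultrafilter is the projection. *)
Lemma weak_projP C x : op_closed op C -> C `<=` L -> L x ->
  [/\ L (weak_proj C x), closed_span C (weak_proj C x) &
      agree G C (weak_proj C x) x].
Proof.
move=> Cop CL Lx; suff [y [Ly Cy yx]] : exists y,
    [/\ L y, closed_span C y & agree G C y x] by rewrite (weak_proj_uniq Ly Cy yx).
have [C0|/set0P[c Cc]] := eqVneq C set0.
  exists 0; split=> //; first exact: (closed_span_subspace C).1.
  by move=> [//|z s] k _ /(_ z (mem_head _ _)); rewrite C0.
pose D := [set i : seq (seq X * nat) * nat |
  forall p, p \in i.1 -> p.1 != [::] /\ forall z, z \in p.1 -> C z].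
pose E (i : seq (seq X * nat) * nat) := [set z | C z /\
  forall p, p \in i.1 -> `|G p.1 p.2 z - G p.1 p.2 x| <= i.2.+1%:R^-1].
have EP : ProperFilter (filter_from D E).
  apply: filter_from_proper.
    apply: filter_from_filter; first by exists ([::], 0%N).
    move=> [l n] [l' n'] Dl Dl'; exists (l ++ l', maxn n n').
      by move=> p; rewrite mem_cat => /orP[/Dl|/Dl'].
    move=> z [Cz /= zx]; split; split=> // p pl.
      apply: le_trans (zx p _) _; first by rewrite mem_cat pl.
      by rewrite lef_pV2 ?posrE // ler_nat ltnS leq_maxl.
    apply: le_trans (zx p _) _; first by rewrite mem_cat pl orbT.
    by rewrite lef_pV2 ?posrE // ler_nat ltnS leq_maxr.
  (* The point [c] makes [s] nonempty, as closedness of [C] under [op] requires. *)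
  move=> [l n] Dl; pose s := c :: flatten [seq p.1 | p <- l].
  have [|j jP] := opP.2 s l n x Lx.
    move=> p pl; apply: subseq_trans (subseq_cons _ _).
    elim: l pl {Dl s} => [//|q l IH]; rewrite inE => /orP[/eqP ->|/IH pl] /=.
      exact: prefix_subseq.
    exact: subseq_trans pl (suffix_subseq _ _).
  exists (op s j); split => //; apply: Cop => // z.
  rewrite inE => /orP[/eqP -> //|/flattenP[_ /mapP[p pl ->]]].
  by have [_] := Dl p pl; apply.
have [U [UU EU]] := ultraFilterLemma EP.
have UC : U C by apply: EU; exists ([::], 0%N) => // z [].
have [|y Ly Uy] := @weak_compact_ultra _ _ L _ U id Lc UU.
  by apply: filterS UC.
exists y; split=> //.
  apply: (weak_limit_closed_span (ultra_proper) _ Uy).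
  by apply: filterS UC => z; exact: sub_closed_span.
move=> s k s0 sC; apply: (cvg_unique (@norm_hausdorff _ R^o) (Uy (G s k))).
apply/cvgrPdist_lt => e e0.
have [n ne] := ltr_add_invr e0; rewrite add0r in ne.
apply: EU; exists ([:: (s, k)], n).
  by move=> p; rewrite inE => /eqP ->.
move=> z [Cz zx]; rewrite distrC; apply: le_lt_trans ne.
by apply: (zx (s, k)); rewrite inE.
Qed.

Lemma weak_limit_agree {I} (U : set_system I) (x : I -> X) C y z :
  ProperFilter U -> (forall f, f (x i) @[i --> U] --> f y) ->
  (forall s k, s != [::] -> (forall c, c \in s -> C c) ->
     \forall i \near U, G s k (x i) = G s k z) -> agree G C y z.
Proof.
move=> UP xy xz s k s0 sC; apply: (weak_limit_eq UP (xy (G s k)) (cvg_cst _)).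
exact: xz.
Qed.

(** Along an ultrafilter of tails of the chain, the projections of [x] converge weakly to the
    projection for the union, and closed spans are weakly closed. This handles the limit stages
    [clt]. *)
Lemma weak_proj_bigcup {I} (D : set I) (C : I -> set X) W x :
  (forall i, D i -> op_closed op (C i)) -> (forall i, D i -> C i `<=` L) ->
  (forall i j, D i -> D j -> C i `<=` C j \/ C j `<=` C i) -> L x ->
  (forall i, D i -> closed_span W (weak_proj (C i) x)) ->
  closed_span W (weak_proj (\bigcup_(i in D) C i) x).
Proof.
move=> Cop CL Ctot Lx CW; have [D0|/set0P[i0 Di0]] := eqVneq D set0.
  rewrite D0 bigcup_set0.
  have -> : weak_proj set0 x = 0; last exact: (closed_span_subspace W).1.
  apply: weak_proj_uniq => //; first exact: (closed_span_subspace _).1.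
  by move=> [//|z s] k _ /(_ z (mem_head _ _)).
have Cdir i j : D i -> D j -> exists k, [/\ D k, C i `<=` C k & C j `<=` C k].
  by move=> Di Dj; have [ij|ji] := Ctot _ _ Di Dj; [exists j|exists i]; split.
pose E i := [set k | D k /\ C i `<=` C k].
have EP : ProperFilter (filter_from D E).
  apply: filter_from_proper; last by move=> i Di; exists i; split.
  apply: filter_from_filter; first by exists i0.
  move=> i j Di Dj; have [k [Dk ik jk]] := Cdir _ _ Di Dj.
  exists k => // l [Dl kl]; split; split=> //.
    exact: subset_trans ik kl.
  exact: subset_trans jk kl.
have [U [UU EU]] := ultraFilterLemma EP.
have UD : U D by apply: EU; exists i0 => // k [].
have [|y Ly Uy] := @weak_compact_ultra _ _ L _ U (fun i => weak_proj (C i) x) Lc UU.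
  by apply: filterS UD => i Di; have [] := weak_projP (Cop _ Di) (CL _ Di) Lx.
have -> : weak_proj (\bigcup_(i in D) C i) x = y.
  apply: weak_proj_uniq => //.
    apply: (weak_limit_closed_span ultra_proper _ Uy); apply: filterS UD => i Di.
    have [_ + _] := weak_projP (Cop _ Di) (CL _ Di) Lx.
    by apply: closed_spanS; exact: bigcup_sup.
  apply: (weak_limit_agree ultra_proper Uy) => s k s0 sC.
  have [i Di si] := directed_bigcup_seq (ex_intro _ i0 Di0) Cdir sC.
  apply: EU; exists i => // l [Dl il].
  have [_ _] := weak_projP (Cop _ Dl) (CL _ Dl) Lx.
  by apply=> // z /si /il.
apply: (weak_limit_closed_span ultra_proper _ Uy).
by apply: filterS UD => i; exact: CW.
Qed.

End WeakProjection.
End Norming.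

(** * Rescaling to a c0 set *)

Section Weights.
Context {R : realType} {X : normedModType R}.
Implicit Types (f : dual_space X) (x y : X) (A C L W : set X) (w : X -> R).

Definition c0_weight A w := (forall x, 0 < w x <= 1) /\
  forall f e, 0 < e -> finite_set [set x | A x /\ e <= w x * `|f x|].

(** The weights are 1 / (i + 1) along an enumeration: if M bounds |f| on [A], then e <= M / (i + 1)
    bounds i. *)
Lemma countable_c0_weight A : countable A ->
  (forall f, exists M, forall x, A x -> `|f x| <= M) -> exists w, c0_weight A w.
Proof.
move=> /countable_injP[i iI] Ab; exists (fun x => (i x).+1%:R^-1).
split=> [x|f e e0].
  by rewrite invr_gt0 ltr0n /= invf_le1 ?ltr0n // ler1n.
have [M fM] := Ab f.
have /archi_boundP MN : 0 <= `|M / e| by [].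
apply/finite_set_leP; exists (Num.bound `|M / e|); apply/card_le_injP; exists i.
split=> [x [Ax ex]|x y [Ax _] [Ay _] /iI]; last by apply; exact: mem_set.
rewrite /= -(ltr_nat R); apply: lt_trans MN.
apply: lt_le_trans (ler_norm _); rewrite ltr_pdivlMr //.
apply: lt_le_trans (fM x Ax).
by rewrite mulrC ler_pdivlMr // in ex; apply: lt_le_trans ex; rewrite mulrC ltr_pM2l // ltr_nat.
Qed.

Lemma c0_weight_c0_set A w : c0_weight A w -> c0_set [set w x *: x | x in A].
Proof.
move=> [w01 wf] f e e0; apply: sub_finite_set (finite_image (fun x => w x *: x) (wf f e e0)).
move=> _ [[x Ax <-] ex]; exists x => //; split => //.
have /andP[w0 _] := w01 x.
by rewrite linearZ /= normrZ gtr0_norm in ex.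
Qed.

Lemma c0_weight_closed_span A w : c0_weight A w ->
  A `<=` closed_span [set w x *: x | x in A].
Proof.
move=> [w01 _] x Ax; have /andP[w0 _] := w01 x.
rewrite -[x](scalerK (lt0r_neq0 w0)).
apply: (subspace_setZ _ (closed_span_subspace _)).
by apply: sub_closed_span; exists x.
Qed.

End Weights.

Section WCGtoC0.
Context {R : realType} {X : normedModType R}.
Implicit Types (f : dual_space X) (x y : X) (A C D L W : set X).
Context (G : seq X -> nat -> dual_space X) (Gn : norming_system G).
Local Notation pr L C x := (weak_proj G L C x).

Section Pieces.
Context (L : set X) (Lc : weak_compact L) (L0 : L 0)
  (op : seq X -> nat -> X) (opP : dense_op G L op).
Context (C C' : set X) (Cop : op_closed op C) (C'op : op_closed op C')
  (CC' : C `<=` C') (C'L : C' `<=` L).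

Let CL : C `<=` L. Proof. exact: subset_trans C'L. Qed.

(** With the factor 1/2, a bound of |f| on [L] remains a bound on the piece. *)
Definition piece := [set 2^-1 *: (pr L C' x - pr L C x) | x in L].

(** Weak continuity of [weak_proj] on [L]: a limit of projections lies in the closed span and agrees
    with [y0], which characterizes the projection of [y0]. *)
Lemma weak_proj_limit {I} (U : set_system I) (x : I -> X) E y0 :
  UltraFilter U -> op_closed op E -> E `<=` L ->
  (forall i, L (x i)) -> L y0 -> (forall f, f (x i) @[i --> U] --> f y0) ->
  forall f, f (pr L E (x i)) @[i --> U] --> f (pr L E y0).
Proof.
move=> UU Eop EL Lx Ly0 Uy0.
have [|p Lp Up] := weak_compact_ultra (x := fun i => pr L E (x i)) Lc UU.
  by apply: filterS filterT => i _; have [] := weak_projP Gn Lc L0 opP Eop EL (Lx i).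
suff -> : pr L E y0 = p by [].
apply: weak_proj_uniq => //.
  apply: (weak_limit_closed_span ultra_proper _ Up).
  by apply: filterS filterT => i _; have [] := weak_projP Gn Lc L0 opP Eop EL (Lx i).
move=> s k s0 sC; apply: (weak_limit_eq ultra_proper (Up (G s k)) (Uy0 (G s k))).
apply: filterS filterT => i _.
by have [_ _] := weak_projP Gn Lc L0 opP Eop EL (Lx i); apply.
Qed.

Lemma piece_weak_compact : weak_compact piece.
Proof.
apply/weak_compactP => F FU FL.
have /choice[x xP] : forall z, exists x, L x /\
    (piece z -> z = 2^-1 *: (pr L C' x - pr L C x)).
  move=> z; have [[x Lx <-]|nz] := pselect (piece z); first by exists x.
  by exists 0.
have Lx z : L (x z) by have [] := xP z.
have [|y Ly Uy] := weak_compact_ultra (x := x) Lc FU.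
  by apply: filterS filterT => z _.
exists (2^-1 *: (pr L C' y - pr L C y)); first by exists y.
move=> f; apply: cvg_trans (_ : (fun z => 2^-1 * (f (pr L C' (x z)) - f (pr L C (x z)))) @ F --> _).
  apply: near_eq_cvg; apply: filterS FL => z /(xP z).2 zE /=.
  by rewrite [in RHS]zE linearZ linearB.
rewrite linearZ linearB; apply: cvgMr; apply: cvgB; exact: weak_proj_limit.
Qed.

Lemma piece0 : piece 0.
Proof.
have p0 E : pr L E 0 = 0.
  by apply: weak_proj_id => //; exact: (closed_span_subspace _).1.
by exists 0 => //; rewrite !p0 subrr scaler0.
Qed.

(** It shows that the piece is generated by a set no larger than C'. Projecting to C' first does not
    change the projection to C, so points of the closed span of C' suffice. [weak_proj] is not a
    linear map on X, but [norming_le] bounds the error between the projection of [y] and the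
    combination of the projections of the [v i] by the error between [y] and the combination of the
    [v i]. *)
Lemma piece_closed_span :
  piece `<=` closed_span [set 2^-1 *: (c - pr L C c) | c in C'].
Proof.
set W := closed_span _; have Ws : subspace_set W by exact: closed_span_subspace.
move=> _ [x Lx <-]; set y := pr L C' x.
have [Ly C'y yx] := weak_projP Gn Lc L0 opP C'op C'L Lx.
have <- : pr L C y = pr L C x.
  have [Lp Cp pE] := weak_projP Gn Lc L0 opP Cop CL Ly.
  apply/esym/weak_proj_uniq => //; apply: agree_trans pE _.
  exact: agreeS yx.
apply: (subspace_setZ _ Ws).
move: (C'y); rewrite -/y => /closure_normP Cy.
apply/closure_normP => e e0.
have [_ [n [a [v [C'v ->]]]] yz] := Cy (e / 2) ltac:(by rewrite divr_gt0).
exists (\sum_i a i *: (v i - pr L C (v i))).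
  apply: (subspace_set_sum (lin_span_subspace _)) => i.
  apply: (subspace_setZ _ (lin_span_subspace _)).
  have -> : v i - pr L C (v i) = 2 *: (2^-1 *: (v i - pr L C (v i))).
    by rewrite scalerA divff // scale1r.
  by apply: (subspace_setZ _ (lin_span_subspace _)); apply: sub_lin_span; exists (v i).
have -> : y - pr L C y - \sum_i a i *: (v i - pr L C (v i)) =
    (y - \sum_i a i *: v i) - (pr L C y - \sum_i a i *: pr L C (v i)).
  under eq_bigr do rewrite scalerBr.
  rewrite sumrB !opprB addrACA [RHS]addrACA; congr (_ + _); exact: addrC.
apply: le_lt_trans (ler_normB _ _) _; rewrite [e]splitr; apply: ltr_leD => //.
apply: le_trans (ltW yz).
have [_ Cpy pyE] := weak_projP Gn Lc L0 opP Cop CL Ly.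
apply: (@norming_le _ _ G C) => //.
  apply: (subspace_setB (closed_span_subspace _)) => //.
  apply: (subspace_set_sum (closed_span_subspace _)) => i.
  apply: (subspace_setZ _ (closed_span_subspace _)).
  by have [] := weak_projP Gn Lc L0 opP Cop CL (C'L (C'v i)).
move=> s k s0 sC; rewrite !linearB /= pyE // !linear_sum /=.
congr (_ + _); apply: eq_bigr => i _; rewrite !linearZ /=.
have [_ _ ag] := weak_projP Gn Lc L0 opP Cop CL (C'L (C'v i)).
by rewrite (ag s k s0 sC).
Qed.

End Pieces.
End WCGtoC0.

Section AmirLindenstrauss.
Context {R : realType} {X : normedModType R}.
Implicit Types (f : dual_space X) (x y : X) (A C D L W : set X).

(** The induction runs on the size of the generating set [D]. The domination clause lets smallness
    of a functional on a piece pass to the c0 set found for this piece. *)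
Definition c0_generated D := forall L, weak_compact L -> L 0 -> D `<=` L ->
  L `<=` closed_span D -> exists A, [/\ c0_set A, L `<=` closed_span A &
    forall f M, (forall x, L x -> `|f x| <= M) -> forall x, A x -> `|f x| <= M].

Lemma countable_c0_generated D : countable D -> c0_generated D.
Proof.
move=> Dc L Lc L0 DL LD.
have [|w wD] := countable_c0_weight Dc.
  by move=> f; have [M _ fM] := weak_compact_bounded f Lc; exists M => x /DL /fM.
exists [set w x *: x | x in D]; split.
- exact: c0_weight_c0_set.
- apply: subset_trans LD _; apply: closed_span_le; exact: c0_weight_closed_span.
- move=> f M fM _ [x Dx <-]; have /andP[w0 w1] := wD.1 x.
  rewrite linearZ /= normrZ gtr0_norm //; apply: le_trans (fM _ (DL _ Dx)).
  by rewrite ler_piMl.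
Qed.

(* A functional is small on all but finitely many of the pieces cut out by
   consecutive initial segments of D, by a gliding hump. *)
Lemma c0_generated_step D (lt : X -> X -> Prop) (j : X -> X) :
  strict_well_order lt -> set_inj_on D j ->
  (forall d, D d -> forall op S,
     S #<= op_closure op (initial lt D j d) -> c0_generated S) ->
  c0_generated D.
Proof.
move=> wo jI IH L Lc L0 DL LD; have [wf ltT tot] := wo.
have [G Gn] := @norming_system_exists R X.
have [op opP] := dense_op_exists G L0.
pose Cle := cle op lt j D; pose Clt := clt op lt j D.
have CleL d : Cle d `<=` L by apply: cle_sub => // s k _ _; exact: opP.1.
have CltCle d : Clt d `<=` Cle d by exact: clt_cle.
have CltL d : Clt d `<=` L by exact: subset_trans (CltCle d) (CleL d).
have Clec d : op_closed op (Cle d) by exact: cle_closed.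
have Cltc d : op_closed op (Clt d) by exact: clt_closed.
pose P_ d := piece G L (Clt d) (Cle d).
have /choice[A_ A_P] : forall d, exists A, D d -> [/\ c0_set A, P_ d `<=` closed_span A &
    forall f M, (forall x, P_ d x -> `|f x| <= M) -> forall x, A x -> `|f x| <= M].
  move=> d; have [Dd|] := pselect (D d); last by exists set0.
  have [||||A AP] := IH d Dd op [set 2^-1 *: (c - weak_proj G L (Clt d) c) | c in Cle d]
    (card_image_le _ _) (P_ d).
  - by apply: (piece_weak_compact Gn Lc L0 opP) => //; exact: Clec.
  - exact: (piece0 Gn L0).
  - move=> _ [c Cc <-]; exists c; first exact: (CleL d).
    congr (_ *: (_ - _)); apply: weak_proj_id => //; first exact: (CleL d).
    exact: sub_closed_span.
  - by apply: (piece_closed_span Gn Lc L0 opP) => //; exact: Clec.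
  - by exists A.
pose A := \bigcup_(d in D) A_ d.
have dom f M : (forall x, L x -> `|f x| <= M) -> forall d x, P_ d x -> `|f x| <= M.
  move=> fM d _ [x Lx <-].
  have [L1 _ _] := weak_projP Gn Lc L0 opP (Clec _) (CleL d) Lx.
  have [L2 _ _] := weak_projP Gn Lc L0 opP (Cltc d) (CltL d) Lx.
  rewrite linearZ linearB /= normrZ gtr0_norm //.
  have := fM _ L1; have := fM _ L2.
  by have := ler_normB (f (weak_proj G L (Cle d) x)) (f (weak_proj G L (Clt d) x)); lra.
exists A; split.
- move=> f e e0.
  have e2 : 0 < e / 2 by rewrite divr_gt0.
  (* By domination, a piece on which |f| stays below e / 2 contributes no point with |f| >= e; each
     of the finitely many others contributes finitely many. *)
  suff fin : finite_set [set d | D d /\ exists2 x, P_ d x & e / 2 <= `|f x|].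
    apply: sub_finite_set (bigcup_finite fin (F := fun d => [set x | A_ d x /\ e <= `|f x|]) _).
      move=> x [[d Dd Ax] ex]; exists d => //; split => //.
      apply: contrapT => nd; have [_ _ /(_ f (e / 2))] := A_P d Dd.
      move=> /(_ _ x Ax) fx; suff : e <= e / 2 by lra.
      apply: le_trans ex (fx _) => z Pz; rewrite leNgt; apply/negP => ez.
      by apply: nd; exists z => //; exact: ltW.
    by move=> d [Dd _]; have [/(_ f e e0)] := A_P d Dd.
  apply: contrapT => inf.
  have [|d dP] := swo_increasing_sequence wo _ inf (j := j).
    by move=> x y [Dx _] [Dy _]; exact: jI.
  have /choice[x xP] : forall n, exists x, L x /\
      e / 2 <= `|f (2^-1 *: (weak_proj G L (Cle (d n)) x - weak_proj G L (Clt (d n)) x))|.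
    by move=> n; have [[_ [_ [x Lx <-] ex]] _] := dP n; exists x.
  have dlt m n : (m < n)%N -> lt (j (d m)) (j (d n)).
    elim: n => // n IHn; rewrite ltnS leq_eqVlt => /orP[/eqP ->|/IHn mn].
      exact: (dP n).2.
    exact: ltT mn (dP n).2.
  have [U [UU ooU]] := ultraFilterLemma (eventually_filter : ProperFilter \oo).
  pose q n := weak_proj G L (Cle (d n)) (x n).
  pose p n := weak_proj G L (Clt (d n)) (x n).
  have qP n := weak_projP Gn Lc L0 opP (Clec _) (CleL (d n)) (xP n).1.
  have pP n := weak_projP Gn Lc L0 opP (Cltc (d n)) (CltL (d n)) (xP n).1.
  have [|y Ly Uy] := weak_compact_ultra (x := p) Lc UU.
    by apply: filterS filterT => n _; have [] := pP n.
  have [|z Lz Uz] := weak_compact_ultra (x := q) Lc UU.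
    by apply: filterS filterT => n _; have [] := qP n.
  pose C := \bigcup_n Cle (d n).
  have Cz : closed_span C z.
    apply: (weak_limit_closed_span ultra_proper _ Uz); apply: filterS filterT => n _.
    by have [_ + _] := qP n; apply: closed_spanS => c cn; exists n.
  have Cy : closed_span C y.
    apply: (weak_limit_closed_span ultra_proper _ Uy); apply: filterS filterT => n _.
    have [_ + _] := pP n; apply: closed_spanS => c /CltCle cn.
    by exists n.
  (* For [s] in [Cle (d m)] and n > m, both [p n] and [q n] have the same value as [x n] under
     [G s k], so the limits agree on [C] and coincide. But f (q n) - f (p n) stays at least e in
     absolute value. *)
  have yz : y = z.
    apply: (norming_uniq Gn Cy Cz) => s k s0 sC.
    have [m _ sm] : exists2 m, setT m & forall c, c \in s -> Cle (d m) c.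
      apply: directed_bigcup_seq sC; first by exists 0%N.
      move=> m n _ _; have [mn|nm] := cle_total op wo j D (d m) (d n).
        by exists n; split.
      by exists m; split.
    apply: (weak_limit_eq ultra_proper (Uy (G s k)) (Uz (G s k))).
    apply: ooU; exists m.+1 => // n /= mn.
    have [_ _ ->//] := pP n; last first.
      by move=> c /sm; apply: cle_clt; [have [[]] := dP m|exact: dlt].
    have [_ _ ->//] := qP n => c /sm; apply: cle_mono => //.
    exact: (swo_asym wo (dlt _ _ mn)).
  have : f (q n) - f (p n) @[n --> U] --> f z - f y.
    by apply: cvgB; [exact: Uz|exact: Uy].
  rewrite yz subrr => /cvgr0_norm_lt/(_ e e0) /filter_ex[n].
  have [_] := xP n; rewrite linearZ linearB /= normrZ gtr0_norm //.
  by rewrite -/(q n) -/(p n); lra.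
- apply: subset_trans LD _; apply: closed_span_le => d0 Dd0.
  have Ws := closed_span_subspace A.
  have PA d : D d -> P_ d `<=` closed_span A.
    move=> Dd; have [_ + _] := A_P d Dd; move=> /subset_trans; apply.
    by apply: closed_spanS; exact: bigcup_sup.
  (* Transfinite induction: the projection to [Cle d] is the one to [Clt d], a limit stage, plus
     twice an element of the piece. *)
  have qA d x : D d -> L x -> closed_span A (weak_proj G L (Cle d) x).
    move=> + Lx.
    have [b bd] : exists b, b = j d by exists (j d).
    elim/(well_founded_ind wf): b d bd => b IHb d bd Dd.
    have pA : closed_span A (weak_proj G L (Clt d) x).
      apply: (weak_proj_bigcup Gn Lc L0 opP) => //.
        by move=> i i' _ _; exact: cle_total.
      by move=> i [Di ij]; apply: (IHb (j i) _ i) => //; rewrite bd.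
    have : closed_span A (2^-1 *: (weak_proj G L (Cle d) x - weak_proj G L (Clt d) x)).
      by apply: (PA d Dd); exists x.
    move=> /(subspace_setZ 2 Ws); rewrite scalerA divff // scale1r.
    by move=> /(subspace_setD Ws)/(_ pA); rewrite subrK.
  rewrite -(@weak_proj_id _ _ G Gn L (Cle d0) d0).
  - exact: qA (DL _ Dd0).
  - exact: DL.
  - exact/sub_closed_span/mem_cle.
- by move=> f M fM x [d Dd]; have [_ _ + ] := A_P d Dd; apply; exact: dom.
Qed.

Lemma WCG_c0_set : WCG X -> exists A, c0_set A /\ @linearly_dense R X A.
Proof.
move=> [K [Kd Kc]].
have Lc : weak_compact (K `|` [set 0]).
  apply/weak_compactP => F FU FL.
  have [FK|FK] := in_ultra_setVsetC K FU.
    by have [y Ky Fy] := (weak_compactP K).1 Kc F FU FK; exists y => //; left.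
  exists 0; first by right.
  move=> f; apply: cvg_near_cst; apply: filterS2 FL FK => x [Kx|->] nK //.
have [A [Ac KA _]] := card_ind countable_c0_generated c0_generated_step
  (K `|` [set 0]) _ Lc (or_intror erefl) (@subset_refl _ _) (@sub_closed_span _ _ _).
exists A; split => //; apply/seteqP; split => // x _.
have : closed_span K x by rewrite /closed_span Kd.
by apply: closed_span_le => y Ky; apply: KA; left.
Qed.

End AmirLindenstrauss.

(** * From skeletons and resolutions to WCG *)

Section LimnEsup.
Context {R : realType}.
Implicit Types u : (\bar R)^nat.

Lemma limn_esup_ge u (l : \bar R) : (forall n, l <= u n)%E -> (l <= limn_esup u)%E.
Proof.
move=> lu; apply: le_ereal_inf_tmp => _ [B [N _ NB] <-].
by apply: le_trans (lu N) _; apply: ereal_sup_ubound; exists N => //; apply: NB => /=.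
Qed.

Lemma limn_esup_le0 u : (forall e : R, 0 < e -> \forall n \near \oo, (u n <= e%:E)%E) ->
  (limn_esup u <= 0)%E.
Proof.
move=> ue; apply/lee_addgt0Pr => e e0; rewrite add0e.
apply: le_trans (_ : (ereal_sup [set u n | n in [set n | u n <= e%:E]] <= _)%E).
  by apply: ereal_inf_lbound; exists [set n | (u n <= e%:E)%E] => //; exact: ue.
by apply: ge_ereal_sup => _ [n /= un <-].
Qed.

End LimnEsup.

Section Shrinking.
Context {R : realType} {X : normedModType R} {d : Order.disp_t} {I : porderType d}.
Implicit Types (P : I -> bounded_proj X) (A : set X) (f : dual_space X).

Lemma shrinking_gap P A f (s_ : nat -> I) s e : shrinking P A 0 f ->
  incr_seq s_ -> supremums (range s_) s -> 0 < e ->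
  ~ (forall n, exists2 x, A x & e <= `|f (P (s_ n) x) - f (P s x)|).
Proof.
move=> /[apply] /[apply]; rewrite mul0e => rho0 e0 ex.
suff : (e%:E <= 0)%E by rewrite lee_fin leNgt e0.
apply: le_trans rho0; apply: limn_esup_ge => n; have [x Ax fx] := ex n.
apply: (@le_trans _ _ `|f (P (s_ n) x) - f (P s x)|%:E); first by rewrite lee_fin.
by apply: ereal_sup_ubound; exists x.
Qed.

End Shrinking.

Section ToWCG.
Context {R : realType} {X : normedModType R}.
Implicit Types (f : dual_space X) (x y : X) (A C D L W : set X) (w : X -> R).

Lemma c0_weight_WCG A w : c0_weight A w -> linearly_dense A -> WCG X.
Proof.
move=> wA Ad; exists ([set w x *: x | x in A] `|` [set 0]); split; last first.
  exact/c0_set_weak_compact/c0_weight_c0_set.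
apply/seteqP; split=> // x _.
have : closed_span A x by rewrite /closed_span Ad.
apply: closed_span_le => y /(c0_weight_closed_span wA).
by apply: closed_spanS; exact: subsetUl.
Qed.

Lemma unit_ball_bounded A f : A `<=` @unit_ball R X ->
  exists M, forall x, A x -> `|f x| <= M.
Proof.
move=> A1; have [M M0 fM] := dual_bounded f; exists M => x /A1 x1.
by apply: le_trans (fM x) _; rewrite ger_pMr.
Qed.

Lemma c0_weightS A C w : A `<=` C -> c0_weight C w -> c0_weight A w.
Proof.
move=> AC [w01 wC]; split=> // f e e0.
by apply: sub_finite_set (wC f e e0) => x [/AC].
Qed.

Lemma c0_weight_layers {J : Type} (l : X -> J) A :
  (forall i, exists w, c0_weight [set x | A x /\ l x = i] w) ->
  (forall f e, 0 < e -> finite_set [set l x | x in [set x | A x /\ e <= `|f x|]]) ->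
  exists w, c0_weight A w.
Proof.
move=> /choice[w wP] lfin; exists (fun x => w (l x) x); split=> [x|f e e0].
  exact: (wP (l x)).1.
apply: sub_finite_set (bigcup_finite (lfin f e e0)
  (F := fun i => [set x | (A x /\ l x = i) /\ e <= w i x * `|f x|]) _); last first.
  by move=> i _; exact: (wP i).2.
move=> x [Ax ex]; exists (l x) => //; exists x => //; split => //.
apply: le_trans ex _; have /andP[_ w1] := (wP (l x)).1 x.
by rewrite ler_piMl.
Qed.

(** A functional norming a point [d] closer to [x] than a third of the norm of [x] cannot vanish at
    [x]: otherwise |d| <= |x - d| and |x| < 2|x| / 3. So countably many functionals see all nonzero
    points of [S]. *)
Lemma separable_countable_support A S D : S `<=` A -> countable D ->
  S `<=` closure D -> countably_supports A [set: dual_space X] -> countable [set x | S x /\ x != 0].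
Proof.
move=> SA Dc SD Asupp.
have /choice[phi phiP] := @norming_functional R X.
apply: (@sub_countable _ _ _ (\bigcup_(d in D) [set x | A x /\ phi d x != 0])); last first.
  by apply: bigcup_countable => // d Dd; exact: Asupp.
apply: subset_card_le => x [Sx x0].
have x3 : 0 < `|x| / 3 by rewrite divr_gt0 // normr_gt0.
have /closure_normP/(_ _ x3)[d Dd xd] := SD _ Sx.
exists d => //; split; first exact: SA.
have [phib phid] := phiP d; apply/eqP => phix.
have := phib (x - d); rewrite linearB /= phix phid sub0r normrN normr_id.
by have := ler_normD d (x - d); rewrite [d + _]addrC subrK; lra.
Qed.

Lemma separable_proj_support (P : bounded_proj X) A : separable (range P) ->
  countably_supports A [set: dual_space X] -> countable [set x | A x /\ P x != 0].
Proof.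
move=> [D [DP Dc PD]] Asupp.
have /choice[phi phiP] := @norming_functional R X.
apply: (@sub_countable _ _ _
  (\bigcup_(d in D) [set x | A x /\ adjoint P (phi d) x != 0])); last first.
  by apply: bigcup_countable => // d Dd; exact: Asupp.
apply: subset_card_le => x [Ax x0].
have x3 : 0 < `|P x| / 3 by rewrite divr_gt0 // normr_gt0.
have /closure_normP/(_ _ x3)[d Dd xd] : closure D (P x) by apply: PD; exists x.
exists d => //; split => //.
have [phib phid] := phiP d; apply/eqP => phix.
have := phib (P x - d); rewrite linearB /= phid.
have -> : phi d (P x) = 0 by exact: phix.
rewrite sub0r normrN normr_id.
by have := ler_normD d (P x - d); rewrite [d + _]addrC subrK; lra.
Qed.

Lemma countable_enum {T : pointedType} (S A : set T) a : countable S -> S `<=` A -> A a ->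
  exists e : nat -> T, (forall k, A (e k)) /\ S `<=` range e.
Proof.
move=> /countable_injP[i iI] SA Aa.
exists (fun k => xget a [set x | S x /\ i x = k]); split=> [k|x Sx].
  by case: xgetP => // x _ [/SA].
exists (i x) => //; case: xgetP => [y _ [Sy yx]|/(_ x)[]//].
by apply: iI; rewrite ?inE.
Qed.

Section Skeleton.
Context d (I : porderType d) (P : I -> bounded_proj X) (A : set X)
  (sP : projectional_skeleton P) (A1 : A `<=` @unit_ball R X)
  (Asupp : countably_supports A [set: dual_space X])
  (shr : forall f, shrinking P A 0 f).

(* For a sequence x_n violating c0-smallness with x_n in the n-th of increasing
   layers, the projections attached to [:: x_(n-1); ..; x_0] kill x_n while
   their supremum fixes it, which contradicts shrinking. *)
Lemma skeleton_c0_weight : exists w, c0_weight A w.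
Proof.
have [A0|/set0P[a0 Aa0]] := eqVneq A set0.
  by apply: countable_c0_weight; rewrite A0 // => f; exists 0.
have Pid s t x : (s <= t)%O -> P t (P s x) = P s x.
  by move=> /(skeleton_comp sP)-/(_ x)[_ <-].
have /choice[u uP] : forall x, exists s, P s x = x.
  move=> x; have [s _ [y _ <-]] : (\bigcup_s range (P s)) x by rewrite skeleton_cover.
  by exists s; exact: bproj_idem.
have /choice[up upP] : forall p : I * I, exists t, (p.1 <= t)%O /\ (p.2 <= t)%O.
  by move=> p; exact: (skeleton_directed sP).
(* [s F] lies above [u x] for every [x] in [F], and [s (x :: F)] lies above [s F]. *)
pose s := foldr (fun x t => up (u x, t)) (u 0).
pose supp F := [set x | A x /\ P (s F) x != 0].
(* A set closed under [op] contains every point of [A] that is not killed by [P (s F)] for some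
   nonempty [F] in the set. *)
have /choice[op opP] : forall F, exists e : nat -> X,
    (forall k, A (e k)) /\ supp F `<=` range e.
  move=> F; apply: (countable_enum (a := a0)) => //; last by move=> x [].
  by apply: separable_proj_support => //; exact: skeleton_separable.
apply: (@card_ind _ (fun D => D `<=` A -> exists w, c0_weight D w)) => //.
  move=> D Dc DA; apply: countable_c0_weight => // f.
  by apply: unit_ball_bounded; exact: subset_trans A1.
move=> D lt j wo jI IH DA; have [_ ltT _] := wo.
have opA : op_closed op A by move=> F k _ _; exact: (opP F).1.
pose Cle := cle op lt j D; pose Clt := clt op lt j D.
have /choice[l lP] : forall x, exists d, D x -> [/\ D d, Cle d x & ~ Clt d x].
  move=> x; have [Dx|] := pselect (D x); last by exists 0.
  by have [d'] := cle_layer wo Dx (mem_cle op wo j Dx); exists d'.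
apply: (c0_weight_layers (l := l)).
  move=> i; have [Di|nDi] := pselect (D i); last first.
    apply: countable_c0_weight.
      suff -> : [set x | D x /\ l x = i] = set0 by [].
      by rewrite -subset0 => x [/lP[+ _ _]] li; rewrite li.
    move=> f; apply: unit_ball_bounded; apply: subset_trans A1 => x [/DA //].
  have [|w wi] := IH i Di op (Cle i) (card_lexx _); first exact: cle_sub.
  by exists w; apply: c0_weightS wi => x [/lP[_ + _]] <-.
move=> f e e0; apply: contrapT => inf.
have [|b bP] := swo_increasing_sequence wo (j := j) _ inf.
  by move=> _ _ [x [Dx _] <-] [y [Dy _] <-]; apply: jI; [have [] := lP x Dx|have [] := lP y Dy].
have /choice[x xP] : forall n, exists x, [/\ D x, l x = b n & e <= `|f x|].
  by move=> n; have [[x [Dx ex] <-] _] := bP n; exists x.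
have blt m n : (m < n)%N -> lt (j (b m)) (j (b n)).
  elim: n => // n IHn; rewrite ltnS leq_eqVlt => /orP[/eqP ->|/IHn mn].
    exact: (bP n).2.
  exact: ltT mn (bP n).2.
pose F := fix F n := if n is n.+1 then x n :: F n else [::].
have FS n : F n.+1 = x n :: F n by [].
have Fx n z : z \in F n -> exists2 m, (m < n)%N & z = x m.
  elim: n => [//|n IHn]; rewrite FS inE => /orP[/eqP ->|/IHn[m mn ->]].
    by exists n.
  by exists m => //; exact: ltnW.
(* The shift by one avoids the empty sequence [F 0], about which closedness says nothing. *)
have sF : incr_seq (fun n => s (F n.+1)).
  by move=> n; rewrite (FS n.+1) /=; have [] := upP (u (x n.+1), s (F n.+1)).
have [t tsup] := skeleton_sigma_complete sP sF.
apply: (shrinking_gap (shr f) sF tsup e0) => n.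
have [Dx lx ex] := xP n.+1; exists (x n.+1); first exact: DA.
have [Db Cx Ctx] := lP _ Dx; rewrite lx in Db Cx Ctx.
have -> : P (s (F n.+1)) (x n.+1) = 0.
  apply/eqP; apply: contrapT => /negP Px; apply: Ctx.
  have [|k _ <-] := (opP (F n.+1)).2 (x n.+1); first by split => //; exact: DA.
  apply: clt_closed => //.
  move=> z /Fx[m mn ->]; have [Dm lm _] := xP m.
  by have [Dbm + _] := lP _ Dm; rewrite lm in Dbm *; apply: cle_clt => //; exact: blt.
have -> : P t (x n.+1) = x n.+1.
  rewrite -[in LHS](uP (x n.+1)) Pid ?uP //.
  have : (s (F n.+2) <= t)%O by apply: tsup.1; exists n.+1.
  by apply: le_trans; rewrite FS /=; have [] := upP (u (x n.+1), s (F n.+1)).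
by rewrite linear0 sub0r normrN.
Qed.

End Skeleton.
End ToWCG.

Section WellOrderedType.
Context {d : Order.disp_t} {I : orderType d}
  (wo : wochoice.well_order (<=%O : rel I)).

Lemma well_order_min (A : set I) : A !=set0 ->
  exists2 z, A z & forall y, A y -> (z <= y)%O.
Proof.
move=> [x Ax]; have [|z [[zA zmin] _]] := wo (A := fun y => y \in A).
  by exists x; exact: mem_set.
exists z; first exact: set_mem.
by move=> y Ay; apply: zmin; exact: mem_set.
Qed.

Lemma well_order_strict : strict_well_order (fun x y : I => (x < y)%O).
Proof.
split=> [x|x y z|x y]; last 2 first.
- exact: lt_trans.
- by have [xy|xy|xy] := ltgtP x y; [constructor 1|constructor 3|constructor 2].
apply: contrapT => nx.
have [|z nz zmin] := well_order_min (A := [set x | ~ Acc (fun x y : I => (x < y)%O) x]).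
  by exists x.
apply: nz; constructor => y yz; apply: contrapT => /zmin.
by rewrite leNgt yz.
Qed.

End WellOrderedType.

Section SPRItoWCG.
Context {R : realType} {X : normedModType R}.
Context d (I : tbOrderType d) (Q : I -> bounded_proj X) (A : set X)
  (sQ : SPRI Q) (A1 : A `<=` @unit_ball R X)
  (Asupp : countably_supports A [set: dual_space X])
  (QA : forall x, A x -> [set Q a x | a in [set: I]] `<=` [set 0; x])
  (shr : forall f, shrinking Q A 0 f).

(** Each nonzero point of [A] is switched on at a successor step, for otherwise [SPRI_span] would
    make it 0. Points switched on at the same step are countably many by separability. For points
    x_n switched on at increasing indices b_n with supremum s, Q at b_n kills x_n while Q at s fixes
    it, so shrinking keeps f small on almost all layers. *)
Lemma SPRI_c0_weight : exists w, c0_weight A w.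
Proof.
have Iwo := ordinals_wo (SPRI_index sQ).
have Qid a b x : (b <= a)%O -> Q a (Q b x) = Q b x.
  move=> ba; have [->|at1] := eqVneq a \top%O; first exact: (SPRI_top sQ).
  by have [] := SPRI_comp sQ x (_ : (a < \top)%O) ba; rewrite // lt_neqAle at1 lex1.
have QA' x a : A x -> Q a x = 0 \/ Q a x = x by move=> /QA; apply; exists a.
pose jump x a := exists b, [/\ (a < \top)%O, is_succ a b, Q a x = 0 & Q b x = x].
have /choice[l lP] : forall x, exists a, A x /\ x != 0 -> jump x a.
  move=> x; have [[Ax x0]|] := pselect (A x /\ x != 0); last by exists \bot%O.
  apply: contrapT => /forallNP nl; move/eqP: x0; apply.
  have := @SPRI_span _ _ _ _ _ sQ x; rewrite -/(closed_span _).
  apply: (@closed_span_min _ _ _ [set 0]).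
  - by split=> // a y z -> ->; rewrite scaler0 addr0.
  - exact/accessible_closed_set1/hausdorff_accessible/norm_hausdorff.
  - move=> _ [a [b [at1 ab ->]]] /=.
    have ab' : (a <= b)%O by rewrite ltW // ab.1.
    have [Qa|Qa] := QA' x a Ax; have [Qb|Qb] := QA' x b Ax.
    + by rewrite Qa Qb subrr.
    + by case: (nl a) => _; exists b.
    + by have := Qid _ _ x ab'; rewrite !Qa Qb => <-; rewrite subrr.
    + by rewrite Qa Qb subrr.
have gap x a a' : A x -> x != 0 -> jump x a -> (a < a')%O -> Q a' x = x.
  move=> Ax x0 [b [at1 ab Qa Qb]] aa'.
  by rewrite -[in LHS]Qb Qid // ab.2.
apply: (c0_weight_layers (l := l)).
  move=> a; apply: countable_c0_weight; last first.
    by move=> f; apply: unit_ball_bounded; apply: subset_trans A1 => x [].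
  have [[b [at1 ab]]|nab] := pselect (exists b, (a < \top)%O /\ is_succ a b); last first.
    apply: (@sub_countable _ _ _ [set 0]); last exact: countable1.
    apply: subset_card_le => x [Ax lx] /=; apply: contrapT => /eqP x0.
    by have [b [at1 ab _ _]] := lP x (conj Ax x0); rewrite lx in at1 ab; apply: nab; exists b.
  pose S := [set x | A x /\ range (fun x => Q b x - Q a x) x].
  have Ssep : countable [set x | S x /\ x != 0].
    have [D [_ Dc bD]] := SPRI_separable sQ at1 ab.
    by apply: (separable_countable_support _ Dc _ Asupp) => [x []//|x [_ /bD]].
  apply: (@sub_countable _ _ _ ([set x | S x /\ x != 0] `|` [set 0])); last first.
    apply: setU_card_le => //; [exact: infinite_nat|exact: countable1].
    apply: subset_card_le => x [Ax lx].
    have [->|x0] := eqVneq x 0; [by right|left]; split => //; split=> //.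
    have [b' [_ ab' Qa Qb]] := lP x (conj Ax x0); rewrite lx in ab' Qa.
    have bb' : b = b' by apply/eqP; rewrite eq_le ab.2 ?ab'.1 // ab'.2 // ab.1.
    by exists x => //; rewrite Qa bb' Qb subr0.
move=> f e e0; apply: contrapT => inf.
have [|b bP] := swo_increasing_sequence (well_order_strict Iwo) (j := id) _ inf.
  by move=> ? ? _ _.
have /choice[x xP] : forall n, exists x, [/\ A x, l x = b n & e <= `|f x|].
  by move=> n; have [[x [Ax ex] <-] _] := bP n; exists x.
have bincr : incr_seq b by move=> n; rewrite ltW // (bP n).2.
have [|s sub smin] := well_order_min Iwo (A := ubound (range b)).
  by exists \top%O => ? _; exact: lex1.
apply: (shrinking_gap (shr f) bincr (conj sub smin) e0) => n.
have [Ax lx ex] := xP n; exists (x n) => //.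
have x0 : x n != 0.
  by apply: contraTneq ex => ->; rewrite linear0 normr0 -ltNge.
have xj := lP _ (conj Ax x0); rewrite lx in xj.
have -> : Q s (x n) = x n.
  apply: gap xj _ => //; apply: lt_le_trans (bP n).2 _; apply: sub; by exists n.+1.
by have [_ [_ _ -> _]] := xj; rewrite linear0 sub0r normrN.
Qed.

End SPRItoWCG.

(** * From WCG to skeletons and resolutions *)

Section LinearContinuous.
Context {R : realType} {X : normedModType R}.
Implicit Types (T : X -> X) (A W : set X).

(** Unbundled, because these operators come from choice and are combined pointwise; they are bundled
    as projections only at the end. *)
Definition lincont T := (forall a x y, T (a *: x + y) = a *: T x + T y) /\
  continuous T.

Lemma lincont0 T : lincont T -> T 0 = 0.
Proof.
move=> [Tl _]; have := Tl 1 0 0; rewrite !scale1r addr0 => /eqP.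
by rewrite -subr_eq0 opprD addrA subrr add0r oppr_eq0 => /eqP.
Qed.

Lemma lincontB T x y : lincont T -> T (x - y) = T x - T y.
Proof.
by move=> [Tl _]; have := Tl (-1) y x; rewrite !scaleN1r ![- _ + _]addrC.
Qed.

Lemma lincont_id : lincont id.
Proof. by split=> // x; exact: cvg_id. Qed.

Lemma lincont_comp T T' : lincont T -> lincont T' -> lincont (T \o T').
Proof.
move=> [Tl Tc] [T'l T'c]; split=> [a x y|x] /=; first by rewrite T'l Tl.
by apply: continuous_comp; [exact: T'c|exact: Tc].
Qed.

Lemma lincont_sub T T' : lincont T -> lincont T' -> lincont (fun x => T x - T' x).
Proof.
move=> [Tl Tc] [T'l T'c]; split=> [a x y|x] /=.
  by rewrite T'l Tl scalerBr opprD addrACA.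
by apply: (@continuousB _ _ _ T T'); [exact: Tc|exact: T'c].
Qed.

Lemma lincont_closed_span T A W : lincont T ->
  (forall x, A x -> closed_span W (T x)) ->
  forall x, closed_span A x -> closed_span W (T x).
Proof.
move=> Tlc AW; have [W0 Wl] := closed_span_subspace W.
apply: (@closed_span_min _ _ A [set x | closed_span W (T x)]) => //.
  split=> /= [|a x y Wx Wy]; first by rewrite lincont0.
  by rewrite Tlc.1; exact: Wl.
apply: closed_comp; last exact: closed_closure.
by move=> x _; exact: Tlc.2.
Qed.

Lemma lincont_eq T T' A : lincont T -> lincont T' ->
  (forall x, A x -> T x = T' x) -> forall x, closed_span A x -> T x = T' x.
Proof.
move=> Tlc T'lc AT; have [Dl Dc] := lincont_sub Tlc T'lc.
apply: (@closed_span_min _ _ _ [set x | T x = T' x]) => //.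
  split=> /= [|a x y xE yE]; first by rewrite !lincont0.
  by rewrite Tlc.1 T'lc.1 xE yE.
have -> : [set x | T x = T' x] = [set x | (fun x => T x - T' x) x = 0].
  by apply/seteqP; split=> x /= => [->|/eqP]; rewrite ?subrr ?subr_eq0 // => /eqP.
apply: (@closed_comp _ _ (fun x => T x - T' x) [set 0]) => [x _|]; first exact: Dc.
exact/accessible_closed_set1/hausdorff_accessible/norm_hausdorff.
Qed.

Lemma lincont_bounded_proj T : lincont T -> (forall x, T (T x) = T x) ->
  exists P : bounded_proj X, P =1 T.
Proof.
move=> [Tl Tc] Ti.
pose l : {linear X -> X} := HB.pack T (GRing.isLinear.Build R X X _ T Tl).
by exists (BoundedProj (bproj_fun := l) Tc Ti).
Qed.

End LinearContinuous.

Section Splitting.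
Context {R : realType} {X : completeNormedModType R}.
Implicit Types (Y Z : set X).

(** The inequality makes the [Y]-components of a Cauchy sequence in Y + Z Cauchy, so Y + Z is closed
    by completeness and equals X; it also gives uniqueness of the decomposition and the norm
    bound. *)
Lemma contractive_splitting Y Z : subspace_set Y -> subspace_set Z ->
  closed Y -> closed Z -> (forall y z, Y y -> Z z -> `|y| <= `|y + z|) ->
  (forall x, closed_span (Y `|` Z) x) ->
  exists T, [/\ lincont T, forall y, Y y -> T y = y, forall z, Z z -> T z = 0,
    forall x, `|T x| <= `|x| & forall x, Y (T x)].
Proof.
move=> Ys Zs Yc Zc YZ dense.
pose W := [set x | exists y z, [/\ Y y, Z z & x = y + z]].
have Ws : subspace_set W.
  split; first by exists 0, 0; split; [exact: Ys.1|exact: Zs.1|rewrite addr0].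
  move=> a _ _ [y [z [Yy Zz ->]]] [y' [z' [Yy' Zz' ->]]].
  exists (a *: y + y'), (a *: z + z'); split; [exact: Ys.2|exact: Zs.2|].
  by rewrite scalerDr addrACA.
have Wc : closed W.
  move=> x /closure_normP Wx.
  have /choice[y /choice[z yzP]] : forall n : nat, exists y z,
      [/\ Y y, Z z & `|x - (y + z)| < n.+1%:R^-1].
    move=> n; have [|_ [y [z [Yy Zz ->]]] xn] := Wx n.+1%:R^-1; first by [].
    by exists y, z.
  have yzx : y n + z n @[n --> \oo] --> x.
    apply/cvgrPdist_lt => e e0; near=> n; have [_ _] := yzP n.
    move/lt_trans; apply; near: n.
    exact: (near_infty_natSinv_lt (PosNum e0)).
  have ycv : cvg (y @ \oo).
    apply/cauchy_cvgP/cauchy_exP => e e0.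
    have e2 : 0 < e / 2 by rewrite divr_gt0.
    have /cvgrPdist_lt/(_ _ e2) [N _ NP] := yzx.
    exists (y N); exists N => // n /= Nn; rewrite -ball_normE /=.
    have [YN ZN _] := yzP N; have [Yn Zn _] := yzP n.
    have := YZ _ _ (subspace_setB Ys YN Yn) (subspace_setB Zs ZN Zn).
    move=> /le_lt_trans; apply; rewrite addrACA -opprD.
    have xN := NP N (leqnn N); have xn := NP n Nn.
    have -> : y N + z N - (y n + z n) = (x - (y n + z n)) - (x - (y N + z N)).
      by rewrite opprB [RHS]addrC [RHS]addrA subrK.
    by apply: le_lt_trans (ler_normB _ _) _; move: xN xn => /=; lra.
  have zcv : z n @[n --> \oo] --> x - limn y.
    have -> : z = (fun n => y n + z n) - y.
      by apply/funext => n; rewrite !fctE addrC addKr.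
    exact: cvgB.
  exists (limn y), (x - limn y); split; last by rewrite addrC subrK.
    by apply: (@closed_cvg _ _ \oo _ y Y Yc _ _ ycv); apply: nearW => n; have [] := yzP n.
  by apply: (@closed_cvg _ _ \oo _ z Z Zc _ _ zcv); apply: nearW => n; have [] := yzP n.
have WT x : W x.
  by apply: (closed_span_min Ws Wc _ (dense x)) => y [Yy|Zy];
    [exists y, 0; split=> //; [exact: Zs.1|rewrite addr0]|
     exists 0, y; split=> //; [exact: Ys.1|rewrite add0r]].
have uniq y z y' z' : Y y -> Z z -> Y y' -> Z z' -> y + z = y' + z' -> y = y'.
  move=> Yy Zz Yy' Zz' E; apply/eqP; rewrite -subr_eq0 -normr_le0.
  have := YZ _ _ (subspace_setB Ys Yy Yy') (subspace_setB Zs Zz Zz').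
  by rewrite addrACA -opprD E subrr normr0.
have /choice[T TP] : forall x, exists y, Y y /\ exists2 z, Z z & x = y + z.
  by move=> x; have [y [z [Yy Zz ->]]] := WT x; exists y; split=> //; exists z.
have Tuniq x y z : Y y -> Z z -> x = y + z -> T x = y.
  by move=> Yy Zz ->; have [YT [z' Zz' E]] := TP (y + z); apply: uniq YT Zz' Yy Zz _.
have Tl a x y : T (a *: x + y) = a *: T x + T y.
  have [Yx [z Zz xE]] := TP x; have [Yy [z' Zz' yE]] := TP y.
  apply: (Tuniq _ _ (a *: z + z')); [exact: Ys.2|exact: Zs.2|].
  by rewrite {1}xE {1}yE scalerDr addrACA.
have T1 x : `|T x| <= `|x|.
  by have [Yx [z Zz xE]] := TP x; rewrite {2}xE; exact: YZ.
exists T; split=> // [|y Yy|z Zz|x].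
- split=> //; pose l : {linear X -> X} := HB.pack T (GRing.isLinear.Build R X X _ T Tl).
  apply: (@bounded_linear_continuous _ _ _ l); apply/linear_boundedP.
  near=> N => x; apply: le_trans (T1 x) _; rewrite -[leLHS]mul1r.
  by rewrite ler_wpM2r.
- by apply: (Tuniq _ _ 0) => //; [exact: Zs.1|rewrite addr0].
- by apply: (Tuniq _ _ z) => //; [exact: Ys.1|rewrite add0r].
- by have [] := TP x.
Unshelve. all: by end_near. Qed.

End Splitting.

(** * Operators that are diagonal on a linearly dense set *)

Section Diagonal.
Context {R : realType} {X : normedModType R} (A : set X)
  (Ad : forall x, closed_span A x).
Implicit Types (S C : set X) (T : X -> X).

Definition diag_op S T := lincont T /\
  forall x, A x -> (S x -> T x = x) /\ (~ S x -> T x = 0).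

Definition has_diag S := exists T, diag_op S T.

(** Such an operator is determined by [S] because [A] is linearly dense, so identities between
    operators become identities between sets. [id] is a default value. *)
Definition diag S : X -> X :=
  if pselect (has_diag S) is left Sd then projT1 (cid Sd) else id.

Lemma diagP S : has_diag S -> diag_op S (diag S).
Proof. by rewrite /diag; case: pselect => // Sd _; exact: projT2 (cid Sd). Qed.

Lemma diag_op_eq S S' T T' : diag_op S T -> diag_op S' T' ->
  (forall x, A x -> S x <-> S' x) -> T =1 T'.
Proof.
move=> [Tlc ST] [T'lc ST'] SS' x.
suff E y : A y -> T y = T' y by exact: (lincont_eq Tlc T'lc E (@Ad x)).
move=> Ay.
have [Sy|Sy] := pselect (S y).
  by rewrite (ST y Ay).1 // (ST' y Ay).1 //; exact/SS'.
by rewrite (ST y Ay).2 // (ST' y Ay).2 // => S'y; exact/Sy/(SS' _ Ay).2.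
Qed.

Lemma diag_unique S T : diag_op S T -> diag S =1 T.
Proof.
move=> ST; have Sd : diag_op S (diag S) by apply: diagP; exists T.
exact: (diag_op_eq Sd ST).
Qed.

Lemma diag_opI S S' T T' : diag_op S T -> diag_op S' T' ->
  diag_op (S `&` S') (T \o T').
Proof.
move=> [Tlc ST] [T'lc ST']; split; first exact: lincont_comp.
move=> x Ax /=; split=> [[Sx S'x]|SS'x].
  by rewrite (ST' x Ax).1 // (ST x Ax).1.
have [S'x|S'x] := pselect (S' x); last by rewrite (ST' x Ax).2 // lincont0.
by rewrite (ST' x Ax).1 // (ST x Ax).2 // => Sx; apply: SS'x.
Qed.

Lemma diag_opD S S' T T' : diag_op S T -> diag_op S' T' -> S' `<=` S ->
  diag_op (S `\` S') (fun x => T x - T' x).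
Proof.
move=> [Tlc ST] [T'lc ST'] S'S; split; first exact: lincont_sub.
move=> x Ax; split=> [[Sx S'x]|SS'x].
  by rewrite (ST x Ax).1 // (ST' x Ax).2 // subr0.
have [S'x|S'x] := pselect (S' x).
  by rewrite (ST' x Ax).1 // (ST x Ax).1 ?subrr //; exact: S'S.
rewrite (ST' x Ax).2 // (ST x Ax).2 ?subrr // => Sx; exact: SS'x.
Qed.

Lemma has_diagI S S' : has_diag S -> has_diag S' ->
  has_diag (S `&` S').
Proof.
by move=> [T ST] [T' ST']; exists (T \o T'); exact: diag_opI.
Qed.

Lemma has_diagT : has_diag A.
Proof. by exists id; split=> //; exact: lincont_id. Qed.

Lemma has_diagD S S' : has_diag S -> has_diag S' ->
  has_diag (S `\` S').
Proof.
move=> Sd S'd; have [T ST] := Sd; have [T' ST'] := has_diagI Sd S'd.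
have -> : S `\` S' = S `\` (S `&` S').
  by apply/seteqP; split=> x [Sx S'x]; split=> //; [by case=> _ /S'x|by move=> S'x'; exact: S'x].
by exists (fun x => T x - T' x); apply: diag_opD => // x [].
Qed.

Lemma has_diagU S S' : S `<=` A -> S' `<=` A ->
  has_diag S -> has_diag S' -> has_diag (S `|` S').
Proof.
move=> SA S'A Sd S'd.
have -> : S `|` S' = A `\` ((A `\` S) `\` S').
  apply/seteqP; split=> x.
    move=> [Sx|Sx]; split.
    - exact: SA.
    - by case=> -[_ /(_ Sx)].
    - exact: S'A.
    - by case=> _ /(_ Sx).
  move=> [Ax nx]; have [Sx|Sx] := pselect (S x); [by left|right].
  by apply: contrapT => S'x; apply: nx.
have AT := has_diagT.
by apply: (has_diagD AT); apply: has_diagD S'd; exact: has_diagD.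
Qed.

Lemma diag_comp S S' x : has_diag S -> has_diag S' ->
  diag S (diag S' x) = diag (S `&` S') x.
Proof.
by move=> /diagP ST /diagP ST'; rewrite (diag_unique (diag_opI ST ST')).
Qed.

Lemma diag_sub S S' x : has_diag S -> has_diag S' -> S' `<=` S ->
  diag S x - diag S' x = diag (S `\` S') x.
Proof.
by move=> /diagP ST /diagP ST' S'S; rewrite (diag_unique (diag_opD ST ST' S'S)).
Qed.

Lemma diag_idem S x : has_diag S -> diag S (diag S x) = diag S x.
Proof. by move=> Sd; rewrite diag_comp // setIid. Qed.

Lemma diag_range S x : S `<=` A -> has_diag S -> closed_span S (diag S x).
Proof.
move=> SA /diagP[Slc ST]; apply: (lincont_closed_span (A := A)) => // y Ay.
have [Sy|Sy] := pselect (S y); first by rewrite (ST y Ay).1 //; exact: sub_closed_span.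
by rewrite (ST y Ay).2 //; exact: (closed_span_subspace _).1.
Qed.

Lemma diag_id S x : S `<=` A -> has_diag S -> closed_span S x -> diag S x = x.
Proof.
move=> SA /diagP[Slc ST]; apply: (lincont_eq Slc lincont_id) => y Sy.
by rewrite (ST y (SA _ Sy)).1.
Qed.

Lemma diag0 S x : has_diag S -> (forall y, A y -> ~ S y) -> diag S x = 0.
Proof.
move=> /diagP[Slc ST] SA; have lc0 : lincont (fun=> 0 : X).
  by split=> [a y z|y]; [rewrite scaler0 addr0|exact: cvg_cst].
have E y : A y -> diag S y = 0 by move=> Ay; rewrite (ST y Ay).2 //; exact: SA.
exact: (lincont_eq Slc lc0 E (@Ad x)).
Qed.

End Diagonal.

Section ClosedSets.
Context {R : realType} {X : completeNormedModType R} (A : set X)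
  (Ad : forall x, closed_span A x) (A0 : A 0)
  (Asupp : countably_supports A [set: dual_space X])
  (G : seq X -> nat -> dual_space X) (Gn : norming_system G).

Lemma support_op_exists : exists op : seq X -> nat -> X,
  (forall s m, A (op s m)) /\
  forall s k x, A x -> G s k x != 0 -> exists m, op s m = x.
Proof.
have /choice[e eP] : forall sk : seq X * nat, exists e : nat -> X,
    (forall k, A (e k)) /\ [set x | A x /\ G sk.1 sk.2 x != 0] `<=` range e.
  move=> sk; apply: (countable_enum (a := 0)) => //; first exact: Asupp.
  by move=> x [].
exists (fun s m => if unpickle m is Some (k, i) then e (s, k) i else 0); split.
  by move=> s m; case: unpickle => // -[k i]; exact: (eP _).1.
move=> s k x Ax Gx; have [|i _ <-] := (eP (s, k)).2 x; first by [].
by exists (pickle (k, i)); rewrite pickleK.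
Qed.

Context (op : seq X -> nat -> X)
  (opP : forall s k x, A x -> G s k x != 0 -> exists m, op s m = x).

(** For [s] in [C], closedness puts the whole support of [G s k] in [C], so [G s k] vanishes on the
    rest of [A]. Adding a vector from the span of the rest thus cannot lower the norm of a vector in
    the span of [C]. *)
Lemma closed_has_diag C : C `<=` A -> op_closed op C ->
  has_diag A C /\ forall x, `|diag A C x| <= `|x|.
Proof.
move=> CA Cc.
have [|||||x|T [Tlc TC TA T1 _]] := @contractive_splitting _ _
    (closed_span C) (closed_span (A `\` C)).
- exact: closed_span_subspace.
- exact: closed_span_subspace.
- exact: closed_closure.
- exact: closed_closure.
- move=> y z Cy Az; apply: (norming_le Gn Cy) => s k s0 sC.
  rewrite linearD /=; suff -> : G s k z = 0 by rewrite addr0.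
  apply: dual_eq0_closed_span Az => x [Ax nCx]; apply/eqP; apply: contrapT => /negP Gx.
  by have [m mx] := opP Ax Gx; apply: nCx; rewrite -mx; exact: Cc.
- apply: closed_span_le (@Ad x) => y Ay; apply: sub_closed_span.
  by have [Cy|Cy] := pselect (C y); [left|right]; apply: sub_closed_span.
have Td : diag_op A C T.
  split=> // x Ax; split=> Cx; first by apply: TC; exact: sub_closed_span.
  by apply: TA; exact: sub_closed_span.
by split=> [|x]; [exists T|rewrite (diag_unique (@Ad) Td)].
Qed.

End ClosedSets.

(** * Well-orders with countable classes and diagonal projections *)

Section Resolving.
Context {R : realType} {X : completeNormedModType R} (A : set X)
  (Ad : forall x, closed_span A x)
  (G : seq X -> nat -> dual_space X) (Gn : norming_system G)
  (op : seq X -> nat -> X) (opA : forall s m, A (op s m))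
  (opP : forall s k x, A x -> G s k x != 0 -> exists m, op s m = x).
Implicit Types (C D W : set X) (r : X -> X -> Prop).

(** Norm continuity along chains: the projection u for the union is close to a combination y of
    points of one [C i]. The projection for [C i] fixes y and has norm at most 1, so it moves u by
    at most 2|u - y|. *)
Lemma diag_bigcup {I} (D : set I) (C : I -> set X) W x :
  (forall i, D i -> op_closed op (C i)) -> (forall i, D i -> C i `<=` A) ->
  (forall i j, D i -> D j -> C i `<=` C j \/ C j `<=` C i) ->
  (forall i, D i -> closed_span W (diag A (C i) x)) ->
  closed_span W (diag A (\bigcup_(i in D) C i) x).
Proof.
move=> Cop CA Ctot CW; set E := \bigcup_(i in D) C i.
have Cdir i j : D i -> D j -> exists k, [/\ D k, C i `<=` C k & C j `<=` C k].
  by move=> Di Dj; have [ij|ji] := Ctot _ _ Di Dj; [exists j|exists i]; split.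
have Ec : op_closed op E by exact: op_closed_bigcup.
have EA : E `<=` A by move=> y [i Di]; exact: CA.
have [Ed _] := closed_has_diag (@Ad) Gn opP EA Ec.
have [W0 _] := closed_span_subspace W.
have /closure_normP Ex := @diag_range _ _ _ (@Ad) _ x EA Ed.
rewrite /closed_span [closure _](closure_id _).1; last exact: closed_closure.
apply/closure_normP => e e0.
have [y Ey xy] := Ex (e / 2) ltac:(by rewrite divr_gt0).
have [s [sE sy]] := lin_span_seq Ey.
have [s0|s0] := eqVneq s [::].
  exists 0 => //; have y0 : y = 0.
    apply: (@lin_span_min _ _ _ [set 0] _ _ _ sy).
      by split=> // a b z -> ->; rewrite scaler0 addr0.
    by move=> z; rewrite s0.
  by rewrite y0 subr0 in xy *; apply: lt_trans xy _; lra.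
have [i Di si] : exists2 i, D i & forall z, z \in s -> C i z.
  apply: (directed_bigcup_seq _ Cdir sE).
  by case: s s0 sE {sy} => // z s _ /(_ z (mem_head _ _))[i Di _]; exists i.
have [Cd C1] := closed_has_diag (@Ad) Gn opP (CA _ Di) (Cop _ Di).
exists (diag A (C i) x); first exact: CW.
have iE : C i `&` E = C i by apply: setIidl => z iz; exists i.
have -> : diag A (C i) x = diag A (C i) (diag A E x).
  by rewrite (diag_comp (@Ad)) // iE.
have yi : diag A (C i) y = y.
  apply: (diag_id (CA _ Di) Cd); apply: subset_closure.
  exact: lin_spanS sy.
set u := diag A E x in xy *.
have -> : u - diag A (C i) u = (u - y) - diag A (C i) (u - y).
  by rewrite (lincontB _ _ (diagP Cd).1) yi opprB addrA subrK.
apply: le_lt_trans (ler_normB _ _) _.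
by have := C1 (u - y); move: xy; lra.
Qed.

Definition below r C x := [set y | C y /\ r y x].
Definition class r C x := [set y | [/\ C y, ~ r x y & ~ r y x]].

(* A strict weak well-order r of C with countable classes. The last condition
   becomes SPRI_span; it has to be carried through the induction because the
   projections onto initial segments are not uniformly bounded. *)
Definition resolving C r := [/\
  forall S, S `<=` C -> S !=set0 -> exists2 z, S z & forall y, S y -> ~ r y z,
  forall x y z, C x -> C y -> C z -> r x y -> r x z \/ r z y,
  forall x, C x -> [/\ countable (class r C x), has_diag A (class r C x) &
    has_diag A (below r C x)] &
  forall x, closed_span C x ->
    closed_span [set diag A (class r C y) x | y in C] x].

Lemma class_eq C r x y : resolving C r -> C x -> class r C x y ->
  class r C y = class r C x.
Proof.
move=> [_ nt _ _] Cx [Cy xy yx]; apply/seteqP; split=> z [Cz h1 h2]; split=> // rz.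
- by have [|] := nt _ _ y Cx Cz Cy rz.
- by have [|] := nt _ _ y Cz Cx Cy rz.
- by have [|] := nt _ _ x Cy Cz Cx rz.
- by have [|] := nt _ _ x Cz Cy Cx rz.
Qed.

Lemma countable_resolving C : C `<=` A -> op_closed op C -> countable C ->
  resolving C (fun _ _ => False).
Proof.
move=> CA Cc Ccount; have [Cd _] := closed_has_diag (@Ad) Gn opP CA Cc.
have clC x : class (fun _ _ : X => False) C x = C.
  by apply/seteqP; split=> y; [case|split].
split.
- by move=> S _ [z Sz]; exists z => // y _ [].
- by [].
- move=> x Cx; rewrite clC; split=> //.
  have -> : below (fun _ _ : X => False) C x = C `\` C.
    by apply/seteqP; split=> y [].
  exact: has_diagD.
- move=> x Cx; have [C0|/set0P[c Cc']] := eqVneq C set0.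
    by rewrite C0 image_set0; rewrite C0 in Cx.
  apply: sub_closed_span; exists c => //; rewrite clC; exact: diag_id.
Qed.

Section Step.
Context (D : set X) (lt : X -> X -> Prop) (j : X -> X)
  (wo : strict_well_order lt) (jI : set_inj_on D j) (DA : D `<=` A).
Local Notation Cle := (cle op lt j D).
Local Notation Clt := (clt op lt j D).
Local Notation C := (op_closure op D).

(** The order is lexicographic: layers by [lt], points of one layer by the order given for its
    [Cle d]. The second conclusion confines each initial segment to one [Cle d], which will bound
    its cardinality. *)
Lemma resolving_step : (forall d, D d -> exists r, resolving (Cle d) r) ->
  exists r, resolving C r /\
    forall x, C x -> exists2 d, D d & [set y | C y /\ ~ r x y] `<=` Cle d.
Proof.
move=> IH; have [_ ltT tot] := wo.
have irr := swo_irr wo.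
have Ac : op_closed op A by move=> s k _ _; exact: opA.
have CA : C `<=` A by exact: op_closure_min.
have Cc : op_closed op C by exact: op_closure_closed.
have CleC d : Cle d `<=` C by apply: cle_sub => //; exact: op_closure_sub.
have CleA d : Cle d `<=` A by exact: cle_sub.
have CltCle d : Clt d `<=` Cle d by exact: clt_cle.
have CltA d : Clt d `<=` A by move=> x /CltCle /CleA.
have Cled d : has_diag A (Cle d).
  by have [] := closed_has_diag (@Ad) Gn opP (CleA d) (@cle_closed _ op lt j D d).
have Cltd d : has_diag A (Clt d).
  by have [] := closed_has_diag (@Ad) Gn opP (CltA d) (@clt_closed _ op lt wo j D d).
have /choice[r_ r_P] : forall d, exists r, D d -> resolving (Cle d) r.
  by move=> d; have [/IH[r]|] := pselect (D d); [exists r|exists (fun _ _ => True)].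
have /choice[l lP] : forall x, exists d, C x -> [/\ D d, Cle d x & ~ Clt d x].
  move=> x; have [|] := pselect (C x); last by exists 0.
  rewrite (op_closure_cle op wo j D) => -[d Dd dx].
  by have [d'] := cle_layer wo Dd dx; exists d'.
have lC x : C x -> D (l x) by move=> /lP[].
have lx x : C x -> Cle (l x) x by move=> /lP[].
have l_le y d : C y -> D d -> Cle d y -> ~ lt (j d) (j (l y)).
  by move=> Cy Dd dy dl; have [_ _] := lP y Cy; apply; apply: cle_clt dy.
have l_lt y d : C y -> D d -> Clt d y <-> lt (j (l y)) (j d).
  move=> Cy Dd; split=> [[d' [Dd' d'd] d'y]|ld].
    have [d'l|d'l|ld'] := tot (j d') (j (l y)).
    - by case: (l_le _ _ Cy Dd' d'y).
    - by rewrite -d'l.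
    - exact: ltT ld' d'd.
  by apply: cle_clt ld _ _; [exact: lC|exact: lx].
pose r x y := lt (j (l x)) (j (l y)) \/ l x = l y /\ r_ (l x) x y.
have classE x : C x -> class r C x = class (r_ (l x)) (Cle (l x)) x `\` Clt (l x).
  move=> Cx; have Dx := lC _ Cx; apply/seteqP; split=> y.
    move=> [Cy xy yx]; have Dy := lC _ Cy.
    have lxy : l x = l y.
      have [h|h|h] := tot (j (l x)) (j (l y)); last by case: yx; left.
        by case: xy; left.
      exact: jI.
    split; [split|].
    - by rewrite lxy; exact: lx.
    - by move=> h; apply: xy; right.
    - by move=> h; apply: yx; right; rewrite lxy in h.
    - by move=> /(l_lt _ _ Cy Dx); rewrite lxy; exact: irr.
  move=> [[dy xy yx] ndy]; have Cy := CleC _ _ dy; have Dy := lC _ Cy.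
  have lxy : l x = l y.
    apply: jI => //; have [h|//|h] := tot (j (l x)) (j (l y)).
      by case: (l_le _ _ Cy Dx dy).
    by case: ndy; apply/(l_lt _ _ Cy Dx).
  split=> // -[]; rewrite -?lxy => h; first exact: (irr _ h).
  - by case: h => _; exact: xy.
  - exact: (irr _ h).
  - by case: h => _; exact: yx.
have belowE x : C x -> below r C x = Clt (l x) `|` below (r_ (l x)) (Cle (l x)) x.
  move=> Cx; have Dx := lC _ Cx; apply/seteqP; split=> y.
    move=> [Cy [yx|[lyx yx]]]; first by left; apply/(l_lt _ _ Cy Dx).
    by right; split; [rewrite -lyx; exact: lx|rewrite -lyx].
  move=> [yx|[dy yx]].
    have Cy := CleC _ _ (CltCle _ _ yx); split=> //; left.
    exact/(l_lt _ _ Cy Dx).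
  have Cy := CleC _ _ dy; split => //.
  have [h|h|h] := tot (j (l x)) (j (l y)).
  - by case: (l_le _ _ Cy Dx dy).
  - by right; rewrite (jI (lC _ Cx) (lC _ Cy) h) in yx *.
  - by left.
exists r; split; last first.
  move=> x Cx; exists (l x); first exact: lC.
  move=> y [Cy xy]; have [h|h|h] := tot (j (l x)) (j (l y)).
  - by case: xy; left.
  - by rewrite (jI (lC _ Cx) (lC _ Cy) h); exact: lx.
  - by apply: CltCle; apply/l_lt => //; exact: lC.
split.
- move=> S SC S0.
  have [|_ [s0 Ss0 <-] smin] := @swo_min _ _ wo [set j (l x) | x in S].
    by have [s Ss] := S0; exists (j (l s)), s.
  have [min_ _ _ _] := r_P _ (lC _ (SC _ Ss0)).
  have [||z [Sz lz] zmin] := min_ [set y | S y /\ l y = l s0].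
  - by move=> y [/SC Cy <-]; exact: lx.
  - by exists s0.
  exists z => // y Sy [yz|[lyz yz]].
    by apply: (smin (j (l y))); [exists y|rewrite -lz].
  by apply: (zmin y); [split=> //; rewrite lyz|rewrite -lz -lyz].
- move=> x y z Cx Cy Cz [xy|[lxy xy]].
    have [h|h|h] := tot (j (l x)) (j (l z)); first by left; left.
      by right; left; rewrite -h.
    by right; left; exact: ltT h xy.
  have [h|h|h] := tot (j (l x)) (j (l z)); first by left; left.
    have lxz := jI (lC _ Cx) (lC _ Cz) h.
    have [_ nt _ _] := r_P _ (lC _ Cx).
    have [|||xz|zy] := nt x y z _ _ _ xy.
    - exact: lx.
    - by rewrite lxy; exact: lx.
    - by rewrite lxz; exact: lx.
    - by left; right.
    - by right; right; rewrite -lxz.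
  by right; left; rewrite -lxy.
- move=> x Cx; have [_ _ + _] := r_P _ (lC _ Cx); move=> /(_ x (lx _ Cx))[cc cd bd].
  rewrite classE // belowE //; split.
  + by apply: sub_countable cc; exact: card_le_setD.
  + exact: has_diagD.
  + apply: has_diagU => // y [yx _]; exact: CleA yx.
- move=> x Cx; set W := [set diag A (class r C y) x | y in C].
  have W0 := (closed_span_subspace W).1.
  (* The difference is resolved by the classes of [Cle d]; removing [Clt d] from such a class leaves
     nothing or a whole class of [r]. *)
  have delta d : D d -> closed_span W (diag A (Cle d) x - diag A (Clt d) x).
    move=> Dd; set u := _ - _.
    have uE : u = diag A (Cle d `\` Clt d) x by rewrite /u (diag_sub (@Ad)).
    have du : closed_span (Cle d) u.
      rewrite uE; apply: (@closed_spanS _ _ (Cle d `\` Clt d)) => [y []//|].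
      apply: (diag_range (@Ad)) => [y [/CleA]//|]; exact: has_diagD.
    have [_ nt cl /(_ u du)] := r_P _ Dd; apply: closed_span_le => _ [y dy <-].
    set K := class _ _ _; have [_ Kd _] := cl y dy.
    rewrite uE (diag_comp (@Ad)) //; last exact: has_diagD.
    have [[y0 [Ky0 ny0]]|nK] := pselect (exists y0, K y0 /\ ~ Clt d y0); last first.
      rewrite (diag0 (@Ad)) //; first by apply: has_diagI => //; exact: has_diagD.
      by move=> z _ [Kz [_ nz]]; apply: nK; exists z.
    have [dy0 _ _] := Ky0; have Cy0 := CleC _ _ dy0.
    have ly0 : l y0 = d.
      apply: jI => //; first exact: lC.
      have [h|//|h] := tot (j (l y0)) (j d); first by case: ny0; apply/l_lt.
      by case: (l_le _ _ Cy0 Dd dy0).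
    apply: sub_closed_span; exists y0 => //; congr (diag A _ x).
    rewrite classE // ly0 (class_eq (r_P _ Dd) dy Ky0) -/K.
    by apply/seteqP; split=> z [Kz]; [move=> nz; split=> //; split=> //; case: Kz|case].
  have cleW d : D d -> closed_span W (diag A (Cle d) x).
    have [b bd] : exists b, b = j d by exists (j d).
    have [wf _ _] := wo; elim/(well_founded_ind wf): b d bd => b IHb d bd Dd.
    rewrite -[diag A _ x](subrK (diag A (Clt d) x)).
    apply: (subspace_setD (closed_span_subspace W)); first exact: delta.
    apply: diag_bigcup => [i _|i _|i i' _ _|i [Di ij]].
    - exact: cle_closed.
    - exact: CleA.
    - exact: cle_total.
    - by apply: (IHb (j i) _ i) => //; rewrite bd.
  have Cd : has_diag A C by have [] := closed_has_diag (@Ad) Gn opP CA Cc.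
  rewrite -(diag_id CA Cd Cx) (op_closure_cle op wo j D).
  apply: diag_bigcup => [i _|i _|i i' _ _|i Di].
  - exact: cle_closed.
  - exact: CleA.
  - exact: cle_total.
  - exact: cleW.
Qed.

End Step.

Lemma resolving_exists D : D `<=` A -> exists r, resolving (op_closure op D) r.
Proof.
have Ac : op_closed op A by move=> s k _ _; exact: opA.
move: D; apply: card_ind => [D Dc DA|D lt j wo jI IH DA].
  exists (fun _ _ => False); apply: countable_resolving.
  - exact: op_closure_min.
  - exact: op_closure_closed.
  by apply: op_closure_card_le => //; exact: infinite_nat.
have [//|r [rP _]] := resolving_step wo jI DA; last by exists r.
move=> d Dd; apply: (IH d Dd op); last by move=> x [/DA].
by apply: subset_card_le; exact: op_closure_sub.
Qed.

End Resolving.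

(** * Index orders; normalization and shrinking of c0 sets *)

Section ToppedOrder.
Context {K : choiceType} (lt : K -> K -> Prop) (wo : strict_well_order lt) (k0 : K).

Lemma topped_order : exists (d : Order.disp_t) (I : tbOrderType d) (emb : K -> I),
  [/\ forall a b, (emb a < emb b)%O <-> lt a b, forall a, (emb a < \top)%O,
      forall i, (i < \top)%O -> exists a, i = emb a &
      wochoice.well_order (<=%O : rel I)].
Proof.
have [_ ltT tot] := wo; have irr := swo_irr wo.
pose T := option K.
pose le (x y : T) : bool := match x, y with
  | _, None => true | None, Some _ => false | Some a, Some b => `[< ~ lt b a >] end.
have le_refl : reflexive le by move=> [a|] //=; apply/asboolP; exact: irr.
have le_anti : antisymmetric le.
  move=> [a|] [b|] //= /andP[/asboolP ba /asboolP ab].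
  by have [//|->|//] := tot a b.
have le_trans : transitive le.
  move=> [b|] [a|] [c|] //= /asboolP ab /asboolP bc; apply/asboolP => ca.
  by have [ba|E|cb] := tot a b; [exact: bc (ltT _ _ _ ca ba)|rewrite E in ca|exact: ab].
have le_total : total le.
  move=> [a|] [b|] //=; apply/orP; have [ab|ba] := pselect (lt a b).
    by left; apply/asboolP; exact: swo_asym.
  by right; apply/asboolP.
have [kmin _ kminP] := swo_min wo (ex_intro [set: K] k0 I).
have le_bot : forall x, le (Some kmin) x.
  by move=> [a|] //=; apply/asboolP; exact: kminP.
have le_top : forall x, le x None by case.
pose d := Order.default_display.
pose P : porderType d := HB.pack T (Order.Le_isPOrder.Build d T le_refl le_anti le_trans).
pose O : orderType d := HB.pack T P (Order.POrder_isTotal.Build d P le_total).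
pose B : tbOrderType d := HB.pack T O (Order.hasBottom.Build d O le_bot)
  (Order.hasTop.Build d O le_top).
exists d, B, (Some : K -> B).
have leE (x y : B) : (x <= y)%O = le x y by [].
have topE : (\top%O : B) = None by [].
split.
- move=> a b; rewrite ltNge leE /=; split=> [/asboolPn|ab]; last first.
    by apply/asboolPn => nab; exact: nab.
  by move=> /contrapT.
- by move=> a; rewrite ltNge leE.
- by move=> [a|]; [exists a|rewrite topE ltxx].
- apply: wochoice.antisymmetric_well_order; first by move=> x y; exact: le_anti.
  move=> S [x Sx].
  have [[a Sa]|nS] := pselect (exists a, Some a \in S); last first.
    exists x; split=> // y Sy; case: x Sx nS => [a|] Sx nS; first by case: nS; exists a.
    by case: y Sy nS => [a|//] Sy nS; case: nS; exists a.
  have [b Sb bmin] := swo_min wo (ex_intro [set a | Some a \in S] a Sa).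
  exists (Some b); split=> // -[c|] Sc //; rewrite leE; apply/asboolP; exact: bmin.
Qed.

End ToppedOrder.

Lemma inclusion_order {T : Type} (P : set T -> Prop) :
  exists (d : Order.disp_t) (I : porderType d) (S : I -> set T),
  [/\ forall i, P (S i), forall i k, (i <= k)%O <-> S i `<=` S k &
      forall C, P C -> exists i, S i = C].
Proof.
pose I0 := {classic {C : set T | P C}}.
pose S (i : I0) := sval (i : {C : set T | P C}).
pose le (i k : I0) := `[< S i `<=` S k >].
have le_refl : reflexive le by move=> i; apply/asboolP.
have le_anti : antisymmetric le.
  move=> [C PC] [D PD] /andP[/asboolP /= CD /asboolP /= DC].
  exact/eq_exist/seteqP.
have le_trans : transitive le.
  move=> k i l /asboolP ik /asboolP kl; apply/asboolP; exact: subset_trans ik kl.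
pose d := Order.default_display.
pose I : porderType d := HB.pack I0 (Order.Le_isPOrder.Build d I0 le_refl le_anti le_trans).
exists d, I, S; split.
- by move=> i; exact: (svalP (i : {C : set T | P C})).
- by move=> i k; split=> [/asboolP//|ik]; exact/asboolP.
- by move=> C PC; exists (exist P C PC).
Qed.

Section C0Set.
Context {R : realType} {X : normedModType R}.
Implicit Types (f : dual_space X) (A C D W : set X).

(** Points are divided by 1 + |x|, which is positive also at 0, and then by all n + 1. The c0
    property survives because a large value at the n-th multiple forces (n + 1) e <= |f x|, which
    leaves finitely many x and, for each, finitely many n. *)
Lemma c0_set_normalize A : c0_set A -> linearly_dense A -> exists B,
  [/\ c0_set B, forall x, closed_span B x, B 0, B `<=` @unit_ball R X &
      forall x n, B x -> B (n.+1%:R^-1 *: x)].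
Proof.
move=> Ac Ad.
pose g (p : X * nat) : X := p.2.+1%:R^-1 *: ((1 + `|p.1|)^-1 *: p.1).
have n1 x : 0 < 1 + `|x| by rewrite ltr_wpDr.
have nE n : `|n.+1%:R^-1| = n.+1%:R^-1 :> R by rewrite gtr0_norm.
have wE x : `|(1 + `|x|)^-1| = (1 + `|x|)^-1 :> R by rewrite gtr0_norm // invr_gt0.
exists ([set g p | p in [set p | A p.1]] `|` [set 0]); split.
- move=> f e e0; have fin := Ac f e e0.
  apply: (@sub_finite_set _ _ (\bigcup_(x in [set x | A x /\ e <= `|f x|])
    [set g (x, n) | n in [set n | (n < Num.bound `| `|f x| / e|)%N]])).
    move=> _ [[[[x n] /= Ax <-]|->] ex]; last first.
      by rewrite linear0 normr0 leNgt e0 in ex.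
    have fE : f (g (x, n)) = n.+1%:R^-1 * ((1 + `|x|)^-1 * f x).
      by rewrite /g /= !linearZ.
    have ex' := ex; rewrite fE !normrM nE wE in ex'.
    have a1 : (1 + `|x|)^-1 <= 1 by rewrite invf_le1 // lerDl.
    have ex2 : n.+1%:R * e <= `|f x|.
      rewrite mulrC -ler_pdivlMr // mulrC; apply: le_trans ex' _.
      by rewrite ler_wpM2l ?invr_ge0 // ler_piMl.
    exists x.
      split=> //; apply: le_trans ex2; apply: ler_peMl; first exact: ltW.
      by rewrite ler1n.
    exists n => //=; have /archi_boundP : 0 <= `| `|f x| / e| by [].
    rewrite -(ltr_nat R); apply: le_lt_trans; apply: le_trans (ler_norm _).
    rewrite ler_pdivlMr //; apply: le_trans ex2.
    by apply: ler_wpM2r; [exact: ltW|rewrite ler_nat].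
  apply: bigcup_finite => // x _; apply: finite_image; exact: finite_II.
- move=> x; have : closed_span A x by rewrite /closed_span Ad.
  apply: closed_span_le => y Ay.
  have -> : y = (1 + `|y|) *: g (y, 0%N).
    by rewrite /g /= invr1 scale1r scalerA divff ?scale1r // gt_eqF.
  apply: (subspace_setZ _ (closed_span_subspace _)).
  by apply: sub_closed_span; left; exists (y, 0%N).
- by right.
- move=> _ [[[x n] /= _ <-]|->]; rewrite /unit_ball /= ?normr0 //.
  rewrite /g /= !normrZ nE wE.
  apply: (@le_trans _ _ ((1 + `|x|)^-1 * `|x|)).
    by rewrite ler_piMl ?mulr_ge0 ?invr_ge0 ?(ltW (n1 x)) // invf_le1 // ler1n.
  by rewrite mulrC ler_pdivrMr // mul1r lerDr.
- move=> _ m [[[x n] /= Ax <-]|->]; last by right; rewrite scaler0.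
  left; exists (x, (m.+1 * n.+1).-1) => //.
  have -> : g (x, (m.+1 * n.+1).-1) = (m.+1 * n.+1)%:R^-1 *: ((1 + `|x|)^-1 *: x).
    have mn : (m.+1 * n.+1).-1.+1 = (m.+1 * n.+1)%N by rewrite prednK // muln_gt0.
    by rewrite -[in RHS]mn.
  by rewrite natrM invfM -scalerA.
Qed.

(** On the finitely many points with |f x| >= e, the sets [S (s_ n)] eventually agree with [S s]; at
    any other point the two functionals differ by 0 or by f x up to sign. *)
Lemma c0_shrinking A d (I : porderType d) (P : I -> bounded_proj X)
    (S : I -> set X) f : c0_set A ->
  (forall i x, A x -> (S i x -> P i x = x) /\ (~ S i x -> P i x = 0)) ->
  (forall i k, (i <= k)%O -> S i `<=` S k) ->
  (forall (s_ : nat -> I) s x, incr_seq s_ -> supremums (range s_) s ->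
     A x -> S s x -> exists n, S (s_ n) x) ->
  shrinking P A 0 f.
Proof.
move=> Ac PS Smono Ssup s_ s s_incr s_sup; rewrite mul0e; apply: limn_esup_le0 => e e0.
have s_mono m n : (m <= n)%N -> (s_ m <= s_ n)%O.
  elim: n => [|n IH]; first by rewrite leqn0 => /eqP ->.
  by rewrite leq_eqVlt => /orP[/eqP -> //|/IH/le_trans]; apply.
have s_le n : (s_ n <= s)%O by apply: s_sup.1; exists n.
have /finite_seqP[E EE] := Ac f e e0.
have [N NP] : exists N, forall x, x \in E -> S s x -> S (s_ N) x.
  have EA : forall x, x \in E -> A x.
    by move=> x xE; have : [set` E] x by []; rewrite -EE => -[].
  elim: E EA {EE} => [|x E IH] EA; first by exists 0%N.
  have [|N NP] := IH; first by move=> y yE; apply: EA; rewrite inE yE orbT.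
  have [Sx|Sx] := pselect (S s x); last first.
    by exists N => y; rewrite inE => /orP[/eqP ->|]; [|exact: NP].
  have [M MP] := Ssup _ _ _ s_incr s_sup (EA x (mem_head _ _)) Sx.
  exists (maxn M N) => y; rewrite inE => /orP[/eqP -> _|yE Sy].
    by apply: Smono MP; apply: s_mono; exact: leq_maxl.
  by apply: Smono (NP y yE Sy); apply: s_mono; exact: leq_maxr.
exists N => // n /= Nn; apply: ge_ereal_sup => _ [x Ax <-] /=; rewrite lee_fin.
have [xE|xE] := pselect (e <= `|f x|).
  have xE' : x \in E by have : [set` E] x by rewrite -EE.
  have [Sx|Sx] := pselect (S s x).
    rewrite (PS s x Ax).1 // (PS (s_ n) x Ax).1 ?subrr ?normr0 ?ltW //.
    by apply: Smono (NP x xE' Sx); exact: s_mono.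
  rewrite (PS s x Ax).2 // (PS (s_ n) x Ax).2 ?subrr ?normr0 ?ltW // => Sn.
  by apply: Sx; exact: Smono Sn.
have {}xE : `|f x| <= e by apply/ltW; rewrite ltNge; exact/negP.
have [Sx|Sx] := pselect (S s x); have [Sn|Sn] := pselect (S (s_ n) x).
- by rewrite (PS s x Ax).1 // (PS (s_ n) x Ax).1 // subrr normr0 ltW.
- by rewrite (PS s x Ax).1 // (PS (s_ n) x Ax).2 // linear0 sub0r normrN.
- by rewrite (PS s x Ax).2 // (PS (s_ n) x Ax).1 // linear0 subr0.
- by rewrite (PS s x Ax).2 // (PS (s_ n) x Ax).2 // subrr normr0 ltW.
Qed.

End C0Set.

(** * Construction of the skeleton *)

Section ToSkeleton.
Context {R : realType} {X : completeNormedModType R} (A : set X)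
  (Ac : c0_set A) (Ad : forall x, closed_span A x) (A0 : A 0).
Implicit Types C S : set X.

Lemma diag_bounded_proj {I} (S : I -> set X) :
  (forall i, has_diag A (S i)) ->
  exists P : I -> bounded_proj X, forall i, P i =1 diag A (S i).
Proof.
move=> Sd; suff /choice[P PE] : forall i, exists P : bounded_proj X, P =1 diag A (S i).
  by exists P.
move=> i; apply: lincont_bounded_proj; first exact: (diagP (Sd i)).1.
by move=> x; exact: diag_idem.
Qed.

Lemma closed_span_countable x : exists C,
  [/\ C `<=` A, countable C & closed_span C x].
Proof.
have /closure_normP Ax := @Ad x.
have /choice[s sP] : forall n : nat, exists s : seq X, (forall y, y \in s -> A y) /\
    exists2 y, lin_span [set` s] y & `|x - y| < n.+1%:R^-1.
  move=> n; have [|y /lin_span_seq[s [sA sy]] xy] := Ax n.+1%:R^-1; first by [].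
  by exists s; split => //; exists y.
exists (\bigcup_n [set` s n]); split.
- by move=> y [n _ /= ys]; exact: (sP n).1.
- by apply: bigcup_countable => // n _; apply: finite_set_countable; exact: finite_seq.
- apply/closure_normP => e e0; have [n ne] := ltr_add_invr e0; rewrite add0r in ne.
  have [_ [y sy xy]] := sP n; exists y; last exact: lt_trans xy ne.
  by apply: lin_spanS sy => z zs; exists n.
Qed.

Lemma range_diag S (P : bounded_proj X) : S `<=` A -> has_diag A S ->
  P =1 diag A S -> range P = closed_span S.
Proof.
move=> SA Sd PE; apply/seteqP; split=> [_ [x _ <-]|x Sx].
  by rewrite PE; exact: diag_range.
by exists x => //; rewrite PE diag_id.
Qed.

Lemma c0_set_skeleton : exists (d : Order.disp_t) (I : porderType d)
    (P : I -> bounded_proj X),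
  projectional_skeleton P /\ forall f, shrinking P A 0 f.
Proof.
have Asupp := c0_set_countably_supports Ac.
have [G Gn] := @norming_system_exists R X.
have [op [opA opP]] := support_op_exists A0 Asupp G.
have [d [I [S [SP Sle Sex]]]] := inclusion_order
  (fun C : set X => [/\ C `<=` A, countable C & op_closed op C]).
have SA i : S i `<=` A by have [] := SP i.
have Sc i : op_closed op (S i) by have [] := SP i.
have Sd i : has_diag A (S i) by have [] := closed_has_diag (@Ad) Gn opP (SA i) (Sc i).
have [P PE] := diag_bounded_proj Sd.
have rP i : range (P i) = closed_span (S i) by exact: range_diag.
have clI C : C `<=` A -> countable C -> exists i, C `<=` S i.
  move=> CA Cc; have [|i iE] := Sex (op_closure op C).
    split; last exact: op_closure_closed.
    - by apply: op_closure_min => // s k _ _; exact: opA.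
    - by apply: op_closure_card_le => //; exact: infinite_nat.
  by exists i; rewrite iE; exact: op_closure_sub.
have Smono (s_ : nat -> I) : incr_seq s_ -> forall m n, (m <= n)%N -> S (s_ m) `<=` S (s_ n).
  move=> s_incr m n; elim: n => [|n IH]; first by rewrite leqn0 => /eqP ->.
  rewrite leq_eqVlt => /orP[/eqP -> //|/IH mn]; apply: (subset_trans mn).
  exact/Sle/s_incr.
have Sdir (s_ : nat -> I) m n : incr_seq s_ -> exists k,
    [/\ setT k, S (s_ m) `<=` S (s_ k) & S (s_ n) `<=` S (s_ k)].
  move=> s_incr; exists (maxn m n); split=> //; apply: Smono => //.
    exact: leq_maxl.
  exact: leq_maxr.
have sup (s_ : nat -> I) : incr_seq s_ -> exists2 s, supremums (range s_) s &
    S s = \bigcup_n S (s_ n).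
  move=> s_incr; have [|s sE] := Sex (\bigcup_n S (s_ n)).
    split; first by move=> x [n _]; exact: SA.
    - by apply: bigcup_countable => // n _; have [] := SP (s_ n).
    - by apply: op_closed_bigcup => [n _|m n _ _]; [exact: Sc|exact: Sdir].
  exists s => //; split.
    by move=> _ [n _ <-]; apply/Sle; rewrite sE => x xn; exists n.
  move=> t ts; apply/Sle; rewrite sE => x [n _ nx].
  by have /Sle := ts (s_ n) (ex_intro2 _ _ n Logic.I erefl); apply.
(* By antisymmetry every supremum is the one whose set is the union. *)
have supE (s_ : nat -> I) s : incr_seq s_ -> supremums (range s_) s ->
    S s = \bigcup_n S (s_ n).
  move=> /sup[t [tub tlb] <-] [sub slb].
  by congr (S _); apply/le_anti; rewrite slb // tlb.
exists d, I, P; split; last first.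
  move=> f; apply: (@c0_shrinking R X A d I P S f Ac).
  - move=> i x Ax; have [Slc SE] := diagP (Sd i).
    by rewrite PE; exact: SE.
  - by move=> i k /Sle.
  - move=> s_ s x s_incr /supE -> // Ax [n _ nx]; by exists n.
split.
- move=> i k; have [||l ikl] := clI (S i `|` S k).
  + by move=> x [/SA|/SA].
  + have [_ ic _] := SP i; have [_ kc _] := SP k.
    apply: setU_card_le => //; exact: infinite_nat.
  by exists l; split; apply/Sle => x xi; apply: ikl; [left|right].
- by move=> s_ /sup[s sS _]; exists s.
- move=> i; have [_ ic _] := SP i.
  have [D [Di Dc iD]] := span_dense_card infinite_nat ic.
  by exists D; rewrite rP; split=> // x /Di; exact: subset_closure.
- move=> i k x /Sle ik; rewrite !PE !(diag_comp (@Ad)) //.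
  by rewrite (setIidl ik) (setIidr ik).
- move=> s_ s s_incr s_sup; rewrite rP (supE _ _ s_incr s_sup); apply/seteqP; split.
    apply: closureS => x /lin_span_seq[t [tS tx]].
    have [|n _ tn] := directed_bigcup_seq (ex_intro _ 0%N Logic.I) _ tS.
      by move=> m n _ _; exact: Sdir.
    by exists n => //; rewrite rP; apply: subset_closure; exact: lin_spanS tx.
  rewrite [X in _ `<=` X](closure_id _).1; last exact: closed_closure.
  apply: closureS => x [n _]; rewrite rP; by apply: closed_spanS => y yn; exists n.
- apply/seteqP; split=> // x _; have [C [CA Cc Cx]] := closed_span_countable x.
  have [i Ci] := clI C CA Cc; exists i => //; rewrite rP.
  exact: closed_spanS Cx.
Qed.

End ToSkeleton.

Lemma bigcup_countable_card_le {T I : pointedType} (D : set I) (F : I -> set T) :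
  infinite_set D -> (forall i, D i -> countable (F i)) ->
  \bigcup_(i in D) F i #<= D.
Proof.
move=> Dinf Fc; have [g [gD gI]] := infinite_pairing Dinf.
have /infiniteP/card_le_injP[e [eD eI]] := Dinf.
have /choice[h hI] : forall i, exists h : T -> nat,
    D i -> forall x y, F i x -> F i y -> h x = h y -> x = y.
  move=> i; have [Di|] := pselect (D i); last by exists (fun=> 0%N).
  have /countable_injP[h hI] := Fc i Di.
  by exists h => _ x y Fx Fy; apply: hI; apply: mem_set.
have /choice[k kP] : forall x, exists i, (\bigcup_(i in D) F i) x -> D i /\ F i x.
  move=> x; have [[i Di Fx]|] := pselect ((\bigcup_(i in D) F i) x); last by exists point.
  by exists i.
apply/card_le_injP; exists (fun x => g (k x) (e (h (k x) x))); split.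
  by move=> x /kP[Dk _]; apply: gD => //; exact: eD.
move=> x y /kP[Dx Fx] /kP[Dy Fy] /(gI _ _ _ _ Dx (eD _ _) Dy (eD _ _))[//|//|kxy].
by move=> /eI; rewrite -kxy in Fy * => /(_ _ _)/hI; apply.
Qed.

(* Stability under division by integers makes A infinite unless X = 0, so that
   its cardinality is dens X also for separable X. *)
Section Density.
Context {R : realType} {X : normedModType R} (A : set X)
  (Ad : forall x, closed_span A x) (A0 : A 0)
  (Asupp : countably_supports A [set: dual_space X])
  (Adiv : forall x n, A x -> A (n.+1%:R^-1 *: x)).

Lemma nonzero_infinite : (exists x : X, x != 0) -> infinite_set A.
Proof.
move=> [x x0]; have [y [Ay y0]] : exists y, A y /\ y != 0.
  apply: contrapT => nA; move/eqP: x0; apply.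
  apply: (@closed_span_min _ _ A [set 0]) (Ad (x:=x)).
  - by split=> // a y z -> ->; rewrite scaler0 addr0.
  - exact/accessible_closed_set1/hausdorff_accessible/norm_hausdorff.
  - by move=> y Ay /=; apply: contrapT => /eqP y0; apply: nA; exists y.
apply/infiniteP/card_le_injP; exists (fun n => n.+1%:R^-1 *: y).
split=> [n _|m n _ _ /eqP]; first exact: Adiv.
rewrite -subr_eq0 -scalerBl scaler_eq0 (negPf y0) orbF subr_eq0.
by move=> /eqP/invr_inj/eqP; rewrite eqr_nat => /eqP[].
Qed.

(** Every nonzero point of [A] is seen by a functional norming some point of [D], and each of these
    functionals sees only countably many points of [A]. *)
Lemma countable_support_le_dense (D : set X) : dense D -> A #<= D.
Proof.
move=> Dd; have closD x : closure D x.
  apply/closure_normP => e e0; have [||y [xy Dy]] := Dd (ball x e).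
  - by exists x; exact: ballxx.
  - exact: ball_open.
  - by exists y => //; move: xy; rewrite -ball_normE.
have [|X0] := pselect (exists x : X, x != 0); last first.
  have all0 (x : X) : x = 0 by apply: contrapT => /eqP x0; apply: X0; exists x.
  have [y [_ Dy]] := Dd setT (ex_intro _ 0 Logic.I) openT.
  by apply: subset_card_le => x _; rewrite (all0 x) -(all0 y).
move=> /nonzero_infinite Ainf.
have Dinf : infinite_set D.
  move=> Dfin; apply: Ainf; apply: (sub_finite_set _ Dfin) => x _.
  have [+ _] := @accessible_finite_set_closed X.
  move=> /(_ (hausdorff_accessible (@norm_hausdorff _ X)) D Dfin) Dclosed.
  by rewrite (closure_id D).1.
have /choice[phi phiP] := @norming_functional R X.
apply: (@card_le_trans _ _ _ ((\bigcup_(d in D) [set x | A x /\ phi d x != 0]) `|` [set 0])).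
  apply: subset_card_le => x Ax; have [->|x0] := eqVneq x 0; [by right|left].
  have x3 : 0 < `|x| / 3 by rewrite divr_gt0 // normr_gt0.
  have /closure_normP/(_ _ x3)[d Dd' xd] := @closD x.
  exists d => //; split => //.
  have [phib phid] := phiP d; apply/eqP => phix.
  have := phib (x - d); rewrite linearB /= phix phid sub0r normrN normr_id.
  by have := ler_normD d (x - d); rewrite [d + _]addrC subrK; lra.
apply: setU_card_le => //.
  by apply: bigcup_countable_card_le => // d _; exact: Asupp.
have [d Dd'] := infinite_setN0 Dinf.
by apply/card_le_injP; exists (fun=> d); split=> [//|x y -> ->].
Qed.

Lemma card_is_dens_support : card_is_dens X A.
Proof.
split; last exact: countable_support_le_dense.
have [D Dd DA] : exists2 D : set X, dense D & D #<= A; last first.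
  exists D => //; apply/card_eqPle; split=> //; exact: countable_support_le_dense.
have denseP (D : set X) : (forall x, closure D x) -> dense D.
  move=> Dx O [x Ox] Oo.
  by have [y [Dy Oy]] := Dx x O (open_nbhs_nbhs (conj Oo Ox)); exists y.
have [/nonzero_infinite Ainf|X0] := pselect (exists x : X, x != 0).
  have [D [_ DA AD]] := span_dense_card Ainf (card_lexx A).
  by exists D => //; apply: denseP => x; apply: AD.
exists A => //; apply: denseP => x; apply: subset_closure.
have -> : x = 0 by apply: contrapT => /eqP x0; apply: X0; exists x.
exact: A0.
Qed.

End Density.

(** * Construction of the resolution *)

Section ToSPRI.
Context {R : realType} {X : completeNormedModType R} (A : set X)
  (Ac : c0_set A) (Ad : forall x, closed_span A x) (A0 : A 0)
  (Adiv : forall x n, A x -> A (n.+1%:R^-1 *: x)).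

(** Refining [r] by [j] inside its classes gives an order in which every initial segment is smaller
    than [A], as the index set of a SPRI demands: for uncountable [A] such a segment lies in one
    [cle d], which is countable or no larger than the elements below [j d]. *)
Lemma initial_resolving : exists (r lt : X -> X -> Prop) (j : X -> X),
  [/\ resolving A A r, strict_well_order lt, set_inj_on A j &
    forall a, A a ->
      ~ (A #<= [set b | A b /\ (r b a \/ ~ r a b /\ lt (j b) (j a))])].
Proof.
have Asupp := c0_set_countably_supports Ac.
have [G Gn] := @norming_system_exists R X.
have [op [opA opP]] := support_op_exists A0 Asupp G.
have Aop : op_closed op A by move=> s k _ _; exact: opA.
have [lt [j [wo jI jinit]]] := initial_well_order A.
(* For countable [A] a single [cle d] may be all of [A]; one class ordered by [j] alone is used
   instead. *)
have [Acount|Acount] := pselect (countable A).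
  exists (fun _ _ => False), lt, j; split=> //.
    exact: (countable_resolving (@Ad) Gn opP (@subset_refl _ A) Aop Acount).
  move=> a Aa AS; apply: (jinit a Aa); apply: card_le_trans AS _.
  by apply/card_le_injP; exists j; split=> [x [_ [//|[_ xa]]]|x y [Ax _] [Ay _]] //; exact: jI.
have opE : op_closure op A = A.
  by apply/seteqP; split; [exact: op_closure_min|exact: op_closure_sub].
have [d Dd|r [rP rcle]] := resolving_step (@Ad) Gn opA opP wo jI (@subset_refl _ A).
  by apply: (resolving_exists (@Ad) Gn opA opP) => x [].
rewrite opE in rP rcle; exists r, lt, j; split=> // a Aa AS.
have [d Dd ad] := rcle a Aa.
have Acle : A #<= cle op lt j A d.
  apply: card_le_trans AS _; apply: subset_card_le => b [Ab ba]; apply: ad; split=> //.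
  case: ba => [ba|[]//] ab.
  have [min_ _ _ _] := rP.
  have [||z zab zmin] := min_ [set a; b].
  - by move=> z [->|->].
  - by exists a; left.
  - by case: zab zmin => -> zmin; [apply: (zmin b) => //; right|apply: (zmin a) => //; left].
have [cl|[_ cl]] := initial_closure_card op d wo jI.
  by apply: Acount; apply: card_le_trans Acle cl.
by apply: (jinit d Dd); apply: card_le_trans Acle cl.
Qed.

Lemma c0_set_SPRI : exists (d : Order.disp_t) (I : tbOrderType d)
    (Q : I -> bounded_proj X),
  [/\ SPRI Q, forall x, A x -> [set Q a x | a in [set: I]] `<=` [set 0; x] &
      forall f, shrinking Q A 0 f].
Proof.
have Asupp := c0_set_countably_supports Ac.
have [r [lt [j [rP wo jI rinit]]]] := initial_resolving.
have [ltwf ltT lttot] := wo; have [rmin nt rcl rspan] := rP.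
have irr x : A x -> ~ r x x.
  by move=> Ax; have [||z -> zmin] := rmin [set x]; [move=> _ ->|exists x|exact: zmin].
have asym x y : A x -> A y -> r x y -> ~ r y x.
  move=> Ax Ay xy yx; have [||z zxy zmin] := rmin [set x; y].
  - by move=> z [->|->].
  - by exists x; left.
  - by case: zxy zmin => -> zmin; [apply: (zmin y) => //; right|apply: (zmin x) => //; left].
have rT x y z : A x -> A y -> A z -> r x y -> r y z -> r x z.
  move=> Ax Ay Az xy yz; have [//|zy] := nt x y z Ax Ay Az xy.
  by case: (asym _ _ Ay Az yz).
pose sim x y := ~ r x y /\ ~ r y x.
have simT x y z : A x -> A y -> A z -> sim x y -> sim y z -> sim x z.
  move=> Ax Ay Az [xy yx] [yz zy]; split=> h.
    by have [|] := nt _ _ y Ax Az Ay h.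
  by have [|] := nt _ _ y Az Ax Ay h.
have simC x y : sim x y -> sim y x by case.
pose ord x y := r x y \/ ~ r y x /\ lt (j x) (j y).
have simr x y z : A x -> A y -> A z -> sim x y -> r y z -> r x z.
  by move=> Ax Ay Az [xy yx] /(nt _ _ x Ay Az Ax)[].
have rsim x y z : A x -> A y -> A z -> r x y -> sim y z -> r x z.
  by move=> Ax Ay Az /[swap] -[yz zy] /(nt _ _ z Ax Ay Az)[].
pose K := set_type A.
pose ordK (a b : K) := ord (val a) (val b).
have KA (a : K) : A (val a) by exact: (set_mem (valP a)).
have ordT x y z : A x -> A y -> A z -> ord x y -> ord y z -> ord x z.
  move=> Ax Ay Az [xy|[yx xy]] [yz|[zy yz]].
  - by left; exact: rT xy yz.
  - have [xz|zy'] := nt _ _ z Ax Ay Az xy; [by left|by []].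
  - have [yx'|xz] := nt _ _ x Ay Az Ax yz; [by []|by left].
  - have [xz|xz] := pselect (r x z); first by left.
    right; split; last exact: ltT xy yz.
    by move=> /(nt _ _ y Az Ax Ay)[].
have ord_min (S : set X) : S `<=` A -> S !=set0 ->
    exists2 z, S z & forall y, S y -> ~ ord y z.
  move=> SA S0; have [z Sz zmin] := rmin S SA S0.
  have [|_ [w [Sw zw] <-] wmin] := @swo_min _ _ wo (j @` [set y | S y /\ sim z y]).
    by exists (j z), z => //; split=> //; split; exact/irr/SA.
  exists w => // y Sy [yw|[wy yw]].
    by apply: (zmin y Sy); apply: rsim yw (simC _ _ zw); exact: SA.
  apply: (wmin (j y)) yw; exists y => //; split=> //.
  split=> [zy|]; last exact: zmin.
  by apply: wy; apply: simr (simC _ _ zw) zy; exact: SA.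
have woK : strict_well_order ordK.
  split=> [a|a b c|a b]; last 2 first.
  - exact: ordT.
  - have [h|h|h] := lttot (j (val a)) (j (val b)).
    + have [ba|ba] := pselect (r (val b) (val a)).
        by constructor 3; left.
      by constructor 1; right.
    + by constructor 2; apply: val_inj; exact: jI h.
    + have [ab|ab] := pselect (r (val a) (val b)).
        by constructor 1; left.
      by constructor 3; right.
  apply: contrapT => na.
  have [||z [b nb bz] zmin] := ord_min (val @` [set a | ~ Acc ordK a]).
  - by move=> _ [b _ <-].
  - by exists (val a), a.
  apply: nb; constructor => c cb; apply: contrapT => nc.
  by apply: (zmin (val c)); [exists c|rewrite -bz].
have [d [I [emb [embE embT embP Iwo]]]] := topped_order woK (SigSub (mem_set A0) : K).
have embI a b : emb a = emb b -> a = b.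
  move=> E; have [_ _ tot] := woK; have [ab|//|ab] := tot a b.
    by have /embE := ab; rewrite E ltxx.
  by have /embE := ab; rewrite E ltxx.
have mkK x : A x -> exists a : K, val a = x.
  by move=> Ax; exists (SigSub (mem_set Ax) : K).
have embP' (i : I) : i = \top%O \/ exists a, i = emb a.
  have [->|it] := eqVneq i \top%O; first by left.
  by right; apply: embP; rewrite lt_neqAle it lex1.
(* The classes before that of x, and the class of x itself unless x is its
   first element: a class is added at its second element (or at the next class),
   hence at a successor, even when it has no last element. *)
pose cut x := [set y | A y /\ (r y x \/ sim x y /\ exists c, [/\ A c, sim c x & lt (j c) (j x)])].
pose S (i : I) := [set y | A y /\ forall a, i = emb a -> cut (val a) y].
have SA i : S i `<=` A by move=> x [].
have Stop : S \top%O = A.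
  apply/seteqP; split=> // x Ax; split=> // a E.
  by have := embT a; rewrite -E ltxx.
have Semb a : S (emb a) = cut (val a).
  apply/seteqP; split=> x; first by case=> _; apply.
  by move=> cx; split=> [|b /embI <- //]; have [] := cx.
have Sd i : has_diag A (S i).
  have [->|[a ->]] := embP' i; first by rewrite Stop; exact: has_diagT.
  have [_ cd bd] := rcl _ (KA a); rewrite Semb.
  have [[c [Ac' ca lca]]|nc] := pselect (exists c, [/\ A c, sim c (val a) & lt (j c) (j (val a))]).
    have -> : cut (val a) = below r A (val a) `|` class r A (val a).
      apply/seteqP; split=> y.
        by move=> [Ay [ya|[[ay ya] _]]]; [left|right].
      move=> [[Ay ya]|[Ay ay ya]]; split=> //; [by left|right].
      by split=> //; exists c.
    by apply: has_diagU => // y [].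
  have -> : cut (val a) = below r A (val a) => //.
  by apply/seteqP; split=> y [Ay ya]; split=> //; [case: ya => // -[]|left].
have cut_lt x a : A x -> A a -> ord x a -> cut a x.
  move=> Ax Aa [xa|[ax xa]]; split=> //; first by left.
  have [h|h] := pselect (r x a); [by left|right].
  by split=> //; exists x.
have cut_ge x a : A a -> cut a x -> ord x a \/
    sim a x /\ exists c, [/\ A c, sim c a & ord c a].
  move=> Aa [Ax [xa|[ax [c [Ac' ca lca]]]]]; first by left; left.
  right; split=> //; exists c; split=> //; right; split=> //; exact: ca.2.
have cut_mono a b : A a -> A b -> ord a b -> cut a `<=` cut b.
  move=> Aa Ab [ab|[ba ab]] y [Ay ya]; split=> //.
    left; case: ya => [ya|[ay _]]; first exact: rT ya ab.
    by apply: simr (simC _ _ ay) ab.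
  have [ab'|ab'] := pselect (r a b).
    left; case: ya => [ya|[ay _]]; first exact: rT ya ab'.
    by apply: simr (simC _ _ ay) ab'.
  have simab : sim a b by [].
  case: ya => [ya|[ay _]]; first by left; exact: rsim ya simab.
  right; split; first exact: simT (simC _ _ simab) ay.
  by exists a.
have Smono i k : (i <= k)%O -> S i `<=` S k.
  rewrite le_eqVlt => /orP[/eqP -> //|ik].
  have [->|[b kb]] := embP' k; first by rewrite Stop; exact: SA.
  have [it|[a ia]] := embP' i; first by move: ik; rewrite it ltNge lex1.
  rewrite ia kb !Semb; apply: cut_mono => //.
  by apply/embE; rewrite -ia -kb.
have [Q QE] := diag_bounded_proj (@Ad) Sd.
have Qx i x : A x -> (S i x -> Q i x = x) /\ (~ S i x -> Q i x = 0).
  by move=> Ax; rewrite QE; exact: (diagP (Sd i)).2.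
have QB i k x : (i <= k)%O -> Q k x - Q i x = diag A (S k `\` S i) x.
  by move=> ik; rewrite !QE (diag_sub (@Ad)) //; exact: Smono.
(* A successor step adds points of one countable class only, which yields separability of its
   range. *)
have jump_class a k : is_succ (emb a) k -> S k `\` S (emb a) `<=` class r A (val a).
  move=> [ak kmin] x [[Ax kx] ax]; rewrite Semb in ax.
  have [x' xE] := mkK x Ax.
  have nxa : ~ ord x (val a) by move=> xa; apply: ax; exact: cut_lt.
  split=> //; last by move=> xa; apply: nxa; left.
  move=> rax.
  have kx' : (k <= emb x')%O by apply: kmin; apply/embE; left; rewrite xE.
  have kt : (k < \top)%O by exact: le_lt_trans kx' (embT x').
  have [b kb] := embP _ kt.
  have := kx b kb; move=> /(cut_ge _ _ (KA b)) [xb|[bx [c [Ac' cb ocb]]]].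
    have : (emb x' < emb b)%O by apply/embE; rewrite /ordK xE.
    by rewrite -kb ltNge kx'.
  have [c' cE] := mkK c Ac'.
  have ck : (emb c' < k)%O by rewrite kb; apply/embE; rewrite /ordK cE.
  have rac : r (val a) c.
    apply: rsim rax _ => //; apply: (simT _ (val b)) => //; exact: simC.
  have : (k <= emb c')%O by apply: kmin; apply/embE; left; rewrite cE.
  by rewrite leNgt ck.
have [g gE] : exists g : I -> X, forall a, g (emb a) = val a.
  have /choice[g gE] : forall i, exists x, forall a, i = emb a -> val a = x.
    move=> i; have [->|[a ->]] := embP' i; last by exists (val a) => b /embI ->.
    by exists 0 => a E; have := embT a; rewrite -E ltxx.
  by exists g => a; apply/esym/gE.
have gI i k : (i < \top)%O -> (k < \top)%O -> g i = g k -> i = k.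
  move=> /embP[a ->] /embP[b ->]; rewrite !gE => ab; congr emb; exact: val_inj.
have CA : [set i : I | (i < \top)%O] #= A.
  apply/card_eqPle; split.
    apply/card_le_injP; exists g; split=> [i /embP[a ->]|i k it kt].
      by rewrite gE; exact: KA.
    exact: gI.
  apply: (@card_le_trans _ _ _ (g @` [set i : I | (i < \top)%O])); last exact: card_image_le.
  apply: subset_card_le => x /mkK[a <-]; exists (emb a); [exact: embT|exact: gE].
have dens := card_is_dens_support (@Ad) A0 Asupp Adiv.
exists d, I, Q; split; last 2 first.
- move=> x Ax _ [i _ <-]; have [Sx|Sx] := pselect (S i x).
    by right; exact: (Qx i x Ax).1.
  by left; exact: (Qx i x Ax).2.
- move=> f; apply: (@c0_shrinking R X A d I Q S f Ac) => //.
  move=> s_ s x s_incr [sub slb] Ax Sx.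
  have sgt i : (i < s)%O -> exists n, (i < s_ n)%O.
    move=> is_; apply: contrapT => ni; move: is_; rewrite ltNge => /negP; apply.
    apply: slb => _ [n _ <-]; rewrite leNgt; apply/negP => isn; apply: ni.
    by exists n.
  have [x' xE] := mkK x Ax.
  have S_lt k : (emb x' < k)%O -> S k x.
    move=> xk; split=> // a kE; apply: cut_lt => //.
    by rewrite -xE; apply/embE; rewrite -kE.
  (* If [x] is not below [s], it entered [S s] with its class, thanks to an earlier member [c]. Some
     [s_ n] exceeds [c]; lying between [c] and [s], it indexes a point of the same class and its cut
     already contains the class. *)
  have [xs|xs] := boolP (emb x' < s)%O.
    by have [n xn] := sgt _ xs; exists n; exact: S_lt.
  have st : (s < \top)%O by apply: le_lt_trans (embT x'); rewrite leNgt.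
  have [b sb] := embP _ st.
  have /(cut_ge _ _ (KA b)) [xb|[bx [c [Ac' cb ocb]]]] := Sx.2 b sb.
    by case/negP: xs; rewrite sb; apply/embE; rewrite /ordK xE.
  have [c' cE] := mkK c Ac'.
  have [n cn] : exists n, (emb c' < s_ n)%O.
    by apply: sgt; rewrite sb; apply/embE; rewrite /ordK cE.
  exists n; have sns : (s_ n <= s)%O by apply: sub; exists n.
  have [u uE] := embP _ (le_lt_trans sns st).
  have ocu : ord c (val u).
    by move: cn; rewrite uE => /embE; rewrite /ordK cE.
  have nbu : ~ ord (val b) (val u).
    by move=> bu; move: sns; rewrite leNgt uE sb => /negP; apply; apply/embE.
  have scu : sim c (val u).
    split; last by case: ocu => [/asym h|[]//]; apply: h.
    move=> /(nt _ _ (val b) Ac' (KA u) (KA b))[|bu]; first exact: cb.1.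
    by apply: nbu; left.
  rewrite uE Semb; split=> //; right; split.
    apply: (simT _ c) => //; first exact: simC.
    exact: (simT _ (val b)).
  exists c; split=> //; case: ocu => [h|[_]//]; by case: scu => /(_ h).
split.
- split=> //.
  + split; first by have [[D Dd AD] _] := dens; exists D => //; exact: card_eq_trans CA AD.
    by move=> D /dens.2; apply: card_le_trans; have /card_eqPle[] := CA.
  + move=> i it CS; have [a ia] := embP _ it; apply: (rinit _ (KA a)).
    have /card_eqPle[_ AC] := CA.
    apply: card_le_trans AC _; apply: card_le_trans CS _.
    apply/card_le_injP; exists g; split=> [k /= ki|k l ki li].
      have [b kb] := embP _ (lt_trans ki it).
      rewrite kb gE; split; first exact: KA.
      by apply/embE; rewrite -kb -ia.
    by apply: gI; [exact: lt_trans ki it|exact: lt_trans li it].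
- move=> x; rewrite QE; apply: (diag0 (@Ad)) => // y Ay.
  have [b bE] := embP _ (le_lt_trans (le0x (emb (SigSub (mem_set A0) : K))) (embT _)).
  rewrite bE Semb => /(cut_ge _ _ (KA b))[yb|[_ [c [Ac' _ cb]]]].
    have [y' yE] := mkK y Ay.
    have : (emb y' < emb b)%O by apply/embE; rewrite /ordK yE.
    by rewrite -bE ltx0.
  have [c' cE] := mkK c Ac'.
  have : (emb c' < emb b)%O by apply/embE; rewrite /ordK cE.
  by rewrite -bE ltx0.
- by move=> x; rewrite QE Stop diag_id //; exact: has_diagT.
- move=> i k it ik; have [a ia] := embP _ it; rewrite ia in ik *.
  have ak : (emb a <= k)%O by rewrite ltW // ik.1.
  set E := S k `\` S (emb a).
  have Ec : countable E.
    have [cc _ _] := rcl _ (KA a); apply: sub_countable cc.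
    by apply: subset_card_le; exact: jump_class.
  have EA : E `<=` A by move=> x [[]].
  have Ed : has_diag A E by exact: has_diagD.
  have -> : range (fun x => Q k x - Q (emb a) x) = closed_span E.
    apply/seteqP; split=> [_ [x _ <-]|x Ex].
      by rewrite QB //; exact: diag_range.
    by exists x => //; rewrite QB // diag_id.
  have [D [DE Dc ED]] := span_dense_card infinite_nat Ec.
  by exists D; split=> // x /DE; exact: subset_closure.
- move=> i k x it ki; rewrite !QE !(diag_comp (@Ad)) //.
  by rewrite (setIidr (Smono _ _ ki)) (setIidl (Smono _ _ ki)).
- move=> x; have := rspan x (@Ad x); apply: closed_spanS => _ [y Ay <-].
  have clA : class r A y `<=` A by move=> z [].
  (* The whole class is added in the step from its first element [m] to the successor of [m], so the
     class projection is a single difference. *)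
  have [|m ym mmin] := ord_min (class r A y) clA.
    by exists y; split=> //; exact: irr.
  have my := class_eq rP Ay ym; have [m' mE] := mkK m (clA _ ym).
  have Am := clA _ ym.
  have [|k mk kmin] := well_order_min Iwo (A := [set i : I | (emb m' < i)%O]).
    by exists \top%O; exact: embT.
  have msucc : is_succ (emb m') k by [].
  exists (emb m'), k; split=> //; rewrite QB ?ltW // -my; congr (diag A _ x).
  apply/seteqP; split; last by have := jump_class _ _ msucc; rewrite mE.
  move=> z [Az mz zm]; split; last first.
    rewrite Semb mE => /(cut_ge _ _ Am) [|[_ [c [Ac' [cm mc]]]]]; apply: mmin.
      by rewrite -my.
    by rewrite -my.
  split=> // b kb; have /embE mb : (emb m' < emb b)%O by rewrite -kb.
  rewrite /ordK mE in mb; split=> //.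
  case: mb => [mb|[bm mb]]; first by left; exact: simr (conj zm mz) mb.
  have [mb'|mb'] := pselect (r m (val b)).
    by left; exact: simr (conj zm mz) mb'.
  right; split; first exact: (simT _ m).
  by exists m.
Qed.

End ToSPRI.

Theorem theorem29 (R : realType) (X : completeNormedModType R) :
  (WCG X <->
     exists (d : Order.disp_t) (G : porderType d) (P : G -> bounded_proj X)
            (A : set X),
       [/\ projectional_skeleton P, A !=set0 /\ A `<=` @unit_ball R X,
           linearly_dense A /\ countably_supports A [set: dual_space X] &
           forall f : dual_space X, shrinking P A 0 f])
  /\
  (WCG X <->
     exists (d : Order.disp_t) (I : tbOrderType d) (Q : I -> bounded_proj X)
            (A : set X),
       [/\ SPRI Q, A !=set0 /\ A `<=` @unit_ball R X,
           linearly_dense A /\ countably_supports A [set: dual_space X],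
           forall x, A x -> [set Q a x | a in [set: I]] `<=` [set 0; x] &
           forall f : dual_space X, shrinking Q A 0 f]).
Proof.
have toC0 : WCG X -> exists A, [/\ c0_set A, forall x, closed_span A x, A 0,
    A `<=` @unit_ball R X & forall x n, A x -> A (n.+1%:R^-1 *: x)].
  by move=> /WCG_c0_set[A [Ac Ad]]; exact: c0_set_normalize Ad.
have dense A : (forall x, closed_span A x) -> linearly_dense A.
  by move=> Ad; apply/seteqP; split=> // x _; exact: Ad.
split; split=> [/toC0[A [Ac Ad A0 A1 Adiv]]|].
- have [d [I [P [sP shr]]]] := c0_set_skeleton Ac (@Ad) A0.
  exists d, I, P, A; split=> //; first by split=> //; exists 0.
  by split; [exact: dense|exact: c0_set_countably_supports].
- move=> [d [I [P [A [sP [_ A1] [Ad Asupp] shr]]]]].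
  have [w wA] := skeleton_c0_weight sP A1 Asupp shr.
  exact: c0_weight_WCG wA Ad.
- have [d [I [Q [sQ QA shr]]]] := c0_set_SPRI Ac (@Ad) A0 Adiv.
  exists d, I, Q, A; split=> //; first by split=> //; exists 0.
  by split; [exact: dense|exact: c0_set_countably_supports].
- move=> [d [I [Q [A [sQ [_ A1] [Ad Asupp] QA shr]]]]].
  have [w wA] := SPRI_c0_weight sQ A1 Asupp QA shr.
  exact: c0_weight_WCG wA Ad.
Qed.
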